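(* For every integer $k\geq 2$ the threefold $W_k$ admits infinitely many isomorphism classes (as complex manifolds) of deformations. Some of these deformations support nontrivial moduli of vector bundles.
   Context: For $k\geq 1$, $W_k=\mathrm{Tot}(\mathcal{O}_{\mathbb{P}^1}(-k)\oplus\mathcal{O}_{\mathbb{P}^1}(k-2))$ is obtained by gluing $U=\mathbb{C}^3_{\{z,u_1,u_2\}}$ and $V=\mathbb{C}^3_{\{\xi,v_1,v_2\}}$ by $(\xi,v_1,v_2)=(z^{-1},z^ku_1,z^{-k+2}u_2)$ for $z,\xi\neq 0$. A deformation family of a complex manifold $X$ is a holomorphic surjective submersion $\pi\colon\tilde X\to D$, where $D$ is a complex disc centered at $0$ (possibly a vector space, possibly infinite dimensional), with $\pi^{-1}(0)=X$ and $\tilde X$ locally trivial over $D$ in the $C^\infty$ category; the fibers $\pi^{-1}(t)$ are called deformations of $X$. Moduli of vector bundles: for a deformation $X$ glued from charts $U=\mathbb{C}^3_{\{z,u_1,u_2\}}$, $V=\mathbb{C}^3_{\{\xi,v_1,v_2\}}$ with $\xi=z^{-1}$ and containing the line $\ell\cong\mathbb{P}^1$ given by $u_1=u_2=0$, let $\mathcal{O}(j)$ be the line bundle pulled back from $\mathcal{O}_{\mathbb{P}^1}(j)$, with transition function $z^{-j}$. For an integer $j\ge 0$, the moduli of rank 2 bundles of splitting type $j$ is $$\mathfrak{M}_j(X)=\mathrm{Ext}^1_X(\mathcal{O}(j),\mathcal{O}(-j))/\sim,$$ where $\sim$ is isomorphism of the bundles with transition matrices $\begin{pmatrix} z^j&p\\0&z^{-j}\end{pmatrix}$,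 and only first-order extension classes $p=p_1(z,z^{-1})u_1+p_2(z,z^{-1})u_2$ are considered. The moduli is nontrivial if it is not reduced to a single point, i.e. there are non-isomorphic bundles given by such first-order classes. *)

(* Defs.v *)
From HB Require Import structures.
From mathcomp Require Import all_boot all_order all_algebra.
From mathcomp Require Import complex.
From mathcomp Require Import all_classical all_reals all_analysis.

Set Implicit Arguments.
Unset Strict Implicit.
Unset Printing Implicit Defensive.

Import Order.TTheory GRing.Theory Num.Theory numFieldNormedType.Exports.
Local Open Scope ring_scope.
Local Open Scope classical_set_scope.

(* The complex numbers are R[i] for an arbitrary R : realType.  A map between
   normed spaces over R[i] is holomorphic on an open set when it is
   (complex-Frechet) differentiable at each of its points. *)

(* [real_Ck n A f]: f is n times continuously differentiable over the REAL
   numbers on the open set A.  Normed spaces over R[i] carry no real normed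
   structure in the library, so the definition goes through the iterated
   directional derivatives D f (x, v) = lim_(h -> 0, h real) (f (x + h v) - f x) / h,
   required to be jointly continuous in (x, v). *)
Fixpoint real_Ck (R : realType) (F : normedModType R[i]) (n : nat)
    (E : normedModType R[i]) (A : set E) (f : E -> F) {struct n} : Prop :=
  (forall x, A x -> {for x, continuous f}) /\
  match n with
  | 0 => True
  | m.+1 => exists Df : (E * E)%type -> F,
      (forall x v, A x ->
         ((h%:C)%C^-1 *: (f (x + (h%:C)%C *: v) - f x)) @[h --> (0 : R)^']
           --> Df (x, v)) /\
      real_Ck m (A `*` [set: E]) Df
  end.

Definition real_smooth (R : realType) (E F : normedModType R[i])
    (A : set E) (f : E -> F) : Prop :=
  forall n, real_Ck n A f.

Record chart (R : realType) (M : topologicalType) (E : normedModType R[i]) :=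
  Chart {
    cdom : set M;
    cfun : M -> E;
    cinv : E -> M;   (* only meaningful on the image of cdom *)
    cdom_open : open cdom;
    cimg_open : open (cfun @` cdom);
    cfunK : forall x, cdom x -> cinv (cfun x) = x;
    cfun_continuous : {within cdom, continuous cfun};
    cinv_continuous : {within cfun @` cdom, continuous cinv} }.

Definition holo_compatible (R : realType) (M : topologicalType)
    (E : normedModType R[i]) (c d : chart M E) : Prop :=
  forall x, cdom c x -> cdom d x ->
    differentiable (cfun d \o cinv c) (cfun c x) /\
    differentiable (cfun c \o cinv d) (cfun d x).

(* Complex manifolds modelled on E; 'rV[R[i]]_3 is the model for threefolds,
   an infinite dimensional E is needed for total spaces over infinite
   dimensional bases. *)
Record complex_manifold (R : realType) (E : normedModType R[i]) := ComplexManifold {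
  carrier :> topologicalType;
  cm_hausdorff : hausdorff_space carrier;
  cm_second_countable : @second_countable carrier;
  atlas : set (chart carrier E);
  atlas_cover : forall x : carrier, exists2 c, atlas c & cdom c x;
  atlas_compatible : forall c d, atlas c -> atlas d -> holo_compatible c d }.

Definition threefold (R : realType) := complex_manifold 'rV[R[i]]_3.

Definition holo_chart (R : realType) (E : normedModType R[i])
    (M : complex_manifold E) (c : chart M E) : Prop :=
  forall d, atlas d -> holo_compatible c d.

Definition holomorphic (R : realType) (E F : normedModType R[i])
    (M : complex_manifold E) (N : complex_manifold F) (f : M -> N) : Prop :=
  continuous f /\
  forall (c : chart M E) (d : chart N F), atlas c -> atlas d ->
  forall x, cdom c x -> cdom d (f x) ->
    differentiable (cfun d \o f \o cinv c) (cfun c x).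

Definition biholomorphic (R : realType) (E F : normedModType R[i])
    (M : complex_manifold E) (N : complex_manifold F) : Prop :=
  exists (f : M -> N) (g : N -> M),
    [/\ cancel f g, cancel g f, holomorphic f & holomorphic g].

(* The complex discs centered at 0, the whole space included. *)
Definition is_disc (R : realType) (B : normedModType R[i]) (D : set B) : Prop :=
  D = [set: B] \/ exists2 r : R[i], 0 < r & D = ball (0 : B) r.

(* For maps to a vector space: the differential, read in any chart, is a
   surjection with a continuous linear right inverse (automatic from
   surjectivity when the base is finite dimensional). *)
Definition holo_submersion (R : realType) (E B : normedModType R[i])
    (M : complex_manifold E) (pi : M -> B) : Prop :=
  continuous pi /\
  forall c : chart M E, atlas c -> forall x, cdom c x ->
    differentiable (pi \o cinv c) (cfun c x) /\
    exists2 s : {linear B -> E}, continuous s &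
      cancel s ('d (pi \o cinv c) (cfun c x)).

(* i identifies the complex manifold X with the fiber pi^-1(t): it is a
   holomorphic embedding (immersion and homeomorphism onto its image) with
   image the fiber. *)
Definition fiber_identification (R : realType) (m : nat)
    (E B : normedModType R[i]) (X : complex_manifold 'rV[R[i]]_m)
    (M : complex_manifold E) (pi : M -> B) (t : B) (i : X -> M) : Prop :=
  [/\ injective i,
      range i = pi @^-1` [set t],
      forall O : set X, open O -> exists2 O' : set M, open O' & O = i @^-1` O',
      holomorphic i &
      forall (c : chart X 'rV[R[i]]_m) (d : chart M E), atlas c -> atlas d ->
      forall x, cdom c x -> cdom d (i x) ->
        injective ('d (cfun d \o i \o cinv c) (cfun c x))].

(* Phi and Psi are the components of a real-smooth diffeomorphism
   y |-> (Phi y, pi y) from pi^-1(N) onto F x N, and of its inverse. *)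
Definition smooth_trivialization (R : realType) (E G B : normedModType R[i])
    (M : complex_manifold E) (F : complex_manifold G) (pi : M -> B) (N : set B)
    (Phi : M -> F) (Psi : F * B -> M) : Prop :=
  [/\ forall y, N (pi y) -> Psi (Phi y, pi y) = y,
      forall x t, N t -> pi (Psi (x, t)) = t /\ Phi (Psi (x, t)) = x,
      forall y, N (pi y) -> {for y, continuous Phi},
      forall x t, N t -> {for (x, t), continuous Psi} &
      forall (c : chart M E) (d : chart F G), atlas c -> atlas d ->
        real_smooth
          (cfun c @` [set y | [/\ cdom c y, N (pi y) & cdom d (Phi y)]])
          (cfun d \o Phi \o cinv c) /\
        real_smooth
          [set ut : G * B | [/\ (cfun d @` cdom d) ut.1, N ut.2 &
                                cdom c (Psi (cinv d ut.1, ut.2))]]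
          (fun ut : G * B => cfun c (Psi (cinv d ut.1, ut.2)))].

Record deformation_family (R : realType) (m : nat)
    (X0 : complex_manifold 'rV[R[i]]_m) := DeformationFamily {
  base : normedModType R[i];
  disc : set base;
  total_model : normedModType R[i];
  total : complex_manifold total_model;
  proj : total -> base;
  disc_is_disc : is_disc disc;
  proj_onto : range proj = disc;
  proj_submersion : holo_submersion proj;
  central_fiber : exists i : X0 -> total, fiber_identification proj 0 i;
  (* the disc being connected, the typical fiber is the central one *)
  locally_trivial : forall t, disc t ->
    exists N : set base, [/\ open N, N t, N `<=` disc &
      exists (Phi : total -> X0) (Psi : X0 * base -> total),
        smooth_trivialization proj N Phi Psi] }.

Definition deformation (R : realType) (m : nat)
    (X0 X : complex_manifold 'rV[R[i]]_m) : Prop :=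
  exists (T : deformation_family X0) (t : base T) (i : X -> total T),
    disc t /\ fiber_identification (@proj _ _ _ T) t i.

(* Coordinates (z, u1, u2), resp. (xi, v1, v2), on C^3. *)
Definition C3 (R : realType) (a b c : R[i]) : 'rV[R[i]]_3 :=
  \row_(l < 3) [:: a; b; c]`_l.
Definition crd0 (R : realType) (x : 'rV[R[i]]_3) : R[i] := x 0 (@Ordinal 3 0 isT).
Definition crd1 (R : realType) (x : 'rV[R[i]]_3) : R[i] := x 0 (@Ordinal 3 1 isT).
Definition crd2 (R : realType) (x : 'rV[R[i]]_3) : R[i] := x 0 (@Ordinal 3 2 isT).

(* X is the union of two copies U and V of C^3 (with coordinate maps cU, cV),
   whose overlap is z <> 0 in U and xi <> 0 in V and which are identified there
   by g.  The values of g on z = 0 are irrelevant. *)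
Definition glued (R : realType) (X : threefold R) (cU cV : chart X 'rV[R[i]]_3)
    (g : 'rV[R[i]]_3 -> 'rV[R[i]]_3) : Prop :=
  [/\ holo_chart cU /\ holo_chart cV,
      cfun cU @` cdom cU = [set: 'rV[R[i]]_3] /\
      cfun cV @` cdom cV = [set: 'rV[R[i]]_3],
      cdom cU `|` cdom cV = [set: X],
      cfun cU @` (cdom cU `&` cdom cV) = [set x | crd0 x != 0] /\
      cfun cV @` (cdom cU `&` cdom cV) = [set x | crd0 x != 0] &
      forall y, cdom cU y -> cdom cV y -> cfun cV y = g (cfun cU y)].

Definition W_transition (R : realType) (k : nat) (x : 'rV[R[i]]_3) : 'rV[R[i]]_3 :=
  C3 (crd0 x)^-1 (crd0 x ^+ k * crd1 x) (crd0 x ^ (2%:Z - k%:Z) * crd2 x).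

(* X is (a model of) the total space of O(-k) + O(k-2) over P^1. *)
Definition is_W (R : realType) (k : nat) (X : threefold R) : Prop :=
  exists cU cV : chart X 'rV[R[i]]_3, glued cU cV (@W_transition R k).

(* p(z, z^-1); the inner variable of p stands for z, the outer one for z^-1. *)
Definition laurent_eval (R : realType) (p : {poly {poly R[i]}}) (z : R[i]) : R[i] :=
  p.[(z^-1)%:P].[z].

Definition first_order_class (R : realType) (p1 p2 : {poly {poly R[i]}})
    (x : 'rV[R[i]]_3) : R[i] :=
  laurent_eval p1 (crd0 x) * crd1 x + laurent_eval p2 (crd0 x) * crd2 x.

Definition ext_matrix (R : realType) (j : nat) (p : 'rV[R[i]]_3 -> R[i])
    (x : 'rV[R[i]]_3) : 'M[R[i]]_2 :=
  \matrix_(a < 2, b < 2)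
    if a == 0 then (if b == 0 then crd0 x ^+ j else p x)
    else (if b == 0 then 0 else crd0 x ^- j).

(* Isomorphism of the bundles on the threefold glued by g with transition
   matrices ext_matrix j p and ext_matrix j q: holomorphic changes of frame A
   over U and A' over V intertwining them. *)
Definition bundle_iso (R : realType) (g : 'rV[R[i]]_3 -> 'rV[R[i]]_3) (j : nat)
    (p q : 'rV[R[i]]_3 -> R[i]) : Prop :=
  exists A A' : 'rV[R[i]]_3 -> 'M[R[i]]_2,
    [/\ forall x, differentiable A x /\ A x \in unitmx,
        forall x, differentiable A' x /\ A' x \in unitmx &
        forall x, crd0 x != 0 ->
          A' (g x) *m ext_matrix j p x = ext_matrix j q x *m A x].

Definition nontrivial_moduli (R : realType) (g : 'rV[R[i]]_3 -> 'rV[R[i]]_3)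
    (j : nat) : Prop :=
  exists p1 p2 q1 q2 : {poly {poly R[i]}},
    ~ bundle_iso g j (first_order_class p1 p2) (first_order_class q1 q2).

(* X is glued from U and V with xi = z^-1, contains the line
   u1 = u2 = 0 (v1 = v2 = 0 in V), and has a nontrivial moduli of rank 2 bundles
   of some splitting type j. *)
Definition supports_nontrivial_moduli (R : realType) (X : threefold R) : Prop :=
  exists (cU cV : chart X 'rV[R[i]]_3) (g : 'rV[R[i]]_3 -> 'rV[R[i]]_3),
    [/\ glued cU cV g,
        forall x, crd0 x != 0 -> crd0 (g x) = (crd0 x)^-1,
        forall z, z != 0 -> g (C3 z 0 0) = C3 z^-1 0 0 &
        exists j : nat, nontrivial_moduli g j].

(* Main.v *)
From HB Require Import structures.
Require Import Defs.
From mathcomp Require Import all_boot all_order all_algebra.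
From mathcomp Require Import complex.
From mathcomp Require Import all_classical all_reals all_analysis.
From mathcomp Require Import ring lra.

(** The threefold W_k is deformed over the affine line.  With the exponent
    written as k + 2, the fiber over t is obtained by gluing U and V along
      v2 = z^(-k) u2 + t z^(-k-1) q(u1),   v1 = z^(k+2) (u1 + t v2),
    where q is a polynomial; t = 0 gives back W_(k+2).  Let X_n be the fiber
    over t = 1 when q(w) = w (w - 1) ... (w - (n - 1)).

    _This is a deformation family._  Over the smooth functions the deformed
    gluing is conjugate to the original one: there are diffeomorphisms of U and
    V, depending on t, with coefficients rational in z and its conjugate, that
    carry one to the other ([gluing_twist], [gluing_inv_twist]).  So the total
    space is the product of W with the line as a smooth manifold, with other
    holomorphic charts, and the trivialization is the identity.  Its smoothness
    in the sense of iterated directional derivatives rests on two facts: the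
    differential of a holomorphic function is again holomorphic ([diff_diff],
    a consequence of Cauchy's formula), and the class of functions used for the
    induction, which is closed under composition and contains the
    conjugation ([hadamard_Ck_comp], [hadamard_Ck_Rlinear]).

    _The X_n are pairwise not isomorphic._  Say that two points are unseparated
    when all global holomorphic functions agree on them; isomorphisms preserve
    this relation.  On X_n there are four functions a, b, c, w, polynomial in
    each chart, with w = u1 on U, and two distinct points on which they agree
    satisfy q(w) = a = c = 0 ([unseparated_exceptional]).  These equations define
    one projective line over each root of q, and by Liouville's theorem the points
    of a projective line are unseparated ([exceptional_line]).  So the number of
    classes with more than one point is n, and n is an invariant ([fewer_roots]).

    _W is not isomorphic to X_1._  In W every point of U with u1 = 0 lies on a
    projective line, so an isomorphism would map the surface u1 = 0 into a
    single line of X_1, which the injectivity of its differential forbids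
    ([W_not_biholomorphic]).

    _Bundles on X_1._  For splitting type 2 the class z u2 is not isomorphic to
    the trivial one.  In a pair of intertwining frame changes the first diagonal
    entry is a nonzero constant a0 on the line; the derivative in the direction
    u2 of the equation for the off-diagonal entry says that
    a0 z + h(1/z) = z^2 g(z) with g and h entire, and Liouville's theorem makes
    z^2 g(z) - a0 z constant, so that a0 = 0 ([no_intertwiner]). *)

Set Implicit Arguments.
Unset Strict Implicit.
Unset Printing Implicit Defensive.

Import Order.TTheory GRing.Theory Num.Theory numFieldNormedType.Exports.
Local Open Scope ring_scope.
Local Open Scope classical_set_scope.
Local Notation Re := (@complex.Re _).
Local Notation Im := (@complex.Im _).

(** * Real-valued norms *)

Section Norm.
Variable R : realType.
Local Notation C := (R[i]^o).

Section OneSpace.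
Variable V : normedModType R[i].

(** The norm of a space over R[i] takes its values in R[i], whose order is partial.
    Its real part carries the same information and allows the order of R to be used. *)
Definition nrm (x : V) : R := Re `|x|.

Lemma nrmE (x : V) : `|x| = (nrm x)%:C%C.
Proof. by rewrite /nrm RRe_real// normr_real. Qed.

Lemma nrm_ge0 (x : V) : 0 <= nrm x.
Proof. by rewrite -ler0c -nrmE. Qed.

Lemma nrm0 : nrm 0 = 0.
Proof. by rewrite /nrm normr0. Qed.

Lemma nrm0_eq0 (x : V) : nrm x = 0 -> x = 0.
Proof. by move=> x0; apply/eqP; rewrite -normr_eq0 nrmE x0. Qed.

Lemma nrmN (x : V) : nrm (- x) = nrm x.
Proof. by rewrite /nrm normrN. Qed.

Lemma nrmD (x y : V) : nrm (x + y) <= nrm x + nrm y.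
Proof. by rewrite -lecR rmorphD/= -!nrmE ler_normD. Qed.

Lemma nrmB (x y : V) : nrm (x - y) <= nrm x + nrm y.
Proof. by rewrite -[nrm y]nrmN nrmD. Qed.

Lemma nrmC (x y : V) : nrm (x - y) = nrm (y - x).
Proof. by rewrite -nrmN opprB. Qed.

Lemma nbhs_nrm (x : V) (A : set V) :
  nbhs x A <-> exists2 e : R, 0 < e & forall y, nrm (y - x) < e -> A y.
Proof.
split.
  move/nbhs_ballP => [e /= e0 xA].
  have eR : e = (Re e)%:C%C by rewrite RRe_real// gtr0_real.
  exists (Re e); first by rewrite -ltcR -eR.
  move=> y yx; apply: xA; rewrite -ball_normE/= -normrN opprB nrmE eR ltcR.
  exact: yx.
move=> [e e0 xA]; apply/nbhs_ballP; exists (e%:C)%C => /=; first by rewrite ltcR.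
move=> y; rewrite -ball_normE/= -normrN opprB nrmE ltcR; exact: xA.
Qed.

End OneSpace.

Lemma nrmZ (V : normedModType R[i]) (a : C) (x : V) : nrm (a *: x) = nrm a * nrm x.
Proof.
apply: (@complexI R); rewrite rmorphM/= -nrmE normrZ nrmE; congr (_ * _).
Qed.

Lemma nrmM (a b : C) : nrm (a * b) = nrm a * nrm b.
Proof. exact: nrmZ. Qed.

Lemma nrm_real (a : R) : nrm ((a%:C)%C : C) = `|a|.
Proof. by rewrite /nrm normc_def/= expr0n/= addr0 sqrtr_sqr. Qed.

Lemma nrm1 : nrm (1 : C) = 1.
Proof. by rewrite /nrm normr1. Qed.

Lemma nrmV (a : C) : nrm a^-1 = (nrm a)^-1.
Proof.
have [->|a0] := eqVneq a 0; first by rewrite invr0 nrm0 invr0.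
apply: (@mulfI _ (nrm a)); first by apply: contra_neq a0; exact: nrm0_eq0.
rewrite -nrmM mulfV// nrm1 mulfV//.
by apply: contra_neq a0; exact: nrm0_eq0.
Qed.

Lemma nrm_gt0 (V : normedModType R[i]) (a : V) : a != 0 -> 0 < nrm a.
Proof.
by move=> a0; rewrite lt_neqAle nrm_ge0 andbT eq_sym; apply: contra_neq a0; exact: nrm0_eq0.
Qed.

Lemma ler_Re_nrm (a : C) : `|Re a| <= nrm a.
Proof. by rewrite -lecR -(nrmE (a : C)); exact: normc_ge_Re. Qed.

Lemma ler_Im_nrm (a : C) : `|Im a| <= nrm a.
Proof.
have := ler_Re_nrm (a * 'i%C); rewrite ReiNIm normrN nrmM.
suff -> : nrm ('i%C : C) = 1 by rewrite mulr1.
by rewrite /nrm normc_def/= expr0n/= expr1n add0r sqrtr1.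
Qed.

Lemma nrm_le_ReIm (a : C) : nrm a <= `|Re a| + `|Im a|.
Proof.
rewrite [X in nrm X]complexE (le_trans (nrmD _ _))// nrm_real lerD2l nrmM nrm_real.
by rewrite {1}/nrm normc_def/= expr0n/= expr1n add0r sqrtr1 mul1r.
Qed.

Section TwoSpaces.
Variables V W : normedModType R[i].

Lemma cvg_nrm (f : V -> W) (x : V) :
  {for x, continuous f} <->
  forall e : R, 0 < e -> exists2 d : R, 0 < d &
    forall y, nrm (y - x) < d -> nrm (f y - f x) < e.
Proof.
split=> [fx e e0|H].
  have /fx : nbhs (f x) [set w | nrm (w - f x) < e] by apply/nbhs_nrm; exists e.
  by move=> /nbhs_nrm.
move=> A /nbhs_nrm[e e0 eA]; have [d d0 H'] := H _ e0.
by apply/nbhs_nrm; exists d => // y /H' /eA.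
Qed.

End TwoSpaces.
End Norm.

Lemma linear_bounded (R : realType) (V W : normedModType R[i]) (L : {linear V -> W}) :
  continuous L ->
  exists2 K : R, 0 < K & forall h, nrm (L h) <= K * nrm h.
Proof.
move=> /linear_lipschitz[k k0 kL]; have kR : k = (Re k)%:C%C by rewrite RRe_real// gtr0_real.
exists (Re k); first by rewrite -ltcR -kR.
by move=> h; rewrite -lecR rmorphM/= -kR -!nrmE.
Qed.

Lemma nrm_bounded_continuous (R : realType) (V W : normedModType R[i]) (L : {linear V -> W}) (K : R) :
  (forall h, nrm (L h) <= K * nrm h) -> continuous L.
Proof.
move=> KL x; apply/cvg_nrm => e e0.
have K1 : 0 < `|K| + 1 by have := normr_ge0 K; lra.
exists (e / (`|K| + 1)); first by rewrite divr_gt0.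
move=> y; rewrite ltr_pdivlMr// => yx; rewrite -linearB (le_lt_trans (KL _))//.
apply: le_lt_trans yx; rewrite mulrC ler_wpM2l ?nrm_ge0//.
by have := ler_norm K; lra.
Qed.

Lemma diff_nrm (R : realType) (V W : normedModType R[i]) (f : V -> W) (x : V) :
  differentiable f x ->
  forall e : R, 0 < e -> exists2 d : R, 0 < d &
    forall h, nrm h < d -> nrm (f (x + h) - f x - 'd f x h) <= e * nrm h.
Proof.
move=> /diff_locallyP[_ fx] e e0.
have e0' : 0 < (e%:C)%C :> R[i] by rewrite ltcR.
move/eqaddoP : fx => /(_ _ e0') /nbhs_nrm[d d0 H].
exists d => // h hd; have := H h; rewrite subr0 => /(_ hd) /=.
rewrite fctE/= opprD addrA -lecR rmorphM/= -!nrmE [h + x]addrC.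
exact.
Qed.

(** The form in which differentials are computed below; together with [diff_nrm] it
    replaces the little-o notation by estimates in R. *)
Lemma nrm_diff (R : realType) (V W : normedModType R[i]) (f : V -> W) (x : V)
    (L : {linear V -> W}) : continuous L ->
  (forall e : R, 0 < e -> exists2 d : R, 0 < d &
    forall h, nrm h < d -> nrm (f (x + h) - f x - L h) <= e * nrm h) ->
  differentiable f x /\ ('d f x = L :> (V -> W)).
Proof.
move=> cL H.
have E : f \o shift x = cst (f x) + L +o_ 0 id.
  apply/eqaddoP => e e0; have eR : e = (Re e)%:C%C by rewrite RRe_real// gtr0_real.
  have e0' : 0 < Re e by rewrite -ltcR -eR.
  have [d d0 Hd] := H _ e0'; apply/nbhs_nrm; exists d => // h.
  rewrite subr0 => /Hd; rewrite -lecR rmorphM/= -!nrmE -eR.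
  by rewrite fctE/= opprD addrA [h + x]addrC.
have dE := diff_unique cL E; split=> //.
by apply/diff_locallyP; rewrite dE.
Qed.

(** * Integrals of complex functions of a real variable *)

Section Integral.
Variable R : realType.
Local Notation C := (R[i]^o).
Local Notation mu := (@lebesgue_measure R).
Implicit Types (phi psi : R -> C) (a b m : R).

Lemma cvgR_nrm phi (x : R) :
  {for x, continuous phi} <->
  forall e : R, 0 < e -> exists2 d : R, 0 < d &
    forall y, `|y - x| < d -> nrm (phi y - phi x) < e.
Proof.
split=> [fx e e0|H].
  have /fx/nbhs_ballP[d /= d0 H] : nbhs (phi x) [set w | nrm (w - phi x) < e].
    by apply/nbhs_nrm; exists e.
  exists d => // y yx; apply: (H y).
  by rewrite /ball/= distrC.
move=> A /nbhs_nrm[e e0 eA]; have [d d0 H'] := H _ e0.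
apply/nbhs_ballP; exists d => // y; rewrite /ball/= distrC => /H'; exact: eA.
Qed.

Lemma continuous_Re phi : continuous phi -> continuous (fun x => Re (phi x)).
Proof.
move=> cphi x; apply/cvgrPdist_lt => e e0.
have /cvgR_nrm /(_ _ e0)[d d0 H] := cphi x.
apply/nbhs_ballP; exists d => // y; rewrite /ball/= distrC => /H.
by apply: le_lt_trans; rewrite distrC -raddfB; exact: ler_Re_nrm.
Qed.

Lemma continuous_Im phi : continuous phi -> continuous (fun x => Im (phi x)).
Proof.
move=> cphi x; apply/cvgrPdist_lt => e e0.
have /cvgR_nrm /(_ _ e0)[d d0 H] := cphi x.
apply/nbhs_ballP; exists d => // y; rewrite /ball/= distrC => /H.
by apply: le_lt_trans; rewrite distrC -raddfB; exact: ler_Im_nrm.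
Qed.

Lemma continuous_mulC (k : C) phi : continuous phi -> continuous (fun x => k * phi x : C).
Proof.
move=> cphi x; apply/cvgR_nrm => e e0.
have k1 : 0 < nrm k + 1 by have := nrm_ge0 k; lra.
have /cvgR_nrm /(_ (e / (nrm k + 1)))[|d d0 H] := cphi x; first by rewrite divr_gt0.
exists d => // y /H; rewrite ltr_pdivlMr// -mulrBr nrmM; apply: le_lt_trans.
by rewrite mulrC ler_wpM2l ?nrm_ge0//; lra.
Qed.

Lemma continuous_integrable (f : R -> R) a b : continuous f ->
  mu.-integrable `[a, b] (EFin \o f).
Proof.
move=> cf; apply: continuous_compact_integrable; first exact: segment_compact.
exact: continuous_subspaceT.
Qed.

Lemma Rintegral_itv_cst a b (r : R) : a <= b ->
  \int[mu]_(x in `[a, b]) r = r * (b - a).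
Proof.
move=> ab; rewrite Rintegral_cst; last exact: measurable_itv.
congr (_ * _); transitivity (fine (lebesgue_measure `[a, b])) => //.
rewrite lebesgue_measure_itv/= lte_fin; case: ltP => // ba.
have -> : a = b by apply/eqP; rewrite eq_le ab ba.
by rewrite subrr.
Qed.

Definition cint phi a b : C :=
  Complex (\int[mu]_(x in `[a, b]) Re (phi x)) (\int[mu]_(x in `[a, b]) Im (phi x)).

Lemma cintD phi psi a b : continuous phi -> continuous psi ->
  cint (fun x => phi x + psi x) a b = cint phi a b + cint psi a b.
Proof.
move=> cphi cpsi; rewrite /cint.
have -> : (fun x => Re (phi x + psi x)) = (fun x => Re (phi x) + Re (psi x)).
  by apply/funext => x; rewrite raddfD.
have -> : (fun x => Im (phi x + psi x)) = (fun x => Im (phi x) + Im (psi x)).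
  by apply/funext => x; rewrite raddfD.
rewrite RintegralD//; try (apply: continuous_integrable; first [exact: continuous_Re|exact: continuous_Im]).
rewrite RintegralD//; try (apply: continuous_integrable; first [exact: continuous_Re|exact: continuous_Im]).
Qed.

Lemma cintZ (k : C) phi a b : continuous phi ->
  cint (fun x => k * phi x) a b = k * cint phi a b.
Proof.
move=> cphi; rewrite /cint; case: k => k l.
have -> : (fun x => Re ((k +i* l)%C * phi x)) = (fun x => k * Re (phi x) + (- l) * Im (phi x)).
  by apply/funext => x; case: (phi x) => u v /=; rewrite mulNr.
have -> : (fun x => Im ((k +i* l)%C * phi x)) = (fun x => k * Im (phi x) + l * Re (phi x)).
  by apply/funext => x; case: (phi x) => u v /=.
have iR : mu.-integrable `[a, b] (EFin \o (fun x => Re (phi x))).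
  by apply: continuous_integrable; exact: continuous_Re.
have iI : mu.-integrable `[a, b] (EFin \o (fun x => Im (phi x))).
  by apply: continuous_integrable; exact: continuous_Im.
have Zc (c : R) (f : R -> R) : continuous f -> mu.-integrable `[a, b] (EFin \o (fun x => c * f x)).
  move=> cf; apply: continuous_integrable => x.
  by apply: cvgM; [exact: cvg_cst|exact: cf].
rewrite !RintegralD//; try (apply: Zc; first [exact: continuous_Re|exact: continuous_Im]).
rewrite !RintegralZl//; congr Complex.
by rewrite mulNr.
Qed.

Lemma cintB phi psi a b : continuous phi -> continuous psi ->
  cint (fun x => phi x - psi x) a b = cint phi a b - cint psi a b.
Proof.
move=> cphi cpsi.
have -> : (fun x => phi x - psi x) = (fun x => phi x + (-1) * psi x).
  by apply/funext => x; rewrite mulN1r.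
rewrite (cintD a b cphi (continuous_mulC (k := -1) cpsi)).
by rewrite (cintZ (-1 : C) a b cpsi) mulN1r.
Qed.

Lemma cint_split phi a b m : continuous phi -> a <= m -> m <= b ->
  cint phi a b = cint phi a m + cint phi m b.
Proof.
move=> cphi am mb; rewrite /cint.
have spl (f : R -> R) : continuous f -> \int[mu]_(x in `[a, b]) f x =
    \int[mu]_(x in `[a, m]) f x + \int[mu]_(x in `[m, b]) f x.
  move=> cf; have iab := continuous_integrable a b cf.
  apply/eqP; rewrite addrC -subr_eq; apply/eqP.
  rewrite (Rintegral_itvB iab) ?bnd_simp// Rintegral_itv_obnd_cbnd//.
  apply: integrableS (continuous_integrable m b cf) => //.
  by apply: subset_itvr; rewrite bnd_simp.
rewrite (spl _ (continuous_Re cphi)) (spl _ (continuous_Im cphi)).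
by [].
Qed.

(** The constant 2 comes from bounding the real and imaginary parts separately; it
    is harmless for the limits and estimates in which the bound is used. *)
Lemma cint_bound phi a b (M : R) : continuous phi -> a <= b ->
  (forall x, a <= x <= b -> nrm (phi x) <= M) ->
  nrm (cint phi a b) <= 2 * M * (b - a).
Proof.
move=> cphi ab HM.
have bnd (f : R -> R) : continuous f -> (forall x, a <= x <= b -> `|f x| <= M) ->
    `|\int[mu]_(x in `[a, b]) f x| <= M * (b - a).
  move=> cf fM.
  have h4 : `|\int[mu]_(x in `[a, b]) f x| <= \int[mu]_(x in `[a, b]) `|f x|.
    apply: le_normr_Rintegral; first exact: measurable_itv.
    exact: continuous_integrable.
  apply: le_trans h4 _.
  have cn : continuous (fun x => `|f x|).
    move=> x; apply: cvg_norm; exact: cf.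
  have h3 : \int[mu]_(x in `[a, b]) `|f x| <= \int[mu]_(x in `[a, b]) (cst M) x.
    apply: le_Rintegral; first exact: measurable_itv.
    - exact: continuous_integrable.
    - by apply: continuous_integrable => x; exact: cvg_cst.
    - by move=> x /=; rewrite in_itv/= => /fM.
  apply: le_trans h3 _.
  by rewrite Rintegral_itv_cst.
apply: le_trans (nrm_le_ReIm _) _; rewrite /cint/=.
have h1 := bnd _ (continuous_Re cphi) (fun x H => le_trans (ler_Re_nrm _) (HM x H)).
have h2 := bnd _ (continuous_Im cphi) (fun x H => le_trans (ler_Im_nrm _) (HM x H)).
lra.
Qed.

Lemma cint_cst (k : C) a b : a <= b -> cint (fun=> k) a b = k * ((b - a)%:C)%C.
Proof.
move=> ab; rewrite /cint !Rintegral_itv_cst//.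
by case: k => u v /=; apply/eqP; rewrite eq_complex/= !mulr0 subr0 add0r !eqxx.
Qed.

(** With [cint_cst] this integrates the affine functions, the only case that
    Goursat's argument computes. *)
Lemma cint_id a b : a <= b ->
  cint (fun x => (x%:C)%C) a b = (((b ^+ 2 - a ^+ 2) / 2)%:C)%C.
Proof.
rewrite le_eqVlt => /orP[/eqP ->|ab].
  by rewrite subrr mul0r /cint set_itv1 !Rintegral_set1.
rewrite /cint/=; congr Complex; last by rewrite Rintegral_itv_cst ?mul0r// ltW.
rewrite /Rintegral (@continuous_FTC2 _ id (fun x => x ^+ 2 / 2))//=.
- by rewrite mulrBl.
- by apply: continuous_subspaceT => x; exact: cvg_id.
- have cF : continuous (fun x : R => x ^+ 2 / 2).
    move=> x; apply: cvgM; last exact: cvg_cst.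
    exact: exprn_continuous.
  split.
  + by move=> x _; apply: derivableM => //; apply: derivableX.
  + exact: cvg_at_right_filter (cF a).
  + exact: cvg_at_left_filter (cF b).
- move=> x _; rewrite derive1E deriveMr// exp_derive /= expr1 /GRing.scale/=.
  by rewrite mulr1; field.
Qed.

End Integral.

(** * Goursat's theorem on rectangles *)

Section Goursat.
Variable R : realType.
Local Notation C := (R[i]^o).
Implicit Types (g : R -> R -> C) (a b c d : R).

(** The integral of g dz along the boundary of the rectangle [[a, b] x [c, d]],
    counterclockwise. *)
Definition bint g a b c d : C :=
  cint (fun x => g x c) a b - cint (fun x => g x d) a b
  + 'i%C * (cint (g b) c d - cint (g a) c d).

(** Separate continuity is all that the integrals over the four sides need. *)
Definition sep_continuous g :=
  (forall y, continuous (fun x => g x y)) /\ (forall x, continuous (g x)).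

Lemma bint_splitx g a b c d m : sep_continuous g -> a <= m -> m <= b ->
  bint g a b c d = bint g a m c d + bint g m b c d.
Proof.
move=> [cx cy] am mb; rewrite /bint (cint_split (cx c) am mb) (cint_split (cx d) am mb).
by ring.
Qed.

Lemma bint_splity g a b c d m : sep_continuous g -> c <= m -> m <= d ->
  bint g a b c d = bint g a b c m + bint g a b m d.
Proof.
move=> [cx cy] cm md; rewrite /bint (cint_split (cy a) cm md) (cint_split (cy b) cm md).
by ring.
Qed.

Lemma continuous_RtoC : continuous (fun x : R => (x%:C)%C : C).
Proof.
move=> x; apply/cvgR_nrm => e e0; exists e => // y.
by rewrite -raddfB nrm_real.
Qed.

Lemma continuousD_C (phi psi : R -> C) : continuous phi -> continuous psi ->
  continuous (fun x => phi x + psi x : C).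
Proof. by move=> f g x; apply: continuousD; [exact: f|exact: g]. Qed.

Lemma continuousB_C (phi psi : R -> C) : continuous phi -> continuous psi ->
  continuous (fun x => phi x - psi x : C).
Proof. by move=> f g x; apply: continuousB; [exact: f|exact: g]. Qed.

Lemma continuous_cstC (k : C) : continuous (fun _ : R => k).
Proof. by move=> x; exact: cvg_cst. Qed.

Lemma cint_affine (u v : C) a b : a <= b ->
  cint (fun x => u + v * (x%:C)%C) a b
    = u * ((b - a)%:C)%C + v * (((b ^+ 2 - a ^+ 2) / 2)%:C)%C.
Proof.
move=> ab.
rewrite (cintD _ _ (continuous_cstC (k := u)) (continuous_mulC (k := v) continuous_RtoC)).
by rewrite (cintZ v _ _ continuous_RtoC) cint_cst// cint_id.
Qed.

Lemma bint_affine (u v : C) a b c d : a <= b -> c <= d ->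
  bint (fun x y => u + v * ((x%:C)%C + 'i%C * (y%:C)%C)) a b c d = 0.
Proof.
move=> ab cd; rewrite /bint.
have hx y : (fun x : R => u + v * ((x%:C)%C + 'i%C * (y%:C)%C)) =
    (fun x => (u + v * 'i%C * (y%:C)%C) + v * (x%:C)%C).
  by apply/funext => x; ring.
have hy x : (fun y : R => u + v * ((x%:C)%C + 'i%C * (y%:C)%C)) =
    (fun y => (u + v * (x%:C)%C) + (v * 'i%C) * (y%:C)%C).
  by apply/funext => y; ring.
rewrite !hx !hy !cint_affine//.
by rewrite !(rmorphM, rmorphB, rmorphXn)/=; ring.
Qed.

Lemma bint_bound g a b c d (M : R) : sep_continuous g -> a <= b -> c <= d ->
  (forall x y, a <= x <= b -> c <= y <= d -> nrm (g x y) <= M) ->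
  nrm (bint g a b c d) <= 4 * M * ((b - a) + (d - c)).
Proof.
move=> [cx cy] ab cd HM; rewrite /bint.
have h1 : nrm (cint (fun x => g x c) a b) <= 2 * M * (b - a).
  by apply: cint_bound => // x H; apply: HM => //; rewrite lexx.
have h2 : nrm (cint (fun x => g x d) a b) <= 2 * M * (b - a).
  by apply: cint_bound => // x H; apply: HM => //; rewrite lexx andbT.
have h3 : nrm (cint (g b) c d) <= 2 * M * (d - c).
  by apply: cint_bound => // x H; apply: HM => //; rewrite lexx andbT.
have h4 : nrm (cint (g a) c d) <= 2 * M * (d - c).
  by apply: cint_bound => // x H; apply: HM => //; rewrite lexx.
apply: le_trans (nrmD _ _) _; rewrite nrmM.
have -> : nrm ('i%C : C) = 1.
  by rewrite /nrm normc_def/= expr0n/= expr1n add0r sqrtr1.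
have h5 := nrmB (cint (fun x => g x c) a b) (cint (fun x => g x d) a b).
have h6 := nrmB (cint (g b) c d) (cint (g a) c d).
lra.
Qed.

(** Q is one of the four quarters of the rectangle P, with at least a quarter of the
    boundary integral. *)
Definition quarter_step g (P Q : (R * R) * (R * R)) :=
  [/\ [/\ P.1.1 <= Q.1.1, Q.1.2 <= P.1.2, P.2.1 <= Q.2.1 & Q.2.2 <= P.2.2],
      Q.1.2 - Q.1.1 = (P.1.2 - P.1.1) / 2, Q.2.2 - Q.2.1 = (P.2.2 - P.2.1) / 2 &
      nrm (bint g P.1.1 P.1.2 P.2.1 P.2.2) <=
        4 * nrm (bint g Q.1.1 Q.1.2 Q.2.1 Q.2.2)].

Lemma midpointP a b : a <= b ->
  exists m, [/\ a <= m, m <= b, m - a = (b - a) / 2 & b - m = (b - a) / 2].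
Proof. by move=> ab; exists ((a + b) / 2); split; lra. Qed.

Lemma quarter_le (z z1 z2 z3 z4 : C) : z = z1 + z2 + (z3 + z4) ->
  [\/ nrm z <= 4 * nrm z1, nrm z <= 4 * nrm z2, nrm z <= 4 * nrm z3 |
      nrm z <= 4 * nrm z4].
Proof.
move=> E; have := nrmD (z1 + z2) (z3 + z4); have := nrmD z1 z2; have := nrmD z3 z4.
rewrite -E; move: (nrm (z3 + z4)) (nrm (z1 + z2)) (nrm z).
move: (nrm z1) (nrm z2) (nrm z3) (nrm z4) => a1 a2 a3 a4 a5 a6 a7 {E} h1 h2 h3.
have [h|h] := leP a7 (4 * a1); first by constructor 1.
have [h'|h'] := leP a7 (4 * a2); first by constructor 2.
have [h''|h''] := leP a7 (4 * a3); first by constructor 3.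
by constructor 4; lra.
Qed.

Lemma bint_quarter g P : sep_continuous g -> P.1.1 <= P.1.2 -> P.2.1 <= P.2.2 ->
  exists Q, quarter_step g P Q.
Proof.
case: P => -[a b] [c d] /= cg ab cd.
have [m [am mb m1 m2]] := midpointP ab; have [n [cn nd n1 n2]] := midpointP cd.
have := bint_splitx c d cg am mb.
rewrite (bint_splity a m cg cn nd) (bint_splity m b cg cn nd) => /quarter_le[] h.
- by exists ((a, m), (c, n)).
- by exists ((a, m), (n, d)).
- by exists ((m, b), (c, n)).
- by exists ((m, b), (n, d)).
Qed.

Lemma ler_dist_itv (x x' u v : R) : u <= x <= v -> u <= x' <= v -> `|x' - x| <= v - u.
Proof. by move=> /andP[? ?] /andP[? ?]; rewrite ler_norml; apply/andP; split; lra. Qed.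

Lemma bintB f g a b c d : sep_continuous f -> sep_continuous g ->
  bint (fun x y => f x y - g x y) a b c d = bint f a b c d - bint g a b c d.
Proof.
move=> [fx fy] [gx gy]; rewrite /bint (cintB _ _ (fx c) (gx c)) (cintB _ _ (fx d) (gx d)).
rewrite (cintB _ _ (fy b) (gy b)) (cintB _ _ (fy a) (gy a)).
by do 8 move: (cint _ _ _) => ?; ring.
Qed.

Lemma nested_point (u v : nat -> R) : (forall n, u n <= u n.+1) ->
  (forall n, v n.+1 <= v n) -> (forall n, u n <= v n) ->
  exists p, forall n, u n <= p <= v n.
Proof.
move=> hu hv huv.
have mu m n : (m <= n)%N -> u m <= u n by apply: (homo_leq (@lexx _ _) le_trans hu).
have mv m n : (m <= n)%N -> v n <= v m.
  elim: n => [|n IH]; first by rewrite leqn0 => /eqP ->.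
  by rewrite leq_eqVlt => /orP[/eqP ->//|/IH]; apply: le_trans.
have uv m n : u m <= v n.
  have [mn|/ltnW nm] := leqP m n; first by apply: le_trans (mu _ _ mn) _.
  by apply: le_trans (mv _ _ nm).
have hs : has_sup (range u).
  split; first by exists (u 0%N), 0%N.
  by exists (v 0%N) => _ [m _ <-].
exists (sup (range u)) => n; apply/andP; split.
  by apply: ub_le_sup; [exact: hs.2|exists n].
by apply: ge_sup => [|_ [m _ <-]//]; exact: hs.1.
Qed.

(** The hypothesis says that g is complex differentiable as a function of x + i y,
    but only in terms of the real variables and at the points of the rectangle.
    Repeated quartering produces rectangles that shrink to a point, with boundary
    integrals at least 4^-n times the first one; near that point g differs from an
    affine function, of integral zero, by e times the diameter, so the integrals are
    at most a multiple of e 4^-n. *)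
Lemma goursat g a b c d : sep_continuous g -> a <= b -> c <= d ->
  (forall x y, a <= x <= b -> c <= y <= d -> exists k : C,
     forall e : R, 0 < e -> exists2 r : R, 0 < r &
     forall x' y', a <= x' <= b -> c <= y' <= d -> `|x' - x| + `|y' - y| < r ->
       nrm (g x' y' - g x y - k * (((x' - x)%:C)%C + 'i%C * ((y' - y)%:C)%C))
         <= e * (`|x' - x| + `|y' - y|)) ->
  bint g a b c d = 0.
Proof.
move=> cg ab cd Hd; apply: nrm0_eq0; apply/eqP; rewrite eq_le nrm_ge0 andbT.
have step P : exists Q, P.1.1 <= P.1.2 -> P.2.1 <= P.2.2 -> quarter_step g P Q.
  have [h1|h1] := pselect (P.1.1 <= P.1.2); last by exists P => /h1.
  have [h2|h2] := pselect (P.2.1 <= P.2.2); last by exists P => _ /h2.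
  by have [Q HQ] := bint_quarter cg h1 h2; exists Q.
have [F HF] := choice step.
pose P n := iter n F ((a, b), (c, d)).
pose w := (b - a) + (d - c).
have w0 : 0 <= w by rewrite /w; lra.
have ord n : (P n).1.1 <= (P n).1.2 /\ (P n).2.1 <= (P n).2.2.
  elim: n => [//|n [h1 h2]]; have [_ e1 e2 _] := HF _ h1 h2.
  by rewrite /P !iterS -/(P n); split; lra.
have st n := HF _ (ord n).1 (ord n).2.
have wid n : ((P n).1.2 - (P n).1.1) + ((P n).2.2 - (P n).2.1) = w / 2 ^+ n.
  elim: n => [|n IH]; first by rewrite expr0 divr1.
  have [_ e1 e2 _] := st n; rewrite /P !iterS -/(P n) e1 e2 -mulrDl IH exprS invfM.
  by rewrite mulrCA mulrC mulrA.
have big n : nrm (bint g a b c d) <= 4 ^+ n * nrm (bint g (P n).1.1 (P n).1.2 (P n).2.1 (P n).2.2).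
  elim: n => [|n IH]; first by rewrite expr0 mul1r.
  apply: le_trans IH _; have [_ _ _ e] := st n.
  by rewrite exprSr -mulrA ler_wpM2l// exprn_ge0.
have inc n : [/\ (P n).1.1 <= (P n.+1).1.1, (P n.+1).1.2 <= (P n).1.2,
    (P n).2.1 <= (P n.+1).2.1 & (P n.+1).2.2 <= (P n).2.2].
  by have [e _ _ _] := st n; rewrite /P !iterS.
have [x Hx] := @nested_point (fun n => (P n).1.1) (fun n => (P n).1.2)
  (fun n => let: And4 h _ _ _ := inc n in h) (fun n => let: And4 _ h _ _ := inc n in h)
  (fun n => (ord n).1).
have [y Hy] := @nested_point (fun n => (P n).2.1) (fun n => (P n).2.2)
  (fun n => let: And4 _ _ h _ := inc n in h) (fun n => let: And4 _ _ _ h := inc n in h)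
  (fun n => (ord n).2).
have sub n : [/\ a <= (P n).1.1, (P n).1.2 <= b, c <= (P n).2.1 & (P n).2.2 <= d].
  elim: n => [//|n [h1 h2 h3 h4]]; have [i1 i2 i3 i4] := inc n.
  by split; [exact: le_trans i1|exact: le_trans h2|exact: le_trans i3|exact: le_trans h4].
have [k Hk] := Hd x y (Hx 0%N) (Hy 0%N).
suff Heps e : 0 < e -> nrm (bint g a b c d) <= e * (4 * w ^+ 2).
  apply/ler_addgt0Pl => e e0; rewrite addr0.
  have w1 : 0 < 4 * w ^+ 2 + 1 by have := sqr_ge0 w; lra.
  apply: le_trans (Heps (e / (4 * w ^+ 2 + 1)) _) _; first by rewrite divr_gt0.
  rewrite -mulrA ger_pMr// mulrC ler_pdivrMr// mul1r; lra.
move=> e0; have [r r0 Hr] := Hk _ e0.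
have [n Hn] : exists n, w / 2 ^+ n < r.
  have [n Hn] : exists n : nat, w / r < n%:R.
    by exists (Num.truncn (w / r)).+1; exact: truncnS_gt.
  exists n; rewrite ltr_pdivrMr ?exprn_gt0// mulrC -ltr_pdivrMr//.
  by apply: lt_trans Hn _; rewrite -natrX ltr_nat ltn_expl.
apply: le_trans (big n) _.
have [s1 s2 s3 s4] := sub n. have [le1 le2] := ord n.
have Wn := wid n; move: (Hx n) (Hy n) => /andP[x1 x2] /andP[y1 y2].
pose A := (P n).1.1; pose B := (P n).1.2; pose U := (P n).2.1; pose V := (P n).2.2.
rewrite -/A -/B -/U -/V in Wn x1 x2 y1 y2 s1 s2 s3 s4 le1 le2 *.
(* f is the affine approximation of g at the common point (x, y) *)
pose K := g x y - k * ((x%:C)%C + 'i%C * (y%:C)%C).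
pose f x' y' : C := K + k * ((x'%:C)%C + 'i%C * (y'%:C)%C).
have cf : sep_continuous f.
  split=> [y'|x'].
    have -> : (fun x' => f x' y') = (fun x' => (K + k * ('i%C * (y'%:C)%C)) + k * (x'%:C)%C).
      by apply/funext => x'; rewrite /f; ring.
    apply: continuousD_C; first exact: continuous_cstC.
    exact: continuous_mulC continuous_RtoC.
  have -> : f x' = (fun y' => (K + k * (x'%:C)%C) + (k * 'i%C) * (y'%:C)%C).
    by apply/funext => y'; rewrite /f; ring.
  apply: continuousD_C; first exact: continuous_cstC.
  exact: continuous_mulC continuous_RtoC.
have cgf : sep_continuous (fun x y => g x y - f x y).
  split=> z; first exact: continuousB_C (cg.1 z) (cf.1 z).
  exact: continuousB_C (cg.2 z) (cf.2 z).
have E : bint f A B U V = 0 by exact: bint_affine.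
have -> : bint g A B U V = bint (fun x y => g x y - f x y) A B U V.
  by rewrite (bintB _ _ _ _ cg cf) E subr0.
have bb : nrm (bint (fun x y => g x y - f x y) A B U V)
    <= 4 * (e * (w / 2 ^+ n)) * ((B - A) + (V - U)).
  apply: bint_bound => // x' y' x'AB y'UV.
  have dx : `|x' - x| <= B - A by apply: ler_dist_itv => //; rewrite x1 x2.
  have dy : `|y' - y| <= V - U by apply: ler_dist_itv => //; rewrite y1 y2.
  have dxy : `|x' - x| + `|y' - y| <= w / 2 ^+ n by rewrite -Wn lerD.
  have -> : g x' y' - f x' y' =
     g x' y' - g x y - k * (((x' - x)%:C)%C + 'i%C * ((y' - y)%:C)%C).
    by rewrite /f /K !rmorphB/=; ring.
  apply: le_trans (Hr x' y' _ _ _) _.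
  - by case/andP: x'AB => u1 u2; rewrite (le_trans s1)//= (le_trans u2).
  - by case/andP: y'UV => u1 u2; rewrite (le_trans s3)//= (le_trans u2).
  - exact: le_lt_trans dxy Hn.
  - by rewrite ler_wpM2l ?(ltW e0).
apply: le_trans (ler_wpM2l _ bb) _; first by rewrite exprn_ge0.
rewrite Wn; have -> : (4 : R) ^+ n = 2 ^+ n * 2 ^+ n.
  by rewrite -exprMn -natrM.
have p2 : (2 : R) ^+ n != 0 by rewrite expf_neq0.
by rewrite le_eqVlt; apply/orP; left; apply/eqP; move: (2 ^+ n) p2 => p p2; field.
Qed.

End Goursat.

(** * Polar coordinates and Cauchy's formula *)

Section Polar.
Variable R : realType.
Local Notation C := (R[i]^o).

(** The exponential of s + i t: the plane without 0, in logarithmic polar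
    coordinates. *)
Definition pexp (s t : R) : C := Complex (expR s * cos t) (expR s * sin t).

Lemma pexpD s s' t t' : pexp (s + s') (t + t') = pexp s t * pexp s' t'.
Proof.
rewrite /pexp expRD cosD sinD; apply/eqP; rewrite eq_complex/=.
by apply/andP; split; apply/eqP; ring.
Qed.

Lemma nrm_pexp s t : nrm (pexp s t) = expR s.
Proof.
rewrite /nrm normc_def/= !exprMn -mulrDr cos2Dsin2 mulr1 sqrtr_sqr.
by rewrite ger0_norm// expR_ge0.
Qed.

Lemma pexp_neq0 s t : pexp s t != 0.
Proof.
apply/eqP => E; have := nrm_pexp s t; rewrite E nrm0 => /eqP.
by rewrite eq_sym gt_eqF// expR_gt0.
Qed.

Lemma is_derive_approx (f : R -> R) (x l : R) : is_derive x 1 f l ->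
  forall e, 0 < e -> exists2 d, 0 < d &
    forall h, `|h| < d -> `|f (x + h) - f x - l * h| <= e * `|h|.
Proof.
move=> [fx fl] e e0; move: fx; rewrite /derivable => fx.
have H : h^-1 *: (f (h *: 1 + x) - f x) @[h --> 0^'] --> l by rewrite -fl; exact: fx.
move/cvgrPdist_le : H => /(_ _ e0)/nbhs_ballP[d /= d0 H].
exists d => // h hd; have [->|h0] := eqVneq h 0.
  by rewrite addr0 subrr mulr0 subr0 normr0 mulr0.
have := H h; rewrite /ball/= sub0r normrN => /(_ hd h0).
rewrite /GRing.scale/= mulr1 [h + x]addrC => H'.
have -> : f (x + h) - f x - l * h = - ((l - h^-1 * (f (x + h) - f x)) * h).
  by rewrite mulrBl mulrAC mulVf// mul1r; ring.
by rewrite normrN normrM ler_wpM2r.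
Qed.

Lemma pexp_approx0 (e : R) : 0 < e -> exists2 d : R, 0 < d &
  forall s t, `|s| + `|t| < d ->
    nrm (pexp s t - 1 - ((s%:C)%C + 'i%C * (t%:C)%C)) <= e * (`|s| + `|t|).
Proof.
move=> e0; have e6 : 0 < e / 6 by rewrite divr_gt0.
have [d1 d10 H1] := is_derive_approx (is_derive_expR 0) e6.
have [d1' d10' H1'] := is_derive_approx (is_derive_expR 0) ltr01.
have [d2 d20 H2] := is_derive_approx (is_derive_cos 0) e6.
have [d3 d30 H3] := is_derive_approx (is_derive_sin 0) e6.
exists (Num.min (Num.min d1 d1') (Num.min (Num.min d2 d3) (Num.min (1 / 2) (e / 6)))).
  by rewrite !lt_min d10 d10' d20 d30 e6/= divr_gt0.
move=> s t; rewrite !lt_min => /andP[/andP[h1 h1'] /andP[/andP[h2 h3] /andP[h4 h5]]].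
have s0 := normr_ge0 s; have t0 := normr_ge0 t.
have {H1} := H1 s (le_lt_trans _ h1).
rewrite lerDl => /(_ t0); rewrite add0r expR0 mul1r => H1.
have {H1'} := H1' s (le_lt_trans _ h1').
rewrite lerDl => /(_ t0); rewrite add0r expR0 !mul1r => H1'.
have {H2} := H2 t (le_lt_trans _ h2).
rewrite lerDr => /(_ s0); rewrite add0r cos0 sin0 oppr0 mul0r subr0 => H2.
have {H3} := H3 t (le_lt_trans _ h3).
rewrite lerDr => /(_ s0); rewrite add0r cos0 sin0 subr0 mul1r => H3.
have E2 : expR s <= 2.
  by move: H1'; rewrite ler_norml => /andP[_]; have := ler_norm s; lra.
have E1 : `|expR s - 1| <= 2 * `|s|.
  have -> : expR s - 1 = (expR s - 1 - s) + s by ring.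
  by apply: le_trans (ler_normD _ _) _; lra.
have eg := expR_ge0 s.
apply: le_trans (nrm_le_ReIm _) _.
have -> : Re (pexp s t - 1 - ((s%:C)%C + 'i%C * (t%:C)%C))
    = expR s * (cos t - 1) + (expR s - 1 - s).
  by rewrite /pexp /=; ring.
have -> : Im (pexp s t - 1 - ((s%:C)%C + 'i%C * (t%:C)%C))
    = expR s * (sin t - t) + (expR s - 1) * t.
  by rewrite /pexp /=; ring.
have n1 : `|expR s * (cos t - 1) + (expR s - 1 - s)| <= 2 * (e / 6 * `|t|) + e / 6 * `|s|.
  apply: le_trans (ler_normD _ _) _; rewrite lerD// normrM (ger0_norm eg).
  by rewrite ler_pM// normr_ge0.
have n2 : `|expR s * (sin t - t) + (expR s - 1) * t| <= 2 * (e / 6 * `|t|) + 2 * (e / 6) * `|t|.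
  apply: le_trans (ler_normD _ _) _; rewrite lerD// normrM.
    by rewrite (ger0_norm eg) ler_pM// normr_ge0.
  by rewrite ler_wpM2r// (le_trans E1)// ler_wpM2l//; lra.
apply: le_trans (lerD n1 n2) _.
have es : 0 <= e * `|s| by rewrite mulr_ge0// ltW.
by lra.
Qed.

(** The exponential is complex differentiable and is its own derivative: reduce to
    s = t = 0 by [pexpD]. *)
Lemma pexp_approx s t (e : R) : 0 < e -> exists2 d : R, 0 < d &
  forall s' t', `|s' - s| + `|t' - t| < d ->
    nrm (pexp s' t' - pexp s t
         - pexp s t * (((s' - s)%:C)%C + 'i%C * ((t' - t)%:C)%C))
      <= e * (`|s' - s| + `|t' - t|).
Proof.
move=> e0; have E0 := expR_gt0 s.
have [|d d0 H] := @pexp_approx0 (e / expR s); first by rewrite divr_gt0.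
exists d => // s' t' /H; rewrite -(ler_pM2l E0) -(nrm_pexp s t) -nrmM.
rewrite [X in _ <= X](_ : _ = e * (`|s' - s| + `|t' - t|)); last first.
  by rewrite nrm_pexp; field; rewrite gt_eqF.
suff -> : pexp s t * (pexp (s' - s) (t' - t) - 1 - (((s' - s)%:C)%C + 'i%C * ((t' - t)%:C)%C))
  = pexp s' t' - pexp s t - pexp s t * (((s' - s)%:C)%C + 'i%C * ((t' - t)%:C)%C) by [].
by rewrite !mulrBr -pexpD mulr1; congr (pexp _ _ - _ - _); ring.
Qed.

Lemma pexp_cont s t (e : R) : 0 < e -> exists2 d : R, 0 < d &
  forall s' t', `|s' - s| + `|t' - t| < d -> nrm (pexp s' t' - pexp s t) < e.
Proof.
move=> e0; have [d d0 H] := pexp_approx s t ltr01.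
have E0 := expR_gt0 s.
exists (Num.min d (e / (1 + expR s))); first by rewrite lt_min d0 divr_gt0// addr_gt0.
move=> s' t'; rewrite lt_min => /andP[/H h1 h2].
set D := ((s' - s)%:C)%C + 'i%C * ((t' - t)%:C)%C in h1.
have nD : nrm (D : C) <= `|s' - s| + `|t' - t|.
  apply: le_trans (nrm_le_ReIm _) _; rewrite /D/= !(mul0r, mul1r, subr0, addr0, add0r, mulr0, oppr0).
  by [].
have -> : pexp s' t' - pexp s t = (pexp s' t' - pexp s t - pexp s t * D) + pexp s t * D by ring.
apply: le_lt_trans (nrmD _ _) _; rewrite nrmM nrm_pexp.
move: h2; rewrite ltr_pdivlMr ?addr_gt0// => h2.
have : expR s * nrm (D : C) <= expR s * (`|s' - s| + `|t' - t|) by rewrite ler_wpM2l// ltW.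
by lra.
Qed.

End Polar.

Section CauchyDerivative.
Variable R : realType.
Local Notation C := (R[i]^o).

Lemma pexp_2pi (s : R) : pexp s (pi *+ 2) = pexp s 0.
Proof.
have e2 : pexp 0 (pi *+ 2) = 1 :> R[i].
  rewrite mulr2n -[X in pexp X]addr0 pexpD /pexp expR0 cospi sinpi !mul1r.
  by apply/eqP; rewrite eq_complex/=; apply/andP; split; apply/eqP; ring.
by rewrite -[in LHS](addr0 s) -[in LHS](add0r (pi *+ 2)) pexpD e2 mulr1.
Qed.

(** A retraction of R onto the segment, used to extend functions defined on a
    rectangle so that they are continuous everywhere. *)
Definition clamp (a b s : R) := Num.max a (Num.min s b).

Lemma clampP a b s : a <= b -> a <= clamp a b s <= b.
Proof. by move=> ab; rewrite /clamp le_max lexx/= ge_max ab ge_min lexx orbT. Qed.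

Lemma clamp_id a b s : a <= s <= b -> clamp a b s = s.
Proof. by move=> /andP[h1 h2]; rewrite /clamp (min_idPl h2) (max_idPr h1). Qed.

Lemma ler_dist_max (a x y : R) : `|Num.max a x - Num.max a y| <= `|x - y|.
Proof.
have := ler_norm (x - y); have := ler_norm (y - x); rewrite (distrC y x).
have := normr_ge0 (x - y); move: (`|x - y|) => n n0 h1 h2.
by case: (leP a x) => ?; case: (leP a y) => ?; rewrite ler_norml; apply/andP; split; lra.
Qed.

Lemma ler_dist_min (a x y : R) : `|Num.min x a - Num.min y a| <= `|x - y|.
Proof.
have := ler_norm (x - y); have := ler_norm (y - x); rewrite (distrC y x).
have := normr_ge0 (x - y); move: (`|x - y|) => n n0 h1 h2.
by case: (leP x a) => ?; case: (leP y a) => ?; rewrite ler_norml; apply/andP; split; lra.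
Qed.

Lemma clamp_lip a b s s' : `|clamp a b s' - clamp a b s| <= `|s' - s|.
Proof. exact: le_trans (ler_dist_max _ _ _) (ler_dist_min _ _ _). Qed.

(** The complex derivative is the value of the differential at 1. *)
Lemma diffC1 (F : C -> C) (z h : C) : 'd F z h = h * 'd F z (1 : C).
Proof.
transitivity ('d F z (h *: (1 : C))); last exact: linearZ.
by congr ('d F z _); rewrite /GRing.scale/= mulr1.
Qed.

Lemma diff_pexp (F : C -> C) (s t : R) : differentiable F (pexp s t) ->
  exists k : C, forall e : R, 0 < e -> exists2 r : R, 0 < r &
    forall s' t', `|s' - s| + `|t' - t| < r ->
      nrm (F (pexp s' t') - F (pexp s t)
           - k * (((s' - s)%:C)%C + 'i%C * ((t' - t)%:C)%C))
        <= e * (`|s' - s| + `|t' - t|).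
Proof.
set z := pexp s t => dF; pose k := 'd F z (1 : C); exists (k * z) => e e0.
pose B := nrm z + 1; pose K := nrm k + 1.
have B0 : 0 < B by rewrite /B; have := nrm_ge0 z; lra.
have K0 : 0 < K by rewrite /K; have := nrm_ge0 k; lra.
have e1 : 0 < e / (2 * B) by rewrite divr_gt0// mulr_gt0.
have e2 : 0 < e / (2 * K) by rewrite divr_gt0// mulr_gt0.
have [d1 d10 H1] := diff_nrm dF e1.
have [d2 d20 H2] := pexp_approx s t e2.
have [d3 d30 H3] := pexp_approx s t ltr01.
have [d4 d40 H4] := pexp_cont s t d10.
exists (Num.min d2 (Num.min d3 d4)); first by rewrite !lt_min d20 d30.
move=> s' t'; rewrite !lt_min => /andP[/H2 h2 /andP[/H3 h3 /H4 h4]].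
move: h2 h3 h4 {H2 H3 H4}; set z' := pexp s' t'; rewrite -/z.
set D : C := ((s' - s)%:C)%C + 'i%C * ((t' - t)%:C)%C.
have nD : nrm D <= `|s' - s| + `|t' - t|.
  apply: le_trans (nrm_le_ReIm _) _; rewrite /D/= !(mul0r, mul1r, subr0, addr0, add0r, mulr0, oppr0).
  by [].
move: nD; set N := `|s' - s| + `|t' - t| => nD h2 h3 h4.
have N0 : 0 <= N by exact: le_trans (nrm_ge0 _) nD.
have zz : nrm (z' - z) <= B * N.
  have -> : z' - z = (z' - z - z * D) + z * D by ring.
  apply: le_trans (nrmD _ _) _; rewrite nrmM /B.
  have h5 : nrm z * nrm D <= nrm z * N by rewrite ler_wpM2l ?nrm_ge0.
  by rewrite mulrDl [X in _ <= X]addrC lerD.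
have {}h1 := H1 (z' - z) h4; rewrite subrKC in h1.
rewrite diffC1 in h1.
have -> : F z' - F z - k * z * D = (F z' - F z - (z' - z) * k) + k * (z' - z - z * D) by ring.
apply: le_trans (nrmD _ _) _; rewrite nrmM.
have b1 : e / (2 * B) * nrm (z' - z) <= e / 2 * N.
  apply: le_trans (ler_wpM2l (ltW e1) zz) _.
  by rewrite le_eqVlt; apply/orP; left; apply/eqP; field; rewrite gt_eqF.
have b2 : nrm k * nrm (z' - z - z * D) <= e / 2 * N.
  have kK : nrm k <= K by rewrite /K; lra.
  apply: le_trans (ler_pM (nrm_ge0 _) (nrm_ge0 _) kK h2) _.
  by rewrite le_eqVlt; apply/orP; left; apply/eqP; field; rewrite gt_eqF.
apply: le_trans (lerD (le_trans h1 b1) b2) _; lra.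
Qed.

(** Goursat's theorem for F (exp (s + i t)) on the rectangle [[s0, s1] x [0, 2 pi]]: the
    two horizontal sides cancel by periodicity, and the vertical ones are the means
    on the two circles. *)
Lemma circle_mean (F : C -> C) (s0 s1 : R) : s0 <= s1 ->
  (forall z : C, expR s0 <= nrm z <= expR s1 -> differentiable F z) ->
  cint (fun t => F (pexp s0 t)) 0 (pi *+ 2) = cint (fun t => F (pexp s1 t)) 0 (pi *+ 2).
Proof.
move=> s01 dF; pose cl := clamp s0 s1.
have dFc s t : differentiable F (pexp (cl s) t).
  by apply: dF; rewrite nrm_pexp !ler_expR; exact: clampP.
have jc s t (e : R) : 0 < e -> exists2 d : R, 0 < d & forall s' t',
    `|cl s' - cl s| + `|t' - t| < d -> nrm (F (pexp (cl s') t') - F (pexp (cl s) t)) < e.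
  move=> e0; have /cvg_nrm/(_ _ e0)[d d0 H] := differentiable_continuous (dFc s t).
  have [d' d'0 H'] := pexp_cont (cl s) t d0.
  by exists d' => // s' t' /H'; exact: H.
pose g s t : C := F (pexp (cl s) t).
have cg : sep_continuous g.
  split=> [t s|s t]; apply/cvgR_nrm => e e0; have [d d0 H] := jc s t e e0; exists d => //.
    move=> s' ss'; apply: H; rewrite subrr normr0 addr0.
    exact: le_lt_trans (clamp_lip _ _ _ _) ss'.
  by move=> t' tt'; apply: H; rewrite subrr normr0 add0r.
have pi2 : 0 <= pi *+ 2 :> R by rewrite mulrn_wge0// pi_ge0.
have : bint g s0 s1 0 (pi *+ 2) = 0.
  apply: goursat => // s t hs ht; have := dFc s t; rewrite /g [cl s]clamp_id//.
  move=> /diff_pexp[k Hk]; exists k => e /Hk[d d0 H]; exists d => // s' t' hs' ht' h.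
  by rewrite [cl s']clamp_id//; exact: H.
rewrite /bint.
have -> : (fun s => g s (pi *+ 2)) = (fun s => g s 0).
  by apply/funext => s; rewrite /g pexp_2pi.
rewrite subrr add0r => /eqP; rewrite mulf_eq0 subr_eq0 => /orP[/eqP|/eqP].
  by case=> /eqP; rewrite oner_eq0.
have c0 : cl s0 = s0 by apply: clamp_id; rewrite lexx.
have c1 : cl s1 = s1 by apply: clamp_id; rewrite lexx andbT.
by rewrite /g c0 c1 => ->.
Qed.

(** The integrand has the same mean on all smaller circles, and tends to F' (0) when
    the radius tends to 0. *)
Lemma cauchy_derive1 (F : C -> C) (s1 : R) :
  (forall z : C, nrm z <= expR s1 -> differentiable F z) ->
  cint (fun t => (F (pexp s1 t) - F 0) / pexp s1 t) 0 (pi *+ 2)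
    = 'd F 0 (1 : C) * (((pi *+ 2)%:C)%C : C).
Proof.
move=> dF; pose G z : C := (F z - F 0) / z; pose k := 'd F 0 (1 : C).
have pi2 : 0 <= pi *+ 2 :> R by rewrite mulrn_wge0// pi_ge0.
have dG z : z != 0 -> nrm z <= expR s1 -> differentiable G z.
  move=> z0 zs; apply: differentiableM; last exact: differentiableV.
  by apply: differentiableB; [exact: dF|exact: differentiable_cst].
have cG s : s <= s1 -> continuous (fun t => G (pexp s t)).
  move=> ss t; apply/cvgR_nrm => e e0.
  have /cvg_nrm/(_ _ e0)[d d0 H] : {for pexp s t, continuous G}.
    apply: differentiable_continuous; apply: dG; first exact: pexp_neq0.
    by rewrite nrm_pexp ler_expR.
  have [d' d'0 H'] := pexp_cont s t d0; exists d' => // t' tt'.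
  by apply: H; apply: H'; rewrite subrr normr0 add0r.
apply/eqP; rewrite -subr_eq0; apply/eqP; apply: nrm0_eq0; apply/eqP.
rewrite eq_le nrm_ge0 andbT; apply/ler_addgt0Pl => e e0; rewrite addr0.
have P0 : 0 < 4 * pi + 1 :> R by have := pi_gt0 R; lra.
have e1 : 0 < e / (4 * pi + 1) by rewrite divr_gt0.
have d0F : differentiable F 0 by apply: dF; rewrite nrm0 expR_ge0.
have [d d0 H] := diff_nrm d0F e1.
pose s0 := Num.min s1 (ln (d / 2)).
have s01 : s0 <= s1 by rewrite ge_min lexx.
have s0d : expR s0 < d.
  have : expR s0 <= d / 2.
    by rewrite -[X in _ <= X]lnK ?posrE ?divr_gt0// ler_expR ge_min lexx orbT.
  by move=> /le_lt_trans; apply; lra.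
have -> : cint (fun t => (F (pexp s1 t) - F 0) / pexp s1 t) 0 (pi *+ 2)
    = cint (fun t => G (pexp s0 t)) 0 (pi *+ 2).
  apply/esym; apply: (circle_mean s01) => z /andP[z1 z2]; apply: dG; last exact: z2.
  by apply/eqP => z0; move: z1; rewrite z0 nrm0 leNgt expR_gt0.
have -> : k * (((pi *+ 2)%:C)%C : C) = cint (fun=> k) 0 (pi *+ 2).
  by rewrite cint_cst// subr0.
rewrite -(cintB _ _ (cG _ s01) (continuous_cstC (k := k))).
apply: le_trans (cint_bound (M := e / (4 * pi + 1)) _ pi2 _) _.
- exact: continuousB_C (cG _ s01) (continuous_cstC (k := k)).
- move=> t _; set z := pexp s0 t.
  have z0 : z != 0 by exact: pexp_neq0.
  have := H z; rewrite nrm_pexp => /(_ s0d); rewrite add0r -(nrm_pexp s0 t) -/z.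
  rewrite diffC1 -/k.
  rewrite -ler_pdivrMr ?nrm_gt0// -nrmV -nrmM.
  suff -> : (F z - F 0 - z * k) / z = G z - k by [].
  by rewrite /G mulrBl; congr (_ - _); rewrite mulrAC mulfV// mul1r.
- have pg := pi_gt0 R; rewrite subr0 mulr2n.
  have -> : 2 * (e / (4 * pi + 1)) * (pi + pi) = e * (4 * pi / (4 * pi + 1)).
    by field; rewrite gt_eqF//; lra.
  by rewrite ger_pMr// ler_pdivrMr// mul1r; lra.
Qed.

End CauchyDerivative.

(** * Cauchy estimates and the mean value inequality *)

Section HoloDerivative.
Variable R : realType.
Local Notation C := (R[i]^o).

Lemma nrm_diff_fun (V W : normedModType R[i]) (f : V -> W) (x : V) (L : V -> W) (K : R) :
  linear L -> (forall h, nrm (L h) <= K * nrm h) ->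
  (forall e : R, 0 < e -> exists2 d : R, 0 < d &
    forall h, nrm h < d -> nrm (f (x + h) - f x - L h) <= e * nrm h) ->
  differentiable f x /\ ('d f x = L :> (V -> W)).
Proof.
move=> linL bL H.
pose LL : {linear V -> W} := HB.pack_for {linear V -> W} L (GRing.isLinear.Build _ _ _ _ L linL).
apply: (@nrm_diff _ _ _ f x LL) => //.
exact: (@nrm_bounded_continuous _ _ _ LL K bL).
Qed.

Lemma nrm_pair1 (V W : normedModType R[i]) (p : V * W) : nrm p.1 <= nrm p.
Proof. by rewrite -lecR -!nrmE prod_normE comparable_le_max ?lexx// real_comparable ?normr_real. Qed.

Lemma nrm_pair2 (V W : normedModType R[i]) (p : V * W) : nrm p.2 <= nrm p.
Proof. by rewrite -lecR -!nrmE prod_normE comparable_le_max ?lexx ?orbT// real_comparable ?normr_real. Qed.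

Section Line.
Variables (V : normedModType R[i]) (W : normedModType R[i]) (f : V -> W) (x v : V).

(** Restriction to complex lines reduces functions on a normed space, of any
    dimension, to functions of one variable. *)
Lemma diff_line (z : C) : differentiable f (x + z *: v) ->
  differentiable (fun z : C => f (x + z *: v)) z /\
  'd (fun z : C => f (x + z *: v)) z (1 : C) = 'd f (x + z *: v) v.
Proof.
move=> df.
have [| | |dl dlE] := @nrm_diff_fun C V (fun z : C => x + z *: v) z (fun h : C => h *: v) (nrm v).
- by move=> a h h' /=; rewrite scalerDl scalerA.
- by move=> h; rewrite nrmZ mulrC.
- move=> e e0; exists 1 => // h _; rewrite scalerDl addrA [x + _ + _]addrC addrK.
  by rewrite subrr nrm0 mulr_ge0 ?nrm_ge0// ltW.
split; first exact: (@differentiable_comp _ _ _ _ (fun z : C => x + z *: v) f).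
rewrite (@diff_comp _ _ _ _ (fun z : C => x + z *: v) f)//=.
by rewrite dlE scale1r.
Qed.

End Line.

Section CauchyFormula.
Variables (V : normedModType R[i]) (f : V -> C) (y v : V) (r : R).
Hypothesis r0 : 0 < r.
Hypothesis df : forall z : C, nrm z <= r -> differentiable f (y + z *: v).

Definition circ (t : R) : C := pexp (ln r) t.

Lemma nrm_circ t : nrm (circ t) = r.
Proof. by rewrite nrm_pexp lnK. Qed.

Lemma circ_neq0 t : circ t != 0.
Proof. exact: pexp_neq0. Qed.

Lemma circ_comp_continuous (W : normedModType R[i]) (G : C -> W) :
  (forall z : C, nrm z = r -> {for z, continuous G}) ->
  forall t (e : R), 0 < e -> exists2 d : R, 0 < d &
    forall t', `|t' - t| < d -> nrm (G (circ t') - G (circ t)) < e.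
Proof.
move=> cG t e e0; have /cvg_nrm/(_ _ e0)[d d0 H] := cG _ (nrm_circ t).
have [d' d'0 H'] := pexp_cont (ln r) t d0; exists d' => // t' tt'.
by apply: H; apply: H'; rewrite subrr normr0 add0r.
Qed.

Lemma cauchy_integrand_continuous :
  continuous (fun t => (f (y + circ t *: v) - f y) / circ t : C).
Proof.
move=> t; apply/cvgR_nrm.
apply: (@circ_comp_continuous C (fun z : C => (f (y + z *: v) - f y) / z)) => z zr.
have z0 : z != 0 by apply/eqP => z0; move: zr; rewrite z0 nrm0 => E; move: r0; rewrite -E ltxx.
have zr' : nrm z <= r by rewrite zr.
apply: differentiable_continuous; apply: differentiableM; last exact: differentiableV.
by apply: differentiableB; [exact: (diff_line (df zr')).1|exact: differentiable_cst].
Qed.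

Lemma cauchy_formula :
  cint (fun t => (f (y + circ t *: v) - f y) / circ t) 0 (pi *+ 2)
    = 'd f y v * (((pi *+ 2)%:C)%C : C).
Proof.
have dF (z : C) : nrm z <= expR (ln r) -> differentiable (fun z : C => f (y + z *: v)) z.
  by rewrite lnK// => /df /diff_line[].
have := cauchy_derive1 dF; rewrite !scale0r !addr0 /circ => ->; congr (_ * _).
have n0 : nrm (0 : C) <= r by rewrite nrm0 ltW.
by have [_ ->] := diff_line (df n0); rewrite scale0r addr0.
Qed.

Lemma cauchy_estimate (M : R) :
  (forall z : C, nrm z <= r -> nrm (f (y + z *: v) - f y) <= M) ->
  nrm ('d f y v) <= 2 * M / r.
Proof.
move=> HM; have pg := pi_gt0 R.
have pi2 : 0 < pi *+ 2 :> R by rewrite pmulrn_lgt0.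
rewrite -(ler_pM2r pi2) -[X in _ * X <= _]ger0_norm ?(ltW pi2)// -(nrm_real (pi *+ 2)).
rewrite -nrmM -cauchy_formula.
have := @cint_bound _ _ 0 (pi *+ 2) (M / r) cauchy_integrand_continuous (ltW pi2).
rewrite subr0 mulrA; apply => t _.
by rewrite nrmM nrmV nrm_circ ler_pM2r ?invr_gt0// HM// nrm_circ.
Qed.

End CauchyFormula.

Lemma approx_is_derive (f : R -> R) (x l : R) :
  (forall e, 0 < e -> exists2 d, 0 < d &
    forall h, `|h| < d -> `|f (x + h) - f x - l * h| <= e * `|h|) ->
  is_derive x 1 f l.
Proof.
move=> H; have cl : h^-1 *: (f (h *: 1 + x) - f x) @[h --> 0^'] --> l.
  apply/cvgrPdist_le => e e0; have [d d0 Hd] := H e e0.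
  apply/nbhs_ballP; exists d => //= h; rewrite /ball/= sub0r normrN => hd h0.
  have := Hd h hd; rewrite /GRing.scale/= mulr1 [h + x]addrC => H'.
  have -> : l - h^-1 * (f (x + h) - f x) = - ((f (x + h) - f x - l * h) * h^-1).
    by rewrite mulrBl mulfK// mulrC; ring.
  by rewrite normrN normrM normfV ler_pdivrMr// normr_gt0.
split; first by apply/cvg_ex; exists l.
exact: cvg_lim cl.
Qed.

(** The mean value theorem for the real and the imaginary part of F along the segment
    [[0, 1]]; hence the factor 2. *)
Lemma mvt_C (F : C -> C) (B : R) :
  (forall s : R, 0 <= s <= 1 -> differentiable F ((s%:C)%C : C) /\
     nrm ('d F ((s%:C)%C : C) (1 : C)) <= B) ->
  nrm (F 1 - F 0) <= 2 * B.
Proof.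
move=> H.
have main (p : C -> R) : {morph p : a b / a + b} -> {morph p : a / - a} ->
    (forall (a : C) (s : R), p (a * (s%:C)%C) = p a * s) ->
    (forall a, `|p a| <= nrm a) -> `|p (F 1 - F 0)| <= B.
  move=> pD pN pM pn; pose df s := p ('d F ((s%:C)%C : C) (1 : C)).
  have dr (s : R) : 0 <= s <= 1 -> is_derive s 1 (fun s : R => p (F (s%:C)%C)) (df s).
    move=> /H[dF _]; apply: approx_is_derive => e e0; have [d d0 Hd] := diff_nrm dF e0.
    exists d => // h hd; have := Hd ((h%:C)%C : C); rewrite nrm_real => /(_ hd).
    rewrite diffC1 mulrC; apply: le_trans; rewrite rmorphD/= /df -pM -!pN -!pD.
    exact: pn.
  have [| |c c01] := @MVT_segment R (fun s : R => p (F (s%:C)%C)) df 0 1 ler01.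
  - by move=> s; rewrite in_itv/= => /andP[s0 s1]; apply: dr; rewrite !ltW.
  - apply: derivable_within_continuous => s; rewrite in_itv/= => /dr[].
    by [].
  rewrite subr0 mulr1 -pN -pD => ->.
  move: c01; rewrite in_itv/= => /H[_]; apply: le_trans; exact: pn.
have hR := main (fun a : C => Re a).
have hI := main (fun a : C => Im a).
apply: le_trans (nrm_le_ReIm _) _.
have -> : 2 * B = B + B by ring.
apply: lerD.
  by apply: hR; [exact: raddfD|exact: raddfN|move=> [a b] s /=; ring|exact: ler_Re_nrm].
by apply: hI; [exact: raddfD|exact: raddfN|move=> [a b] s /=; ring|exact: ler_Im_nrm].
Qed.

End HoloDerivative.

(** * The differential of a holomorphic function is holomorphic *)

(** If f is holomorphic and bounded by M on a ball of radius 4 rho, Cauchy's estimates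
    give explicit bounds on the smaller concentric balls: the differential is bounded
    by K1, it is Lipschitz with constant K2, and f has a first order expansion with a
    quadratic remainder. *)
Section LocalEstimates.
Variable R : realType.
Local Notation C := (R[i]^o).
Variable V : normedModType R[i].

Lemma diff_shift (f : V -> C) (y k : V) : differentiable f (y + k) ->
  differentiable (fun y => f (y + k)) y /\
  'd (fun y => f (y + k)) y = 'd f (y + k) :> (V -> C).
Proof.
move=> df; apply: (@nrm_diff _ _ _ _ _ ('d f (y + k))).
  exact: diff_continuous.
move=> e /(diff_nrm df)[d d0 H]; exists d => // h /H.
by rewrite [y + h + k]addrAC.
Qed.

Lemma continuousM_C (T : topologicalType) (f g : T -> C) z :
  {for z, continuous f} -> {for z, continuous g} ->
  {for z, continuous (fun z => f z * g z : C)}.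
Proof. by move=> cf cg; exact: (@cvgM R[i] T (nbhs z) _ f g _ _ cf cg). Qed.

Lemma diffB_fun (W : normedModType R[i]) (f g : W -> C) (x : W) :
  differentiable f x -> differentiable g x ->
  differentiable (fun y => f y - g y) x /\
  forall u, 'd (fun y => f y - g y) x u = 'd f x u - 'd g x u.
Proof.
move=> df dg; split; first exact: differentiableB.
by move=> u; exact: (congr1 (fun h : W -> C => h u) (diffB df dg)).
Qed.

(** Cauchy's estimate on the disc of radius rho / 2 of the line spanned by v. *)
Lemma cauchy_bound (F : V -> C) (y v : V) (rho B : R) : 0 < rho ->
  (forall y', nrm (y' - y) < rho -> differentiable F y' /\ nrm (F y') <= B) ->
  nrm ('d F y v) <= 8 * B / rho * nrm v.
Proof.
move=> rho0 HF; have [->|v0] := eqVneq v 0.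
  by rewrite linear0 !nrm0 mulr0.
have vp := nrm_gt0 v0; pose r := rho / 2 / nrm v.
have r0 : 0 < r by rewrite !divr_gt0.
have zv (z : C) : nrm z <= r -> nrm (y + z *: v - y) < rho.
  rewrite /r ler_pdivlMr// addrAC subrr add0r nrmZ => /le_lt_trans; apply; lra.
have yy : nrm (y - y) < rho by rewrite subrr nrm0.
apply: le_trans (cauchy_estimate (M := 2 * B) r0 _ _) _.
- by move=> z /zv /HF[].
- move=> z /zv /HF[_ h1]; apply: le_trans (nrmB _ _) _; have [_ h2] := HF _ yy; lra.
- rewrite le_eqVlt; apply/orP; left; apply/eqP; rewrite /r.
  by field; rewrite !gt_eqF.
Qed.

Variables (f : V -> C) (x0 : V) (rho M : R).
Hypothesis rho0 : 0 < rho.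
Hypothesis hf : forall y, nrm (y - x0) < 4 * rho -> differentiable f y /\ nrm (f y) <= M.

Let K1 := 8 * M / rho.
Let K2 := 8 * (2 * K1) / rho.

Lemma loc_M0 : 0 <= M.
Proof.
have [|_] := hf (y := x0); first by rewrite subrr nrm0 mulr_gt0.
exact: le_trans (nrm_ge0 _).
Qed.

Lemma loc_K10 : 0 <= K1.
Proof. by rewrite /K1 divr_ge0 ?(ltW rho0)// mulr_ge0// loc_M0. Qed.

Lemma loc_K20 : 0 <= K2.
Proof.
apply: divr_ge0 (ltW rho0); apply: mulr_ge0 => //; apply: mulr_ge0 => //.
exact: loc_K10.
Qed.

Lemma loc_le (a b : R) : a <= b -> a * rho <= b * rho.
Proof. by move=> ab; rewrite ler_wpM2r// ltW. Qed.

Lemma loc_lt a b y : a <= b -> nrm (y - x0) < a * rho -> nrm (y - x0) < b * rho.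
Proof. by move=> /loc_le ab /lt_le_trans; apply. Qed.

Lemma loc_lt1 b y : 1 <= b -> nrm (y - x0) < rho -> nrm (y - x0) < b * rho.
Proof. by move=> b1 h; apply: (@loc_lt 1) => //; rewrite mul1r. Qed.

Lemma loc_near (y k : V) (a b : R) : nrm (y - x0) < a -> nrm k < b ->
  nrm (y + k - x0) < a + b.
Proof.
by move=> h1 h2; rewrite addrAC; apply: le_lt_trans (nrmD _ _) _; rewrite ltrD.
Qed.

Lemma loc_bound (y v : V) : nrm (y - x0) < 3 * rho -> nrm ('d f y v) <= K1 * nrm v.
Proof.
move=> hy; apply: cauchy_bound => // y' y'y; apply: hf.
have := loc_near hy y'y; rewrite subrKC -{2}[rho]mul1r -mulrDl; apply: loc_lt; lra.
Qed.

Lemma loc_scale (k : V) (s : R) (b : R) : nrm k < b -> 0 <= s <= 1 ->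
  nrm ((s%:C)%C *: k : V) < b.
Proof.
move=> kb /andP[s0 s1]; apply: le_lt_trans kb.
by rewrite nrmZ nrm_real ger0_norm// ler_piMl// nrm_ge0.
Qed.

Lemma loc_lip (y k : V) : nrm (y - x0) < 2 * rho -> nrm k < rho ->
  nrm (f (y + k) - f y) <= 2 * K1 * nrm k.
Proof.
move=> hy hk; have := @mvt_C R (fun z : C => f (y + z *: k)) (K1 * nrm k).
rewrite scale1r scale0r addr0 mulrA; apply => s s01.
have h := loc_near hy (loc_scale hk s01).
have h3 : nrm (y + (s%:C)%C *: k - x0) < 3 * rho.
  by move: h; rewrite -{2}[rho]mul1r -mulrDl; apply: loc_lt; lra.
have [|df _] := hf (y := y + (s%:C)%C *: k).
  by apply: loc_lt h3; rewrite ler_nat.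
by have [d1 ->] := diff_line df; split => //; exact: loc_bound.
Qed.

(** Cauchy's estimate for the increment f (y + k) - f y, which is small by [loc_lip]. *)
Lemma loc_dlip (y k v : V) : nrm (y - x0) < rho -> nrm k < rho ->
  nrm ('d f (y + k) v - 'd f y v) <= K2 * nrm k * nrm v.
Proof.
move=> hy hk.
have dF y' : nrm (y' - x0) < 2 * rho ->
    differentiable (fun y => f (y + k) - f y) y' /\
    forall u, 'd (fun y => f (y + k) - f y) y' u = 'd f (y' + k) u - 'd f y' u.
  move=> h; have h' := loc_near h hk.
  have [|d1 _] := hf (y := y' + k).
    by move: h'; rewrite -{2}[rho]mul1r -mulrDl; apply: loc_lt; lra.
  have [|d2 _] := hf (y := y'); first by apply: loc_lt h; rewrite ler_nat.
  have [d3 e3] := diff_shift d1.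
  have [d4 e4] := diffB_fun d3 d2; split; first exact: d4.
  move=> u; apply: etrans (e4 u) _; congr (_ - _).
  exact: (congr1 (fun h : V -> C => h u) e3).
have hy2 : nrm (y - x0) < 2 * rho.
  exact: (loc_lt1 (ler1n R 2) hy).
rewrite -(dF y hy2).2.
apply: le_trans (cauchy_bound (rho := rho) (B := 2 * K1 * nrm k) v rho0 _) _.
  move=> y' y'y; have := loc_near hy y'y; rewrite subrKC => h.
  have h' : nrm (y' - x0) < 2 * rho by rewrite mulr_natl mulr2n.
  by split; [exact: (dF _ h').1|exact: loc_lip].
rewrite le_eqVlt; apply/orP; left; apply/eqP; rewrite /K2.
by field; rewrite gt_eqF.
Qed.

Lemma loc_quad (y k : V) : nrm (y - x0) < rho -> nrm k < rho ->
  nrm (f (y + k) - f y - 'd f y k) <= 2 * K2 * nrm k ^+ 2.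
Proof.
move=> hy hk; pose F (z : C) : C := f (y + z *: k) - z * 'd f y k.
have -> : f (y + k) - f y - 'd f y k = F 1 - F 0.
  by rewrite /F scale1r scale0r mul0r subr0 mul1r addr0 addrAC.
rewrite -mulrA; apply: mvt_C => s s01.
have hs := loc_scale hk s01; have h := loc_near hy hs.
have [|df _] := hf (y := y + (s%:C)%C *: k).
  by rewrite -[rho]mul1r -mulrDl in h; apply: loc_lt h; lra.
have [d1 e1] := diff_line df.
have [| | |d2 e2] := @nrm_diff_fun R C C (fun z : C => z * 'd f y k) ((s%:C)%C : C)
    (fun h : C => h * 'd f y k) (nrm ('d f y k)).
- by move=> a u v; rewrite /GRing.scale/= mulrDl mulrA.
- by move=> u; rewrite nrmM mulrC.
- move=> e e0; exists 1 => // u _; rewrite mulrDl [X in X - _ - _]addrC addrK subrr nrm0.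
  by rewrite mulr_ge0 ?nrm_ge0// ltW.
have [d3 e3] := diffB_fun d1 d2; split; first exact: d3.
have E : 'd F ((s%:C)%C : C) (1 : C) = 'd f (y + (s%:C)%C *: k) k - 'd f y k.
  apply: etrans (e3 (1 : C)) _; congr (_ - _); first exact: e1.
  by apply: etrans (congr1 (fun h : C -> C => h (1 : C)) e2) _; exact: mul1r.
rewrite [X in nrm X]E.
apply: le_trans (loc_dlip k hy hs) _.
case/andP: s01 => s0 s1; rewrite nrmZ nrm_real ger0_norm//.
have -> : K2 * (s * nrm k) * nrm k = s * (K2 * nrm k ^+ 2) by ring.
by rewrite ler_piMl// mulr_ge0 ?loc_K20// sqr_ge0.
Qed.

Lemma ltr_mul_half (a n z b : R) : 0 < a -> 0 < b -> a * (n + 1) = b / 2 ->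
  0 <= n -> z <= a -> z * n < b.
Proof. by move=> a0 b0 ab n0 za; have := ler_wpM2r n0 za; lra. Qed.

Lemma quad_small (q n e : R) : 0 <= n -> n * (2 * q + 1) < e ->
  2 * (q * n ^+ 2) <= e * n.
Proof.
move=> n0 h; have -> : 2 * (q * n ^+ 2) = (2 * q * n) * n by ring.
by rewrite ler_wpM2r//; lra.
Qed.

Section DiffOfDiff.
Variable v0 : V.

Let r := rho / (2 * (nrm v0 + 1)).
Local Notation P t := (circ r t).

(** The derivative, with respect to (y, v) in the direction (h, w), of the integrand of
    Cauchy's formula for 'd f y v.  Its mean [dlim] over the circle is the expected
    differential of (y, v) |-> 'd f y v. *)
Definition dint (t : R) (h w : V) : C := ('d f (x0 + P t *: v0) (h + P t *: w) - 'd f x0 h) / P t.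

Lemma dd_r0 : 0 < r.
Proof. by rewrite /r divr_gt0// mulr_gt0// ltr_wpDl// nrm_ge0. Qed.

Lemma dd_rv (z : C) : nrm z <= r -> nrm (z *: v0) < rho.
Proof.
move=> zr; rewrite nrmZ; have v1 : 0 < nrm v0 + 1 by have := nrm_ge0 v0; lra.
have rE : r * (nrm v0 + 1) = rho / 2 by rewrite /r; field; rewrite gt_eqF.
exact: (ltr_mul_half dd_r0 rho0 rE (nrm_ge0 v0) zr).
Qed.

Lemma dd_hf y : nrm (y - x0) < rho -> differentiable f y.
Proof.
by move=> h; have [|//] := hf (y := y); apply: loc_lt1 h; rewrite ler1n.
Qed.

Lemma dd_near (z : C) : nrm z <= r -> nrm (x0 + z *: v0 - x0) < rho.
Proof. by move=> /dd_rv; rewrite addrAC subrr add0r. Qed.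

Lemma dint_continuous h w : continuous (fun t => dint t h w).
Proof.
move=> t; apply/cvgR_nrm.
apply: (@circ_comp_continuous R r dd_r0 C
  (fun z : C => ('d f (x0 + z *: v0) (h + z *: w) - 'd f x0 h) / z)) => z zr.
have z0 : z != 0.
  by apply/eqP => z0; move: zr; rewrite z0 nrm0 => E; have := dd_r0; rewrite -E ltxx.
have zr' : nrm z <= r by rewrite zr.
pose G u (z : C) : C := 'd f (x0 + z *: v0) u.
have cG u : {for z, continuous (G u)}.
  apply/cvg_nrm => e e0; pose B := (K2 * nrm u + 1) * (nrm v0 + 1).
  have v1 : 0 < nrm v0 + 1 by have := nrm_ge0 v0; lra.
  have B1 : 0 < K2 * nrm u + 1 by rewrite ltr_wpDl// mulr_ge0 ?loc_K20 ?nrm_ge0.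
  have B0 : 0 < B by rewrite mulr_gt0.
  exists (Num.min (rho / (nrm v0 + 1)) (e / B)); first by rewrite lt_min !divr_gt0.
  move=> z'; rewrite lt_min ltr_pdivlMr// ltr_pdivlMr// => /andP[h1 h2].
  have kk : nrm ((z' - z) *: v0) < rho.
    by rewrite nrmZ; have := nrm_ge0 (z' - z); lra.
  have := loc_dlip u (dd_near zr') kk; rewrite -addrA -scalerDl subrKC => h3.
  rewrite /G; apply: le_lt_trans h3 _; apply: le_lt_trans h2.
  rewrite nrmZ /B; have n1 := nrm_ge0 (z' - z); have n2 := nrm_ge0 v0.
  have n3 : 0 <= K2 * nrm u by rewrite mulr_ge0 ?loc_K20 ?nrm_ge0.
  have -> : K2 * (nrm (z' - z) * nrm v0) * nrm u = nrm (z' - z) * ((K2 * nrm u) * nrm v0) by ring.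
  by rewrite ler_wpM2l// ler_pM//; lra.
have -> : (fun z : C => ('d f (x0 + z *: v0) (h + z *: w) - 'd f x0 h) / z : C) =
    (fun z => (G h z + z * G w z - 'd f x0 h) * z^-1).
  by apply/funext => z'; rewrite /G linearD linearZ.
have cV : {for z, continuous (fun z : C => z^-1)}.
  by apply: differentiable_continuous; exact: differentiableV.
have cc : {for z, continuous (fun _ : C => 'd f x0 h : C)}.
  by apply: differentiable_continuous; exact: differentiable_cst.
have ci : {for z, continuous (fun z : C => z)}.
  by apply: differentiable_continuous.
apply: (continuousM_C _ cV).
exact: (continuousB (continuousD (cG h) (continuousM_C ci (cG w))) cc).
Qed.

Let pi2 : R := pi *+ 2.

Lemma dd_pi2 : 0 < pi2.
Proof. by have pg := pi_gt0 R; rewrite /pi2 mulr2n addr_gt0. Qed.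

Definition dlim (p : V * V) : C := cint (fun t => dint t p.1 p.2) 0 pi2 / ((pi2%:C)%C : C).

Lemma dlim_linear : linear dlim.
Proof.
move=> a [h w] [h' w']; rewrite /dlim/=.
have -> : (fun t => dint t (a *: h + h') (a *: w + w')) =
    (fun t => a * dint t h w + dint t h' w').
  apply/funext => t; rewrite /dint.
  have -> : a *: h + h' + P t *: (a *: w + w') =
      a *: (h + P t *: w) + (h' + P t *: w').
    by rewrite !scalerDr !scalerA (mulrC a) -!addrA; congr (_ + _); rewrite addrCA.
  have E y X Y : 'd f y (a *: X + Y) = a * 'd f y X + 'd f y Y by exact: linearP.
  by rewrite !E; ring.
rewrite (cintD _ _ (continuous_mulC (k := a) (@dint_continuous h w)) (@dint_continuous h' w')).
by rewrite (cintZ a _ _ (@dint_continuous h w)) mulrDl /GRing.scale/= mulrA.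
Qed.

Lemma cint_avg_bound (phi : R -> C) (B : R) : continuous phi ->
  (forall t, nrm (phi t) <= B) -> nrm (cint phi 0 pi2 / ((pi2%:C)%C : C)) <= 2 * B.
Proof.
move=> cphi HB; rewrite nrmM nrmV nrm_real gtr0_norm ?dd_pi2// ler_pdivrMr ?dd_pi2//.
by have := cint_bound (M := B) cphi (ltW dd_pi2) (fun t _ => HB t); rewrite subr0.
Qed.

Lemma dlim_bounded : exists K, forall p, nrm (dlim p) <= K * nrm p.
Proof.
exists (2 * ((K1 * (1 + r) + K1) / r)) => p; rewrite -mulrA; apply: cint_avg_bound.
  exact: dint_continuous.
move=> t; have Pr := nrm_circ dd_r0 t; have Pr' : nrm (P t) <= r by rewrite Pr.
rewrite /dint nrmM nrmV Pr mulrAC ler_pM2r ?invr_gt0 ?dd_r0//.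
apply: le_trans (nrmB _ _) _; rewrite mulrDl; apply: lerD.
  apply: le_trans (loc_bound _ _) _.
    by apply: loc_lt1 (dd_near Pr'); rewrite ler1n.
  rewrite -[X in _ <= X]mulrA ler_wpM2l ?loc_K10// mulrDl mul1r; apply: le_trans (nrmD _ _) _.
  by rewrite nrmZ Pr lerD ?nrm_pair1// ler_wpM2l ?(ltW dd_r0)// nrm_pair2.
apply: le_trans (loc_bound _ _) _; first by rewrite subrr nrm0 mulr_gt0.
by rewrite ler_wpM2l ?loc_K10// nrm_pair1.
Qed.

(** Write both values of the differential as means over the circle of radius r: the
    difference of the integrands and [dint] differ by quadratic remainders of f,
    controlled by [loc_quad]. *)
Lemma diff_diff_local : differentiable (fun p : V * V => 'd f (fst p) (snd p) : C) (x0, v0).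
Proof.
have [K HK] := dlim_bounded.
apply: (proj1 (@nrm_diff_fun _ _ _ _ _ dlim K dlim_linear HK _)) => e e0.
have rr := dd_r0.
have [L [L0 quad]] : exists L, 0 <= L /\ forall y k, nrm (y - x0) < rho -> nrm k < rho ->
    nrm (f (y + k) - f y - 'd f y k) <= L * nrm k ^+ 2.
  exists (2 * K2); split; last exact: loc_quad.
  by apply: mulr_ge0 => //; exact: loc_K20.
pose Q := (L * (1 + r) ^+ 2 + L) / r.
have Q0 : 0 <= Q.
  apply: divr_ge0 (ltW rr); apply: addr_ge0 => //; apply: mulr_ge0 => //.
  exact: sqr_ge0.
have q1 : 0 < 2 * Q + 1 by lra.
have r1 : 0 < 1 + r by lra.
exists (Num.min (Num.min (rho / 2) 1) (Num.min (rho / (1 + r)) (e / (2 * Q + 1)))).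
  by rewrite !lt_min !divr_gt0//= ltr01.
move=> [h w]; set N := nrm (h, w); rewrite !lt_min => /andP[/andP[N1 N2] /andP[N3 N4]] /=.
have hN : nrm h <= N by exact: (@nrm_pair1 R V V (h, w)).
have wN : nrm w <= N by exact: (@nrm_pair2 R V V (h, w)).
have N0 : 0 <= N := nrm_ge0 _.
have dfz (z : C) : nrm z <= r -> differentiable f (x0 + z *: v0).
  by move=> /dd_near; exact: dd_hf.
have v1 : 0 < nrm v0 + 1 by have := nrm_ge0 v0; lra.
have rE : r * (nrm v0 + 1) = rho / 2 by rewrite /r; field; rewrite gt_eqF.
have dfz' (z : C) : nrm z <= r -> differentiable f (x0 + h + z *: (v0 + w)).
  move=> zr; apply: dd_hf; rewrite -[x0 + h + _]addrA addrAC subrr add0r.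
  apply: le_lt_trans (nrmD _ _) _; rewrite nrmZ.
  have b1 : nrm (v0 + w) <= nrm v0 + 1 by apply: le_trans (nrmD _ _) _; lra.
  have b2 := ler_pM (nrm_ge0 _) (nrm_ge0 _) zr b1; lra.
have c1 := cauchy_integrand_continuous rr dfz'.
have c0 := cauchy_integrand_continuous rr dfz.
have p0 : ((pi2%:C)%C : C) != 0.
  by rewrite eq_complex/= eqxx andbT gt_eqF// dd_pi2.
have e1 : 'd f (x0 + h) (v0 + w) =
    cint (fun t => (f (x0 + h + P t *: (v0 + w)) - f (x0 + h)) / P t) 0 pi2 / ((pi2%:C)%C : C).
  by rewrite (cauchy_formula rr dfz') mulfK.
have e2 : 'd f x0 v0 =
    cint (fun t => (f (x0 + P t *: v0) - f x0) / P t) 0 pi2 / ((pi2%:C)%C : C).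
  by rewrite (cauchy_formula rr dfz) mulfK.
rewrite e1 e2 /dlim -!mulrBl -(cintB _ _ c1 c0) -(cintB _ _ (continuousB_C c1 c0) (@dint_continuous h w)).
apply: le_trans (cint_avg_bound (B := Q * N ^+ 2) _ _) _.
- exact: continuousB_C (continuousB_C c1 c0) (@dint_continuous h w).
- move=> t; have Pr := nrm_circ rr t; have Pr' : nrm (P t) <= r by rewrite Pr.
  pose y := x0 + P t *: v0; pose k := h + P t *: w.
  have -> : (f (x0 + h + P t *: (v0 + w)) - f (x0 + h)) / P t - (f (x0 + P t *: v0) - f x0) / P t
      - dint t h w = ((f (y + k) - f y - 'd f y k) - (f (x0 + h) - f x0 - 'd f x0 h)) / P t.
    rewrite /dint -/y -/k -!mulrBl; congr (_ / _).
    have -> : x0 + h + P t *: (v0 + w) = y + k by rewrite /y /k scalerDr addrACA.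
    ring.
  rewrite nrmM nrmV Pr /Q mulrAC ler_pM2r ?invr_gt0//.
  have kN : nrm k <= (1 + r) * N.
    apply: le_trans (nrmD _ _) _; rewrite nrmZ Pr mulrDl mul1r lerD//.
    by rewrite ler_wpM2l ?(ltW rr).
  have kr : nrm k < rho.
    by apply: le_lt_trans kN _; move: N3; rewrite ltr_pdivlMr// mulrC.
  have hr : nrm h < rho by lra.
  apply: le_trans (nrmB _ _) _; rewrite mulrDl; apply: lerD.
    apply: le_trans (quad _ _ (dd_near Pr') kr) _.
    rewrite -[X in _ <= X]mulrA -exprMn ler_wpM2l// ler_sqr ?nnegrE ?nrm_ge0//.
    by rewrite mulr_ge0// ltW.
  have x00 : nrm (x0 - x0) < rho by rewrite subrr nrm0.
  apply: le_trans (quad _ _ x00 hr) _.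
  by rewrite ler_wpM2l// ler_sqr ?nnegrE ?nrm_ge0.
- by apply: quad_small N0 _; move: N4; rewrite ltr_pdivlMr.
Qed.

End DiffOfDiff.
End LocalEstimates.

(** A function differentiable near x is bounded near x, so that the estimates above
    apply. *)
Theorem diff_diff (R : realType) (V : normedModType R[i]) (f : V -> (R[i])^o) (x v : V) :
  (\forall y \near x, differentiable f y) ->
  differentiable (fun p : V * V => 'd f (fst p) (snd p) : (R[i])^o) (x, v).
Proof.
move=> nf; have [d d0 Hd] := (nbhs_nrm _ _).1 nf.
have /cvg_nrm/(_ _ ltr01)[d' d'0 Hd'] : {for x, continuous f}.
  by apply: differentiable_continuous; apply: Hd; rewrite subrr nrm0.
apply: (@diff_diff_local R V f x (Num.min d d' / 4) (nrm (f x) + 1)).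
  by rewrite divr_gt0// lt_min d0.
move=> y; rewrite mulrC divfK// lt_min => /andP[/Hd h1 /Hd' h2]; split => //.
by rewrite -[f y](subrK (f x)); apply: le_trans (nrmD _ _) _; lra.
Qed.

(** * Liouville's theorem *)

Section Liouville.
Variable R : realType.
Local Notation C := (R[i]^o).

(** Cauchy's estimate on arbitrarily large discs shows that the differential
    vanishes. *)
Lemma entire_bounded_const (F : C -> C) (B : R) :
  (forall z, differentiable F z /\ nrm (F z) <= B) -> forall z, F z = F 0.
Proof.
move=> HF; have B0 : 0 <= B by have [_] := HF 0; exact: le_trans (nrm_ge0 _).
have d0 (y v : C) : 'd F y v = 0.
  apply: nrm0_eq0; apply/eqP; rewrite eq_le nrm_ge0 andbT.
  apply/ler_addgt0Pl => e e0; rewrite addr0.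
  have b1 : 0 < 8 * B * nrm v + 1 by rewrite ltr_wpDl// !mulr_ge0// nrm_ge0.
  have r0 : 0 < (8 * B * nrm v + 1) / e by rewrite divr_gt0.
  apply: le_trans (cauchy_bound v r0 (fun y' _ => HF y')) _.
  have b0 : 0 <= 8 * B * nrm v by rewrite !mulr_ge0// nrm_ge0.
  have -> : 8 * B / ((8 * B * nrm v + 1) / e) * nrm v =
     e * ((8 * B * nrm v) / (8 * B * nrm v + 1)).
    by field; rewrite !gt_eqF.
  by rewrite ger_pMr// ler_pdivrMr// mul1r lerDl.
move=> z; apply/eqP; rewrite -subr_eq0; apply/eqP; apply: nrm0_eq0.
apply/eqP; rewrite eq_le nrm_ge0 andbT.
have := @mvt_C R (fun t : C => F (0 + t *: z)) 0.
rewrite mulr0 scale1r scale0r !add0r; apply => s _.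
have [df E] := @diff_line R C C F 0 z (s%:C)%C (HF _).1.
by split; [exact: df|rewrite [X in nrm X]E [X in nrm X]d0 nrm0].
Qed.

Lemma continuous_bounded_disc (g : C -> C) : (forall z, {for z, continuous g}) ->
  exists B, forall z, nrm z <= 1 -> nrm (g z) <= B.
Proof.
move=> cg; pose p (xy : R * R) : C := Complex xy.1 xy.2.
pose A := `[(-1 : R), 1]%classic `*` `[(-1 : R), 1]%classic.
have cA : compact A by apply: compact_setX; exact: segment_compact.
have cf : continuous (fun xy : R * R => nrm (g (p xy))).
  move=> xy; apply/cvgrPdist_lt => e e0.
  have /cvg_nrm/(_ _ e0)[d d0 H] := cg (p xy).
  have d2 : 0 < d / 2 by rewrite divr_gt0.
  exists (ball xy.1 (d / 2), ball xy.2 (d / 2)) => /=.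
    by split; exact: nbhsx_ballx.
  move=> [x y] [/= h1 h2].
  rewrite /ball/= in h1 h2.
  have : nrm (g (p (x, y)) - g (p xy)) < e.
    apply: H; apply: le_lt_trans (nrm_le_ReIm _) _.
    rewrite [X in `|X| + _](_ : _ = x - xy.1)// [X in _ + `|X|](_ : _ = y - xy.2)//.
    by rewrite (distrC x) (distrC y); lra.
  apply: le_lt_trans; rewrite distrC ler_norml; apply/andP; split.
    have := nrmD (g (p (x, y))) (g (p xy) - g (p (x, y))).
    by rewrite subrKC (nrmC (g (p xy))); lra.
  by have := nrmD (g (p xy)) (g (p (x, y)) - g (p xy)); rewrite subrKC; lra.
have A0 : A !=set0 by exists (0, 0); split => /=; rewrite in_itv/=; apply/andP; split; lra.
have [c _ Hc] := compact_EVT_max A0 cA (continuous_subspaceT cf).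
exists (nrm (g (p c))) => z z1.
have := Hc (Re z, Im z); rewrite /p /=.
have -> : Complex (Re z) (Im z) = z by case: z {z1}.
apply; rewrite inE; split => /=; rewrite in_itv/= -ler_norml.
  exact: le_trans (ler_Re_nrm z) z1.
exact: le_trans (ler_Im_nrm z) z1.
Qed.

(** The pair (g, h) is a holomorphic function on the projective line, given in the
    two affine charts; both are bounded on the unit disc, so g is bounded. *)
Lemma liouville_P1 (g h : C -> C) :
  (forall z, differentiable g z) -> (forall z, differentiable h z) ->
  (forall z, z != 0 -> g z = h z^-1) -> forall z, g z = g 0.
Proof.
move=> dg dh gh.
have [B HB] := continuous_bounded_disc (fun z => differentiable_continuous (dg z)).
have [B' HB'] := continuous_bounded_disc (fun z => differentiable_continuous (dh z)).
apply: (@entire_bounded_const g (Num.max B B')) => z; split; first exact: dg.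
rewrite le_max; have [z1|z1] := leP (nrm z) 1; first by rewrite HB.
have z0 : z != 0 by apply/eqP => z0; move: z1; rewrite z0 nrm0 ltr10.
by rewrite gh// HB' ?orbT// nrmV invf_le1 ?nrm_gt0// ltW.
Qed.

End Liouville.

(** * A class of smooth functions closed under composition *)

Section Hadamard.
Variable R : realType.
Local Notation C := (R[i]^o).

(** A strengthened directional derivative, of Hadamard type, uniform for the
    directions close to v.  Unlike the derivative in the single direction v, it
    satisfies the chain rule ([hadamard_comp]). *)
Definition hadamard (E F : normedModType R[i]) (f : E -> F) (x v : E) (w : F) : Prop :=
  forall e : R, 0 < e -> exists2 d : R, 0 < d &
    forall (h : R) v', h != 0 -> `|h| < d -> nrm (v' - v) < d ->
      nrm ((h%:C)%C^-1 *: (f (x + (h%:C)%C *: v') - f x) - w) < e.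

(** The counterpart of [real_Ck] for this derivative: a smaller class, in which
    smoothness is preserved by composition. *)
Fixpoint hadamard_Ck (F : normedModType R[i]) (n : nat)
    (E : normedModType R[i]) (A : set E) (f : E -> F) {struct n} : Prop :=
  (forall x, A x -> {for x, continuous f}) /\
  match n with
  | 0 => True
  | m.+1 => exists Df : (E * E)%type -> F,
      (forall x v, A x -> hadamard f x v (Df (x, v))) /\
      hadamard_Ck m (A `*` [set: E]) Df
  end.

Lemma nrm_pair_lt (V W : normedModType R[i]) (p : V * W) (e : R) :
  nrm p.1 < e -> nrm p.2 < e -> nrm p < e.
Proof.
rewrite -!ltcR -!nrmE prod_normE => h1 h2.
by rewrite comparable_gt_max ?h1// real_comparable ?normr_real.
Qed.

Lemma hadamard_Ck_real (F : normedModType R[i]) n : forall (E : normedModType R[i])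
  (A : set E) (f : E -> F), hadamard_Ck n A f -> real_Ck n A f.
Proof.
elim: n => [//|n IH] E A f [cf [Df [hD /IH HD]]]; split => //.
exists Df; split => // x v Ax W /nbhs_nrm[e e0 We].
have [d d0 H] := hD x v Ax e e0.
apply/nbhs_ballP; exists d => //= h; rewrite /ball/= sub0r normrN => hd h0.
by apply: We; apply: H => //; rewrite subrr nrm0.
Qed.

Lemma hadamard_Ck_sub (F : normedModType R[i]) n : forall (E : normedModType R[i])
  (A B : set E) (f : E -> F), A `<=` B -> hadamard_Ck n B f -> hadamard_Ck n A f.
Proof.
elim: n => [|n IH] E A B f AB /=; first by case=> cf _; split => // x /AB; exact: cf.
case=> cf [Df [hD HD]]; split; first by move=> x /AB; exact: cf.
exists Df; split; first by move=> x v /AB; exact: hD.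
by apply: IH HD => -[x v] [/= /AB].
Qed.

Lemma hadamard_CkW (F : normedModType R[i]) n : forall (E : normedModType R[i])
  (A : set E) (f : E -> F), hadamard_Ck n.+1 A f -> hadamard_Ck n A f.
Proof.
elim: n => [|n IH] E A f; first by case=> cf _.
case=> cf [Df [hD HD]]; split => //; exists Df; split => //.
exact: IH.
Qed.

Section RealLinear.
Variables (E F : normedModType R[i]) (L : E -> F) (K : R).
Hypothesis LD : {morph L : x y / x + y}.
Hypothesis LZ : forall (h : R) x, L ((h%:C)%C *: x) = (h%:C)%C *: L x.
Hypothesis LK : forall x, nrm (L x) <= K * nrm x.

Lemma Rlinear_sub x y : L (y - x) = L y - L x.
Proof. by apply/eqP; rewrite eq_sym subr_eq -LD subrK. Qed.

Lemma Rlinear_cont x (e : R) : 0 < e -> exists2 d : R, 0 < d &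
  forall y, nrm (y - x) < d -> nrm (L y - L x) < e.
Proof.
move=> e0; have K1 : 0 < `|K| + 1 by have := normr_ge0 K; lra.
exists (e / (`|K| + 1)); first by rewrite divr_gt0.
move=> y; rewrite ltr_pdivlMr// -Rlinear_sub => yx.
apply: le_lt_trans (LK _) _; apply: le_lt_trans yx; rewrite mulrC ler_wpM2l ?nrm_ge0//.
by have := ler_norm K; lra.
Qed.

End RealLinear.

(** Only additivity and real homogeneity are required, so that complex conjugation is
    included; the derivative of L is L itself, evaluated on the direction. *)
Lemma hadamard_Ck_Rlinear (F : normedModType R[i]) n : forall (E : normedModType R[i])
    (A : set E) (L : E -> F) (K : R), 0 <= K ->
  {morph L : x y / x + y} -> (forall (h : R) x, L ((h%:C)%C *: x) = (h%:C)%C *: L x) ->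
  (forall x, nrm (L x) <= K * nrm x) -> hadamard_Ck n A L.
Proof.
elim: n => [|n IH] E A L K K0 LD LZ LK.
  by split => // x _; apply/cvg_nrm; exact: (Rlinear_cont LD LK).
split; first by move=> x _; apply/cvg_nrm; exact: (Rlinear_cont LD LK).
exists (L \o snd); split; last first.
  apply: (IH _ _ _ K K0) => [x y|h x|x] /=; [exact: LD|exact: LZ|].
  by apply: le_trans (LK _) _; rewrite ler_wpM2l// nrm_pair2.
move=> x v _ e e0; have [d d0 H] := Rlinear_cont LD LK v e0; exists d => //.
move=> h v' h0 _ /H; rewrite [x + _]addrC LD addrK LZ scalerA mulVf ?scale1r//.
by rewrite eq_complex/= eqxx andbT.
Qed.

Lemma hadamard_Ck_pair (F G : normedModType R[i]) n : forall (E : normedModType R[i])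
    (A : set E) (f : E -> F) (g : E -> G),
  hadamard_Ck n A f -> hadamard_Ck n A g -> hadamard_Ck n A (fun x => (f x, g x)).
Proof.
have cont (E : normedModType R[i]) (f : E -> F) (g : E -> G) x :
    {for x, continuous f} -> {for x, continuous g} ->
    {for x, continuous (fun x => (f x, g x))}.
  move=> /cvg_nrm cf /cvg_nrm cg; apply/cvg_nrm => e e0.
  have [d1 d10 H1] := cf _ e0; have [d2 d20 H2] := cg _ e0.
  exists (Num.min d1 d2); first by rewrite lt_min d10.
  by move=> y; rewrite lt_min => /andP[/H1 h1 /H2 h2]; exact: nrm_pair_lt.
elim: n => [|n IH] E A f g.
  by move=> [cf _] [cg _]; split => // x Ax; apply: cont; [exact: cf|exact: cg].
move=> [cf [Df [hf Hf]]] [cg [Dg [hg Hg]]]; split.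
  by move=> x Ax; apply: cont; [exact: cf|exact: cg].
exists (fun p => (Df p, Dg p)); split; last exact: IH.
move=> x v Ax e e0; have [d1 d10 H1] := hf x v Ax _ e0; have [d2 d20 H2] := hg x v Ax _ e0.
exists (Num.min d1 d2); first by rewrite lt_min d10.
move=> h v' h0; rewrite !lt_min => /andP[a1 a2] /andP[b1 b2].
by apply: nrm_pair_lt; [exact: H1|exact: H2].
Qed.

Lemma hadamard_comp (E F G : normedModType R[i]) (g : E -> F) (f : F -> G) x v w z :
  hadamard g x v w -> hadamard f (g x) w z -> hadamard (f \o g) x v z.
Proof.
move=> hg hf e e0; have [d1 d10 H1] := hf e e0; have [d2 d20 H2] := hg _ d10.
exists (Num.min d1 d2); first by rewrite lt_min d10.
move=> h v' h0; rewrite !lt_min => /andP[a1 a2] /andP[b1 b2].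
have := H1 h _ h0 a1 (H2 h v' h0 a2 b2).
have hC : (h%:C)%C != 0 :> R[i] by rewrite eq_complex/= eqxx andbT.
by rewrite scalerA mulfV// scale1r subrKC.
Qed.

Lemma hadamard_Ck_fst n (E F : normedModType R[i]) (A : set (E * F)) :
  hadamard_Ck n A fst.
Proof.
apply: (@hadamard_Ck_Rlinear _ _ _ _ _ 1) => // x.
by rewrite mul1r nrm_pair1.
Qed.

(** The derivative of f o g is the composite of Df with the map (x, v) |-> (g x, Dg (x, v)),
    to which the induction hypothesis applies. *)
Lemma hadamard_Ck_comp n :
  forall (E F G : normedModType R[i]) (A : set E) (B : set F) (g : E -> F) (f : F -> G),
  hadamard_Ck n A g -> hadamard_Ck n B f -> (forall x, A x -> B (g x)) ->
  hadamard_Ck n A (f \o g).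
Proof.
elim: n => [|n IH] E F G A B g f.
  move=> [cg _] [cf _] AB; split => // x Ax.
  by apply: continuous_comp; [exact: cg|apply: cf; exact: AB].
move=> Hg [cf [Df [hf Hf]]] AB; have HgW := hadamard_CkW Hg.
case: Hg => [cg [Dg [hg Hg]]]; split.
  by move=> x Ax; apply: continuous_comp; [exact: cg|apply: cf; exact: AB].
exists (Df \o (fun p => (g p.1, Dg p))); split.
  move=> x v Ax; apply: hadamard_comp (hg x v Ax) _.
  by apply: hf; exact: AB.
apply: (IH _ _ _ _ (B `*` setT) _ Df) => //; last by move=> [x v] [/= /AB].
apply: hadamard_Ck_pair => //.
apply: (IH _ _ _ _ A fst g) => //; last by move=> [x v] [].
exact: hadamard_Ck_fst.
Qed.

Lemma open_setXT (S T : topologicalType) (A : set S) : open A -> open (A `*` [set: T]).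
Proof.
move=> oA; have -> : A `*` [set: T] = fst @^-1` A by apply/seteqP; split => -[x y] /=; [case|].
by apply: open_comp => // -[x y] _; exact: cvg_fst.
Qed.

(** The derivative (x, v) |-> 'd f x v is holomorphic by [diff_diff], which allows an
    induction on n over all spaces E. *)
Lemma hadamard_Ck_holo n : forall (E : normedModType R[i]) (A : set E) (f : E -> C),
  open A -> (forall x, A x -> differentiable f x) -> hadamard_Ck n A f.
Proof.
elim: n => [|n IH] E A f oA df.
  by split => // x /df; exact: differentiable_continuous.
split; first by move=> x /df; exact: differentiable_continuous.
exists (fun p => 'd f (fst p) (snd p) : C); split; last first.
  apply: IH; first exact: open_setXT.
  move=> [x v] [/= Ax _]; apply: diff_diff.
  by apply: filterS (open_nbhs_nbhs (conj oA Ax)).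
move=> x v Ax e e0; have dfx := df _ Ax.
have [K K0 HK] := linear_bounded (diff_continuous dfx).
have B0 : 0 < nrm v + 1 by have := nrm_ge0 v; lra.
have e2 : 0 < e / (4 * (nrm v + 1)) by rewrite divr_gt0// mulr_gt0.
have [d d0 H] := diff_nrm dfx e2.
exists (Num.min (Num.min 1 (d / (nrm v + 1))) (e / (4 * K))).
  by rewrite !lt_min ltr01 !divr_gt0// mulr_gt0.
move=> h v' h0; rewrite !lt_min => /andP[/andP[_ h1] _] /andP[/andP[v1 _] v2].
have hC : (h%:C)%C != 0 :> R[i] by rewrite eq_complex/= eqxx andbT.
have nv' : nrm v' <= nrm v + 1.
  by have := nrmD (v' - v) v; rewrite subrK; lra.
have hp : 0 < `|h| by rewrite normr_gt0.
have nh : nrm ((h%:C)%C *: v') < d.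
  move: h1; rewrite ltr_pdivlMr// nrmZ nrm_real; apply: le_lt_trans.
  by rewrite ler_wpM2l// ltW.
have := H _ nh; set r := f _ - f x - _ => rb.
have -> : (h%:C)%C^-1 *: (f (x + (h%:C)%C *: v') - f x) - 'd f x v
    = (h%:C)%C^-1 * r + 'd f x (v' - v).
  have EZ : 'd f x ((h%:C)%C *: v') = (h%:C)%C * 'd f x v' by exact: linearZ.
  have EB : 'd f x (v' - v) = 'd f x v' - 'd f x v by exact: linearB.
  rewrite /r EZ EB; move: ('d f x v') ('d f x v) (f _) (f x) => p q s t.
  by rewrite /GRing.scale/=; field.
apply: le_lt_trans (nrmD _ _) _.
have b1 : nrm ((h%:C)%C^-1 * r : C) <= e / 4.
  rewrite nrmM nrmV nrm_real mulrC ler_pdivrMr//; apply: le_trans rb _.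
  rewrite nrmZ nrm_real; apply: le_trans (_ : e / (4 * (nrm v + 1)) * (`|h| * (nrm v + 1)) <= _).
    by rewrite ler_wpM2l ?ler_wpM2l// ltW.
  by rewrite le_eqVlt; apply/orP; left; apply/eqP; field; rewrite gt_eqF.
have b2 : nrm ('d f x (v' - v)) <= e / 4.
  apply: le_trans (HK _) _; move: v2; rewrite ltr_pdivlMr ?mulr_gt0// => v2; lra.
by apply: le_lt_trans (lerD b1 b2) _; lra.
Qed.

End Hadamard.

(** * Coordinates of C^3 *)

Section Coordinates.
Variable R : realType.
Local Notation C := (R[i]^o).

Lemma C3_crd (x : 'rV[R[i]]_3) : C3 (crd0 x) (crd1 x) (crd2 x) = x.
Proof.
apply/rowP => -[[|[|[|//]]] h]; rewrite mxE /=; congr (x _ _); exact: val_inj.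
Qed.

Lemma crd0_C3 (a b c : R[i]) : crd0 (C3 a b c) = a. Proof. by rewrite /crd0 mxE. Qed.
Lemma crd1_C3 (a b c : R[i]) : crd1 (C3 a b c) = b. Proof. by rewrite /crd1 mxE. Qed.
Lemma crd2_C3 (a b c : R[i]) : crd2 (C3 a b c) = c. Proof. by rewrite /crd2 mxE. Qed.

Definition crdE := (crd0_C3, crd1_C3, crd2_C3).

Lemma C3E (a b c : R[i]) : C3 a b c = a *: C3 1 0 0 + b *: C3 0 1 0 + c *: C3 0 0 1.
Proof.
by apply/rowP => -[[|[|[|//]]] h]; rewrite !mxE /= ?mulr1 ?mulr0 ?addr0 ?add0r.
Qed.

Lemma differentiable_crd0 (x : ('rV[R[i]]_3 : normedModType R[i])) : differentiable (@crd0 R : 'rV[R[i]]_3 -> C) x.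
Proof. exact: differentiable_coord. Qed.
Lemma differentiable_crd1 (x : ('rV[R[i]]_3 : normedModType R[i])) : differentiable (@crd1 R : 'rV[R[i]]_3 -> C) x.
Proof. exact: differentiable_coord. Qed.
Lemma differentiable_crd2 (x : ('rV[R[i]]_3 : normedModType R[i])) : differentiable (@crd2 R : 'rV[R[i]]_3 -> C) x.
Proof. exact: differentiable_coord. Qed.

Section Maps.
Variable E : normedModType R[i].

Lemma differentiable_C3 (a b c : E -> C) x : differentiable a x ->
  differentiable b x -> differentiable c x ->
  differentiable (fun x => C3 (a x) (b x) (c x)) x.
Proof.
move=> da db dc.
have -> : (fun x => C3 (a x) (b x) (c x)) =
    (fun x => (a x *: C3 1 0 0 + b x *: C3 0 1 0) + c x *: C3 0 0 1).
  by apply/funext => y; rewrite C3E.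
by apply: differentiableD; [apply: differentiableD|]; exact: differentiableZl.
Qed.

Lemma hadamard_Ck_C3 n (A : set E) (a b c : E -> C) : hadamard_Ck n A a ->
  hadamard_Ck n A b -> hadamard_Ck n A c ->
  hadamard_Ck n A (fun x => C3 (a x) (b x) (c x)).
Proof.
move=> ha hb hc.
pose L (p : C * C * C) := C3 p.1.1 p.1.2 p.2.
have hL : hadamard_Ck n setT L.
  pose K := nrm (C3 (1 : R[i]) 0 0) + nrm (C3 (0 : R[i]) 1 0) + nrm (C3 (0 : R[i]) 0 1).
  have K0 : 0 <= K by rewrite !addr_ge0 ?nrm_ge0.
  apply: (hadamard_Ck_Rlinear _ _ K0).
  - move=> [[a1 b1] c1] [[a2 b2] c2]; rewrite /L/=.
    by apply/rowP => -[[|[|[|//]]] h]; rewrite !mxE.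
  - move=> h [[a1 b1] c1]; rewrite /L/=.
    by apply/rowP => -[[|[|[|//]]] h']; rewrite !mxE.
  - move=> p; rewrite /L C3E /K !mulrDl.
    have h1 : nrm p.1.1 <= nrm p := le_trans (nrm_pair1 _) (nrm_pair1 _).
    have h2 : nrm p.1.2 <= nrm p := le_trans (nrm_pair2 _) (nrm_pair1 _).
    have h3 : nrm p.2 <= nrm p := nrm_pair2 _.
    apply: le_trans (nrmD _ _) _; apply: lerD; last first.
      by rewrite nrmZ mulrC ler_wpM2l ?nrm_ge0.
    apply: le_trans (nrmD _ _) _; apply: lerD.
      by rewrite nrmZ mulrC ler_wpM2l ?nrm_ge0.
    by rewrite nrmZ mulrC ler_wpM2l ?nrm_ge0.
have hp := hadamard_Ck_pair (hadamard_Ck_pair ha hb) hc.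
exact: (hadamard_Ck_comp hp hL (fun _ _ => I)).
Qed.

Lemma hadamard_Ck_holo3 n (A : set E) (f : E -> 'rV[R[i]]_3) : open A ->
  (forall x, A x -> differentiable f x) -> hadamard_Ck n A f.
Proof.
move=> oA df.
have -> : f = (fun x => C3 (crd0 (f x)) (crd1 (f x)) (crd2 (f x))).
  by apply/funext => x; rewrite C3_crd.
apply: hadamard_Ck_C3; apply: hadamard_Ck_holo => // x /df fx.
- exact: (differentiable_comp fx (differentiable_crd0 _)).
- exact: (differentiable_comp fx (differentiable_crd1 _)).
- exact: (differentiable_comp fx (differentiable_crd2 _)).
Qed.

End Maps.

Lemma differentiable_near_eq (V W : normedModType R[i]) (f g : V -> W) (x : V) :
  (\forall y \near x, f y = g y) -> differentiable f x -> differentiable g x.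
Proof.
move=> fg df; have [d d0 Hd] := (nbhs_nrm _ _).1 fg.
have fgx : f x = g x by apply: Hd; rewrite subrr nrm0.
apply: (proj1 (@nrm_diff _ _ _ g x ('d f x) (diff_continuous df) _)) => e e0.
have [d' d'0 H] := diff_nrm df e0.
exists (Num.min d d'); first by rewrite lt_min d0.
move=> h; rewrite lt_min => /andP[h1 h2]; rewrite -fgx -Hd ?H//.
by rewrite addrAC subrr add0r.
Qed.

Lemma diff_left_inverse (V W : normedModType R[i]) (f : V -> W) (g : W -> V) (x : V) :
  differentiable f x -> differentiable g (f x) ->
  (\forall y \near x, g (f y) = y) -> forall h, 'd g (f x) ('d f x h) = h.
Proof.
move=> df dg gf h.
have dgf : differentiable (g \o f) x by exact: differentiable_comp.
have E : 'd (g \o f) x = 'd g (f x) \o 'd f x :> (V -> V) := diff_comp df dg.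
have [d d0 Hd] := (nbhs_nrm _ _).1 gf.
have [| | |_ E2] := @nrm_diff_fun _ _ _ (g \o f) x id 1.
- by [].
- by move=> u; rewrite mul1r.
- move=> e e0; exists d => // u ud /=; rewrite !Hd ?subrr ?nrm0//; last first.
    by rewrite addrAC subrr add0r.
  by rewrite [x + u]addrC addrK subrr nrm0 mulr_ge0 ?nrm_ge0// ltW.
have E3 : 'd g (f x) \o 'd f x = id :> (V -> V) by rewrite -E -E2.
exact: (congr1 (fun F : V -> V => F h) E3).
Qed.

End Coordinates.

(** * Charts twisted by families of diffeomorphisms *)

Section ChartTopology.
Variables (R : realType) (T : topologicalType) (E : normedModType R[i]).
Implicit Types (c d : chart T E).

Lemma cinvP c p : (cfun c @` cdom c) p -> cdom c (cinv c p) /\ cfun c (cinv c p) = p.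
Proof. by move=> [x cx <-]; rewrite cfunK. Qed.

Lemma cinv_continuous_at c p : (cfun c @` cdom c) p -> {for p, continuous (cinv c)}.
Proof.
move=> cp; have := @cinv_continuous _ _ _ c.
by rewrite continuous_open_subspace; [apply; rewrite inE|exact: cimg_open].
Qed.

Lemma cfun_continuous_at c x : cdom c x -> {for x, continuous (cfun c)}.
Proof.
move=> cx; have := @cfun_continuous _ _ _ c.
by rewrite continuous_open_subspace; [apply; rewrite inE|exact: cdom_open].
Qed.

Lemma cinv_near c x (A : set T) : cdom c x -> nbhs x A ->
  \forall p \near cfun c x, cdom c (cinv c p) /\ A (cinv c p).
Proof.
move=> cx xA; have cp : (cfun c @` cdom c) (cfun c x) by exists x.
have H : cinv c @ cfun c x --> cinv c (cfun c x) by exact: cinv_continuous_at.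
rewrite cfunK// in H.
have nx : nbhs x (cdom c `&` A).
  by apply: filterI => //; apply: open_nbhs_nbhs; split => //; exact: cdom_open.
exact: H nx.
Qed.

Lemma cimage_open c (A : set T) : open A -> open (cfun c @` (cdom c `&` A)).
Proof.
move=> oA; rewrite openE => p [x [cx Ax] <-].
have xA : nbhs x A by exact: open_nbhs_nbhs.
have io : nbhs (cfun c x) (cfun c @` cdom c).
  by apply: open_nbhs_nbhs; split; [exact: cimg_open|exists x].
apply: (@filterS _ _ _ _ _ _ (filterI io (cinv_near cx xA))) => q [/cinvP[_ h] [h1 h2]].
by exists (cinv c q).
Qed.

End ChartTopology.

Section Twist.
Variable R : realType.
Local Notation C := (R[i]^o).
Local Notation M3 := ('rV[R[i]]_3 : normedModType R[i]).

(** A family, smooth in the parameter t, of diffeomorphisms of C^3 and their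
    inverses. *)
Record twist := Twist {
  tw : (M3 * C)%type -> M3;
  twi : (M3 * C)%type -> M3;
  twK : forall p t, twi (tw (p, t), t) = p;
  twiK : forall p t, tw (twi (p, t), t) = p;
  tw_smooth : forall n, hadamard_Ck n setT tw;
  twi_smooth : forall n, hadamard_Ck n setT twi }.

Lemma tw_continuous (a : twist) : continuous (tw a).
Proof. by move=> p; have [H _] := tw_smooth a 0; exact: H. Qed.

Lemma twi_continuous (a : twist) : continuous (twi a).
Proof. by move=> p; have [H _] := twi_smooth a 0; exact: H. Qed.

Lemma continuous_pairC (S T : topologicalType) (t : T) : continuous (fun x : S => (x, t)).
Proof. by move=> x; apply: cvg_pair; [exact: cvg_id|exact: cvg_cst]. Qed.

Lemma continuous_pair (S U V : topologicalType) (f : S -> U) (g : S -> V) (x : S) :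
  {for x, continuous f} -> {for x, continuous g} ->
  {for x, continuous (fun y => (f y, g y))}.
Proof. by move=> cf cg; exact: (cvg_pair cf cg). Qed.

Lemma continuous_fst (S U : topologicalType) (x : S * U) : {for x, continuous fst}.
Proof. by case: x => x y; exact: cvg_fst. Qed.

Lemma continuous_snd (S U : topologicalType) (x : S * U) : {for x, continuous snd}.
Proof. by case: x => x y; exact: cvg_snd. Qed.

Variable T : topologicalType.
Implicit Types c : chart T M3.

Definition full c := cfun c @` cdom c = [set: M3].

Lemma full_dom c p : full c -> cdom c (cinv c p).
Proof. by move=> fc; have [] := @cinvP _ _ _ c p _; rewrite ?fc. Qed.

Lemma full_K c p : full c -> cfun c (cinv c p) = p.
Proof. by move=> fc; have [] := @cinvP _ _ _ c p _; rewrite ?fc. Qed.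

Lemma full_continuous c : full c -> continuous (cinv c).
Proof. by move=> fc p; apply: cinv_continuous_at; rewrite fc. Qed.

(** The chart c followed by the diffeomorphism of parameter t: a chart for another
    complex structure on the same space. *)
Section Slice.
Variables (c : chart T M3) (fc : full c) (a : twist) (t : C).

Let sf x := twi a (cfun c x, t).
Let si p := cinv c (tw a (p, t)).

Let sdom_open : open (cdom c). Proof. exact: cdom_open. Qed.

Lemma slice_img : sf @` cdom c = [set: M3].
Proof.
apply/seteqP; split => // p _; exists (si p); first exact: full_dom.
by rewrite /sf /si full_K// twK.
Qed.

Let simg_open : open (sf @` cdom c). Proof. by rewrite slice_img; exact: openT. Qed.

Let sfunK x : cdom c x -> si (sf x) = x.
Proof. by move=> cx; rewrite /si /sf twiK cfunK. Qed.

Let sfun_continuous : {within cdom c, continuous sf}.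
Proof.
rewrite continuous_open_subspace; last exact: cdom_open.
move=> x; rewrite inE => cx.
have h : {for x, continuous (fun x => (cfun c x, t))}.
  apply: (@continuous_comp _ _ _ (cfun c) (fun p : M3 => (p, t))).
    exact: cfun_continuous_at.
  exact: continuous_pairC.
apply: (@continuous_comp _ _ _ (fun x => (cfun c x, t)) (twi a)) => //.
exact: twi_continuous.
Qed.

Let sinv_continuous : {within sf @` cdom c, continuous si}.
Proof.
apply: continuous_subspaceT => p.
have h : {for p, continuous (fun p : M3 => tw a (p, t))}.
  apply: (@continuous_comp _ _ _ (fun p : M3 => (p, t)) (tw a)).
    exact: continuous_pairC.
  exact: tw_continuous.
by apply: (@continuous_comp _ _ _ (fun p : M3 => tw a (p, t)) (cinv c)) => //; exact: full_continuous.
Qed.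

Definition slice : chart T M3 :=
  Chart sdom_open simg_open sfunK sfun_continuous sinv_continuous.

End Slice.

(** All these charts together, as a chart of the product of the space with the line of
    parameters. *)
Section Total.
Variables (c : chart T M3) (fc : full c) (a : twist).

Let tf (y : T * C) := (twi a (cfun c y.1, y.2), y.2).
Let ti (p : M3 * C) := (cinv c (tw a p), p.2).
Let td : set (T * C) := cdom c `*` setT.

Let tdom_open : open td. Proof. apply: open_setXT; exact: cdom_open. Qed.

Lemma tchart_img : tf @` td = [set: M3 * C].
Proof.
apply/seteqP; split => // -[p t] _; exists (ti (p, t)); first by split => //; exact: full_dom.
by rewrite /tf /ti /= full_K// twK.
Qed.

Let timg_open : open (tf @` td). Proof. by rewrite tchart_img; exact: openT. Qed.

Let tfunK y : td y -> ti (tf y) = y.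
Proof. by case: y => x t [/= cx _]; rewrite /ti /tf/= twiK cfunK. Qed.

Let tfun_continuous : {within td, continuous tf}.
Proof.
rewrite continuous_open_subspace; last exact: tdom_open.
move=> [x t]; rewrite inE => -[/= cx _].
have h : {for (x, t), continuous (fun y : T * C => (cfun c y.1, y.2))}.
  apply: continuous_pair; last exact: continuous_snd.
  apply: (@continuous_comp _ _ _ fst (cfun c)); first exact: continuous_fst.
  exact: cfun_continuous_at.
apply: (@continuous_pair _ _ _ (fun y : T * C => twi a (cfun c y.1, y.2)) snd).
  2: exact: continuous_snd.
apply: (@continuous_comp _ _ _ (fun y : T * C => (cfun c y.1, y.2)) (twi a)) => //.
exact: twi_continuous.
Qed.

Let tinv_continuous : {within tf @` td, continuous ti}.
Proof.
apply: continuous_subspaceT => p.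
apply: (@continuous_pair _ _ _ (fun p => cinv c (tw a p)) snd); last exact: continuous_snd.
by apply: (@continuous_comp _ _ _ (tw a) (cinv c)); [exact: tw_continuous|exact: full_continuous].
Qed.

Definition tchart : chart (T * C)%type (M3 * C)%type :=
  Chart tdom_open timg_open tfunK tfun_continuous tinv_continuous.

End Total.
End Twist.

Section ProductSpaces.

Lemma hausdorff_pair (S T : topologicalType) : hausdorff_space S -> hausdorff_space T ->
  hausdorff_space (S * T)%type.
Proof.
move=> hS hT [a b] [c d] cl; congr (_, _).
  apply: hS => A B nA nB.
  have nA' : nbhs (a, b) (fst @^-1` A) by exact: (@continuous_fst S T (a, b) _ nA).
  have nB' : nbhs (c, d) (fst @^-1` B) by exact: (@continuous_fst S T (c, d) _ nB).
  by have [x [Ax Bx]] := cl _ _ nA' nB'; exists x.1.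
apply: hT => A B nA nB.
have nA' : nbhs (a, b) (snd @^-1` A) by exact: (@continuous_snd S T (a, b) _ nA).
have nB' : nbhs (c, d) (snd @^-1` B) by exact: (@continuous_snd S T (c, d) _ nB).
by have [x [Ax Bx]] := cl _ _ nA' nB'; exists x.2.
Qed.

Lemma second_countable_pair (S T : topologicalType) : @second_countable S ->
  @second_countable T -> @second_countable (S * T)%type.
Proof.
move=> [B cB [oB bB]] [B' cB' [oB' bB']].
exists [set p.1 `*` p.2 | p in B `*` B'].
  by apply: sub_countable (card_image_le _ _) _; exact: countableX.
split.
  move=> _ [[U V] [/= BU BV] <-].
  have -> : U `*` V = (fst @^-1` U) `&` (snd @^-1` V) by [].
  apply: openI; apply: open_comp.
  - by move=> x _; exact: continuous_fst.
  - exact: oB.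
  - by move=> x _; exact: continuous_snd.
  - exact: oB'.
move=> [x y] A [[P Q] [/= nP nQ] PQA].
have [U [BU Ux] UP] := bB x P nP; have [V [BV Vy] VQ] := bB' y Q nQ.
exists (U `*` V); first by split => //; exists (U, V).
by move=> [u v] [/= /UP Pu /VQ Qv]; exact: PQA.
Qed.

(** The balls of radius 1 / (m + 1) around a dense sequence. *)
Lemma second_countable_dense (R : realType) (V : normedModType R[i]) (D : nat -> V) :
  (forall x (e : R), 0 < e -> exists n, nrm (x - D n) < e) -> @second_countable V.
Proof.
move=> dD; pose U (p : nat * nat) := [set y : V | nrm (y - D p.1) < p.2.+1%:R^-1].
exists (range U); first by apply: sub_countable (card_image_le _ _) _; exact: countableP.
split.
  move=> _ [[n m] _ <-]; rewrite openE => x /= xU.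
  apply/nbhs_nrm; exists (m.+1%:R^-1 - nrm (x - D n)); first by rewrite subr_gt0.
  move=> y; move: xU; rewrite /U/=; move: (_^-1) => v xU yx.
  by have := nrmD (y - x) (x - D n); rewrite addrA subrK; lra.
move=> x A /nbhs_nrm[e e0 eA].
have [m me] : exists m : nat, m.+1%:R^-1 < e / 2.
  exists (Num.truncn (2 / e)); rewrite invf_plt ?posrE ?divr_gt0// invf_div.
  exact: truncnS_gt.
have m0 : 0 < m.+1%:R^-1 :> R by rewrite invr_gt0.
have [n xn] := dD x _ m0; exists (U (n, m)); first by split => //; exists (n, m).
move=> y; rewrite /U/= => yn; apply: eA; move: (_^-1) me xn yn {m0} => v me xn yn.
have := nrmD (y - D n) (D n - x); rewrite addrA subrK (nrmC (D n)); lra.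
Qed.

Lemma second_countable_complex (R : realType) : @second_countable (R[i]^o : normedModType R[i]).
Proof.
(* the complex numbers with rational coordinates are dense *)
pose D n : R[i]^o := if unpickle n is Some (p, q) then
  Complex (ratr p : R) (ratr q : R) else 0.
apply: (@second_countable_dense R _ D) => -[a b] e e0.
have approx (u : R) : exists p : rat, `|u - ratr p| < e / 2.
  have [|p] := @rat_in_itvoo R (u - e / 2) (u + e / 2); first by lra.
  by rewrite in_itv/= => /andP[h1 h2]; exists p; rewrite ltr_norml; apply/andP; split; lra.
have [p hp] := approx a; have [q hq] := approx b.
exists (pickle (p, q)); rewrite /D pickleK.
by apply: le_lt_trans (nrm_le_ReIm _) _; rewrite /=; lra.
Qed.

Lemma hausdorff_complex (R : realType) : hausdorff_space (R[i]^o : normedModType R[i]).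
Proof. exact: norm_hausdorff. Qed.

Lemma diff_bounded_linear (R : realType) (V W : normedModType R[i]) (L : V -> W) (K : R) x :
  linear L -> (forall h, nrm (L h) <= K * nrm h) ->
  differentiable L x /\ 'd L x = L :> (V -> W).
Proof.
move=> linL bL; apply: (nrm_diff_fun linL bL) => e e0; exists 1 => // h _.
have -> : L (x + h) = L h + L x by rewrite [x + h]addrC -[h in LHS]scale1r linL scale1r.
by rewrite addrK subrr nrm0 mulr_ge0 ?nrm_ge0// ltW.
Qed.

Section Projections.
Variables (R : realType) (V W : normedModType R[i]).
Implicit Types p : ((V * W)%type : normedModType R[i]).

Lemma diff_fst p : differentiable (fst : V * W -> V) p /\
  'd (fst : V * W -> V) p = (fst : V * W -> V) :> (V * W -> V).
Proof.
apply: (@diff_bounded_linear R (V * W)%type V fst 1); first by move=> k u v.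
by move=> h; rewrite mul1r nrm_pair1.
Qed.

Lemma diff_snd p : differentiable (snd : V * W -> W) p /\
  'd (snd : V * W -> W) p = (snd : V * W -> W) :> (V * W -> W).
Proof.
apply: (@diff_bounded_linear R (V * W)%type W snd 1); first by move=> k u v.
by move=> h; rewrite mul1r nrm_pair2.
Qed.

End Projections.

End ProductSpaces.

Section Deformation.
Variable R : realType.
Local Notation C := (R[i]^o).
Local Notation M3 := ('rV[R[i]]_3 : normedModType R[i]).

Lemma near_crd0 (p : M3) : crd0 p != 0 -> \forall q \near p, crd0 q != 0.
Proof.
move=> p0; have /cvg_nrm/(_ (nrm (crd0 p : C)))[|d d0 H] :=
  differentiable_continuous (differentiable_crd0 p); first exact: nrm_gt0.
apply/nbhs_nrm; exists d => // y /H h; apply/eqP => y0; move: h.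
by rewrite y0 sub0r nrmN ltxx.
Qed.

Variable T : topologicalType.

(** The transition between the charts c and d is D; between the charts twisted by
    a and b it is G, which is holomorphic also in the parameter. *)
Record linked (D : M3 -> M3) (c d : chart T M3) (a b : twist R) (G : (M3 * C)%type -> M3) : Prop :=
  Linked {
    lk_ov : forall y, cdom c y -> (cdom d y <-> crd0 (cfun c y) != 0);
    lk_tr : forall y, cdom c y -> cdom d y -> cfun d y = D (cfun c y);
    lk_crd : forall p t, crd0 (tw a (p, t)) = crd0 p;
    lk_G : forall p t, crd0 p != 0 -> tw b (G (p, t), t) = D (tw a (p, t));
    lk_diff : forall q : ((M3 * C)%type : normedModType R[i]),
      crd0 q.1 != 0 -> differentiable G q }.

Section Linked.
Variables (D : M3 -> M3) (c d : chart T M3) (a b : twist R) (G : (M3 * C)%type -> M3).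
Hypotheses (fc : full c) (fd : full d) (lk : linked D c d a b G).

Lemma crd0_twi p t : crd0 (twi a (p, t)) = crd0 p.
Proof. by rewrite -[in RHS](twiK a p t) (lk_crd lk). Qed.

Lemma linked_slice t p : crd0 p != 0 ->
  cdom d (cinv (slice fc a t) p) /\ cfun (slice fd b t) (cinv (slice fc a t) p) = G (p, t).
Proof.
move=> p0; rewrite /=; set y := cinv c _.
have cy : cdom c y by exact: full_dom.
have yE : cfun c y = tw a (p, t) by exact: full_K.
have dy : cdom d y by apply/(lk_ov lk cy); rewrite yE (lk_crd lk).
by split => //; rewrite (lk_tr lk)// yE -(lk_G lk)// twK.
Qed.

Lemma slice_crd0 t y : cdom c y -> cdom d y -> crd0 (cfun (slice fc a t) y) != 0.
Proof. by move=> cy dy; rewrite /= crd0_twi; exact/(lk_ov lk cy). Qed.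

Lemma linked_slice_diff t y : cdom c y -> cdom d y ->
  differentiable (cfun (slice fd b t) \o cinv (slice fc a t)) (cfun (slice fc a t) y).
Proof.
move=> cy dy; have p0 := slice_crd0 t cy dy.
move: (cfun (slice fc a t) y) p0 => p p0.
have : differentiable (fun q => G (q, t)) p.
  apply: (@differentiable_comp _ _ _ _ (fun q : M3 => (q, t)) G).
    by apply: differentiable_pair => //; exact: differentiable_cst.
  exact: (lk_diff lk).
apply: differentiable_near_eq.
by apply: filterS (near_crd0 p0) => q q0; rewrite /comp (linked_slice t q0).2.
Qed.

(** The transition of the total space is (p, t) |-> (G (p, t), t). *)
Lemma linked_total_diff y : cdom c y.1 -> cdom d y.1 ->
  differentiable (cfun (tchart fd b) \o cinv (tchart fc a)) (cfun (tchart fc a) y).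
Proof.
case: y => y t /= cy dy; have p0 := slice_crd0 t cy dy.
rewrite /= in p0; move: (twi a (cfun c y, t)) p0 => p p0.
have : differentiable (fun q => (G q, q.2)) (p, t).
  apply: (@differentiable_pair _ _ _ _ G snd); first exact: (lk_diff lk).
  exact: (@diff_snd R M3 C (p, t)).1.
apply: differentiable_near_eq.
have np : \forall q \near (p, t), crd0 q.1 != 0.
  exact: (@continuous_fst M3 C (p, t) _ (near_crd0 p0)).
apply: filterS np => -[q s] /= q0; have [_ /= h] := linked_slice s q0.
by rewrite /comp/= h.
Qed.

Lemma linked_self_diff y : cdom c y.1 ->
  differentiable (cfun (tchart fc a) \o cinv (tchart fc a)) (cfun (tchart fc a) y).
Proof.
move=> cy; have : differentiable (fun q : M3 * C => q) (cfun (tchart fc a) y) by [].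
by apply: differentiable_near_eq; apply: filterE => -[q s]; rewrite /comp/= full_K// twK.
Qed.

Lemma linked_self_slice_diff t y : cdom c y ->
  differentiable (cfun (slice fc a t) \o cinv (slice fc a t)) (cfun (slice fc a t) y).
Proof.
move=> cy; have : differentiable (fun q : M3 => q) (cfun (slice fc a t) y) by [].
by apply: differentiable_near_eq; apply: filterE => q; rewrite /comp/= full_K// twK.
Qed.

End Linked.
End Deformation.

(** * The deformation family defined by a twisted gluing *)

(** A space covered by two full charts with transition D, and twists a, b of these
    charts that carry D to a map G holomorphic in all variables.  The product with the
    line is then a deformation family, trivialized by the identity; only its
    holomorphic charts differ from those of a product. *)
Section Family.
Variable R : realType.
Local Notation C := (R[i]^o).
Local Notation M3 := ('rV[R[i]]_3 : normedModType R[i]).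
Local Notation M4 := ((M3 * C)%type : normedModType R[i]).
Variables (T : topologicalType) (hs : hausdorff_space T) (sc : @second_countable T).
Variables (D : M3 -> M3) (cU cV : chart T M3) (fU : full cU) (fV : full cV).
Hypothesis cUV : forall x, cdom cU x \/ cdom cV x.
Variables (a b : twist R) (G H : (M3 * C)%type -> M3).
Hypotheses (lUV : linked D cU cV a b G) (lVU : linked D cV cU b a H).

Definition slice_atlas t : set (chart T M3) := [set slice fU a t; slice fV b t].

Lemma slice_cover t x : exists2 c, slice_atlas t c & cdom c x.
Proof.
by case: (cUV x) => cx; [exists (slice fU a t) => //; left|exists (slice fV b t) => //; right].
Qed.

Lemma slice_compat t c d : slice_atlas t c -> slice_atlas t d -> holo_compatible c d.
Proof.
by move=> [->|->] [->|->] x cx dx; split;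
  solve [exact: linked_self_slice_diff|exact: (linked_slice_diff _ _ lUV)|
         exact: (linked_slice_diff _ _ lVU)].
Qed.

Definition fiber_manifold t : threefold R :=
  ComplexManifold hs sc (slice_cover t) (@slice_compat t).

Definition total_atlas : set (chart (T * C)%type M4) := [set tchart fU a; tchart fV b].

Lemma total_cover x : exists2 c, total_atlas c & cdom c x.
Proof.
case: (cUV x.1) => cx.
  by exists (tchart fU a); [left|split].
by exists (tchart fV b); [right|split].
Qed.

Lemma total_compat c d : total_atlas c -> total_atlas d -> holo_compatible c d.
Proof.
move=> [->|->] [->|->] x cx dx; have {cx} cx1 := cx.1; have {dx} dx1 := dx.1; split;
  solve [exact: linked_self_diff|exact: (linked_total_diff _ _ lUV)|
         exact: (linked_total_diff _ _ lVU)].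
Qed.

Definition total_manifold : complex_manifold M4 :=
  ComplexManifold (hausdorff_pair hs (@hausdorff_complex R))
    (second_countable_pair sc (@second_countable_complex R)) total_cover total_compat.

Definition total_proj : total_manifold -> C := snd.

Section Fiber.
Variables (t : C) (c : chart T M3) (e : chart T M3) (fe : full e) (f : twist R).
Hypothesis ch : holo_compatible c (slice fe f t).
Let incl (x : T) : T * C := (x, t).

Lemma slice_incl_diff x : cdom c x -> cdom e x ->
  differentiable (cfun (tchart fe f) \o incl \o cinv c) (cfun c x).
Proof.
move=> cx ex; have [d1 _] := ch cx ex.
exact: (differentiable_pair d1 (differentiable_cst t _)).
Qed.

(** The projection to the first factor gives a left inverse of the inclusion. *)
Lemma slice_incl_inj x : cdom c x -> cdom e x ->
  injective ('d (cfun (tchart fe f) \o incl \o cinv c) (cfun c x)).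
Proof.
move=> cx ex; set F := _ \o _; set p := cfun c x.
have dF : differentiable F p by exact: slice_incl_diff.
pose K : M4 -> M3 := (cfun c \o cinv (slice fe f t)) \o fst.
have Fp : F p = (cfun (slice fe f t) x, t) by rewrite /F /p /comp cfunK.
have dK : differentiable K (F p).
  rewrite Fp; apply: (@differentiable_comp _ _ _ _ (fst : M3 * C -> M3)).
    exact: (@diff_fst R M3 C _).1.
  exact: (ch cx ex).2.
have ne : nbhs x (cdom e) by apply: open_nbhs_nbhs; split => //; exact: cdom_open.
have ni : nbhs p (cfun c @` cdom c).
  by apply: open_nbhs_nbhs; split; [exact: cimg_open|exists x].
have KF : \forall q \near p, K (F q) = q.
  have N := @filterI _ _ (nbhs_filter p) _ _ ni (cinv_near cx ne).
  have [r r0 Hr] := (nbhs_nrm _ _).1 N.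
  apply/nbhs_nrm; exists r => // q /Hr[qi [cq eq]].
  have -> : K (F q) = cfun c (cinv (slice fe f t) (cfun (slice fe f t) (cinv c q))) by [].
  by rewrite (@cfunK _ _ _ (slice fe f t))//; have [] := cinvP qi.
exact: can_inj (diff_left_inverse dF dK KF).
Qed.

End Fiber.

Section Identification.
Variables (At : set (chart T M3)) (cov : forall x, exists2 c, At c & cdom c x).
Variable comp : forall c d, At c -> At d -> holo_compatible c d.
Variable t : C.
Hypothesis ch : forall c, At c ->
  holo_compatible c (slice fU a t) /\ holo_compatible c (slice fV b t).

Lemma fiber_ident :
  @fiber_identification R 3 M4 C (ComplexManifold hs sc cov comp) total_manifold
    total_proj t (fun x => (x, t)).
Proof.
split.
- by move=> x y [].
- by apply/seteqP; split => [_ [x _ <-]//|[x s] /= ->]; exists x.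
- move=> O oO; exists (O `*` setT); first exact: open_setXT.
  by apply/seteqP; split => [x Ox|x []].
- split; first exact: continuous_pairC.
  move=> c d /ch[h1 h2] [->|->] x cx [dx _].
    exact: (slice_incl_diff h1 cx dx).
  exact: (slice_incl_diff h2 cx dx).
- move=> c d /ch[h1 h2] [->|->] x cx [dx _].
    exact: (slice_incl_inj h1 cx dx).
  exact: (slice_incl_inj h2 cx dx).
Qed.

End Identification.

Lemma total_submersion : holo_submersion total_proj.
Proof.
split; first by move=> x; exact: continuous_snd.
(* in the charts of the total space the projection is the second projection *)
pose L (s : C) : M4 := (0, s).
have linL : linear L by move=> k u v; rewrite /L; congr (_, _); rewrite /= scaler0 addr0.
have bL h : nrm (L h) <= 1 * nrm h.
  rewrite mul1r -lecR -!nrmE prod_normE /= normr0 (@comparable_ge_max _ _ (`|h|)).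
    by rewrite normr_ge0 lexx.
  by rewrite real_comparable// normr_real.
pose LL : {linear C -> M4} := HB.pack_for {linear C -> M4} L (GRing.isLinear.Build _ _ _ _ L linL).
have cL : continuous LL by exact: (@nrm_bounded_continuous _ _ _ LL 1 bL).
have main p : differentiable (snd : M3 * C -> C) p /\
    exists2 s : {linear C -> M4}, continuous s & cancel s ('d (snd : M3 * C -> C) p).
  have [d1 d2] := @diff_snd R M3 C p; split => //; exists LL => // s.
  exact: (congr1 (fun h : M3 * C -> C => h (LL s)) d2).
by move=> c [->|->] x _; exact: main.
Qed.

Lemma holo_compatible_ext (c e e' : chart T M3) : cdom e = cdom e' ->
  cfun e = cfun e' -> cinv e = cinv e' -> holo_compatible c e -> holo_compatible c e'.
Proof.
case: e => d1 f1 i1 p1 p2 p3 p4 p5; case: e' => d2 f2 i2 q1 q2 q3 q4 q5 /= E1 E2 E3.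
by subst d2 f2 i2.
Qed.

Lemma holo_compatibleC (c d : chart T M3) : holo_compatible c d -> holo_compatible d c.
Proof. by move=> h x dx cx; have [h1 h2] := h x cx dx; split. Qed.

Section Main.
Variables (At : set (chart T M3)) (cov : forall x, exists2 c, At c & cdom c x).
Variable comp : forall c d, At c -> At d -> holo_compatible c d.
Hypotheses (hU : forall d, At d -> holo_compatible cU d)
           (hV : forall d, At d -> holo_compatible cV d).
Hypotheses (a0 : forall p, tw a (p, 0) = p) (b0 : forall p, tw b (p, 0) = p).
Let W : threefold R := ComplexManifold hs sc cov comp.

Lemma slice0_compat (e : chart T M3) (fe : full e) (f : twist R) :
  (forall p, tw f (p, 0) = p) -> (forall d, At d -> holo_compatible e d) ->
  forall c, At c -> holo_compatible c (slice fe f 0).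
Proof.
move=> f0 he c /he/holo_compatibleC; apply: holo_compatible_ext => //.
  by apply/funext => y; rewrite /= -{2}[cfun e y]f0 twK.
by apply/funext => y; rewrite /= f0.
Qed.

(** The trivialization is the identity, so in charts it is a twist composed with a
    transition map of W: the first is smooth by assumption, the second holomorphic. *)
Lemma trivialization_smooth (e d : chart T M3) (fe : full e) (f : twist R) :
  holo_compatible e d ->
  real_smooth
    (cfun (tchart fe f) @` [set y | [/\ cdom (tchart fe f) y, True & cdom d y.1]])
    (cfun d \o fst \o cinv (tchart fe f)) /\
  real_smooth
    [set ut : M3 * C | [/\ (cfun d @` cdom d) ut.1, True &
                          cdom (tchart fe f) (cinv d ut.1, ut.2)]]
    (fun ut : M3 * C => cfun (tchart fe f) (cinv d ut.1, ut.2)).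
Proof.
move=> hed; split=> n; apply: hadamard_Ck_real.
  have oO := cimage_open e (cdom_open d).
  apply: (@hadamard_Ck_comp R n M4 M3 M3 _ (cfun e @` (cdom e `&` cdom d)) (tw f) (cfun d \o cinv e)).
  - by apply: hadamard_Ck_sub (tw_smooth f n).
  - apply: hadamard_Ck_holo3 => // _ [y [ey dy] <-].
    exact: (hed y ey dy).1.
  - move=> _ [[y s] [/= [ey _] _ dy] <-] /=.
    by rewrite twiK; exists y.
have oO := cimage_open d (cdom_open e).
have hd : hadamard_Ck n (cfun d @` (cdom d `&` cdom e)) (cfun e \o cinv d).
  apply: hadamard_Ck_holo3 => // _ [y [dy ey] <-].
  exact: (hed y ey dy).2.
have hp : hadamard_Ck n ((cfun d @` (cdom d `&` cdom e)) `*` [set: C]) (fun ut : M3 * C => (cfun e (cinv d ut.1), ut.2)).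
  apply: hadamard_Ck_pair.
    apply: (hadamard_Ck_comp (hadamard_Ck_fst n _) hd) => -[u s] [] //.
  apply: (@hadamard_Ck_Rlinear _ _ _ _ _ _ 1) => // x.
  by rewrite mul1r nrm_pair2.
have ht := hadamard_Ck_comp hp (twi_smooth f n) (fun _ _ => I).
have := hadamard_Ck_pair ht (@hadamard_Ck_Rlinear _ _ n M4 _ snd 1 ler01 (fun x y => erefl)
  (fun h x => erefl) (fun x => _)).
move=> Hf; apply: hadamard_Ck_sub (Hf _).
  by move=> [u s] [/= [y dy <-] _ [ey _]]; split => //; exists y => //; rewrite cfunK in ey.
by move=> x; rewrite mul1r nrm_pair2.
Qed.

Lemma total_locally_trivial (t : C) : exists N : set C, [/\ open N, N t, N `<=` setT &
  exists (Phi : total_manifold -> W) (Psi : W * C -> total_manifold),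
    smooth_trivialization total_proj N Phi Psi].
Proof.
exists setT; split => //; first exact: openT.
exists (fst : T * C -> T), (fun y : T * C => y); split => //.
- by case.
- by move=> y _; exact: continuous_fst.
- by move=> x s _ A.
- move=> c d [->|->] Ad.
    exact: (trivialization_smooth fU a (hU Ad)).
  exact: (trivialization_smooth fV b (hV Ad)).
Qed.

Definition the_family : deformation_family W.
Proof.
apply: (@DeformationFamily R 3 W C setT M4 total_manifold total_proj).
- by left.
- apply/seteqP; split => // t _.
  pose p : M3 := 0; exists (cinv cU p, t) => //.
- exact: total_submersion.
- exists (fun x => (x, 0)); apply: fiber_ident => c Ac; split.
    exact: (@slice0_compat cU fU a a0 hU c Ac).
  exact: (@slice0_compat cV fV b b0 hV c Ac).
- by move=> t _; exact: total_locally_trivial.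
Defined.

Theorem fiber_deformation t : deformation W (fiber_manifold t).
Proof.
exists the_family, t, (fun x => (x, t)); split => //.
apply: fiber_ident => c Ac; split.
  exact: (@slice_compat t c _ Ac (or_introl erefl)).
exact: (@slice_compat t c _ Ac (or_intror erefl)).
Qed.

End Main.

Lemma fiber_glued t (g : M3 -> M3) : (forall p, crd0 p != 0 -> g p = G (p, t)) ->
  @glued R (fiber_manifold t) (slice fU a t) (slice fV b t) g.
Proof.
move=> gG; split.
- split=> d Ad; first exact: (@slice_compat t _ d (or_introl erefl) Ad).
  exact: (@slice_compat t _ d (or_intror erefl) Ad).
- by split; [exact: (slice_img fU a t)|exact: (slice_img fV b t)].
- by apply/seteqP; split => // x _; exact: cUV.
- split; apply/seteqP; split=> [_ [y [Uy Vy] <-]|p p0].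
  + exact: (slice_crd0 fU lUV t Uy Vy).
  + have [Vy _] := linked_slice fU fV lUV t p0.
    exists (cinv (slice fU a t) p); first by split; [exact: (@full_dom R T cU _ fU)|exact: Vy].
    by rewrite /= full_K// twK.
  + exact: (slice_crd0 fV lVU t Vy Uy).
  + have [Uy _] := linked_slice fV fU lVU t p0.
    exists (cinv (slice fV b t) p); first by split; [exact: Uy|exact: (@full_dom R T cV _ fV)].
    by rewrite /= full_K// twK.
- move=> y Uy Vy; have p0 := slice_crd0 fU lUV t Uy Vy; rewrite gG//.
  by rewrite -(linked_slice fU fV lUV t p0).2 (@cfunK _ _ _ (slice fU a t)).
Qed.

End Family.

(** * The deformed gluing maps and their twists *)

Section ConcreteTwists.
Variable R : realType.
Local Notation C := (R[i]^o).
Local Notation M3 := ('rV[R[i]]_3 : normedModType R[i]).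
Local Notation M4 := ((M3 * C)%type : normedModType R[i]).
Local Notation M5 := ((M3 * C * C)%type : normedModType R[i]).

Section DiffRules.
Variables (V : normedModType R[i]) (x : V).
Implicit Types f g : V -> C.

Lemma dfD f g : differentiable f x -> differentiable g x ->
  differentiable (fun y => f y + g y : C) x.
Proof. exact: differentiableD. Qed.

Lemma dfB f g : differentiable f x -> differentiable g x ->
  differentiable (fun y => f y - g y : C) x.
Proof. exact: differentiableB. Qed.

Lemma dfM f g : differentiable f x -> differentiable g x ->
  differentiable (fun y => f y * g y : C) x.
Proof. exact: differentiableM. Qed.

Lemma dfX f n : differentiable f x -> differentiable (fun y => f y ^+ n : C) x.
Proof.
move=> df; elim: n => [|n IH]; first exact: differentiable_cst.
have -> : (fun y => f y ^+ n.+1 : C) = (fun y => f y * f y ^+ n).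
  by apply/funext => y; rewrite exprS.
exact: dfM.
Qed.

Lemma dfV f : differentiable f x -> f x != 0 -> differentiable (fun y => (f y)^-1 : C) x.
Proof. exact: differentiableV. Qed.

Lemma df_cst (c : C) : differentiable (fun _ : V => c) x.
Proof. exact: differentiable_cst. Qed.

Lemma df_comp (q : C -> C) f : (forall z, differentiable q z) -> differentiable f x ->
  differentiable (fun y => q (f y)) x.
Proof. by move=> dq df; exact: (differentiable_comp df (dq _)). Qed.

End DiffRules.

Lemma df_id (z : C) : differentiable (fun z : C => z) z.
Proof. by []. Qed.

Lemma open_neq0 (V : normedModType R[i]) (f : V -> C) :
  (forall x, differentiable f x) -> open [set x | f x != 0].
Proof.
move=> df; rewrite openE => x /= fx0.
have /cvg_nrm/(_ (nrm (f x)))[|d d0 H] := differentiable_continuous (df x).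
  exact: nrm_gt0.
apply/nbhs_nrm; exists d => // y /H h; apply/eqP => y0; move: h.
by rewrite y0 sub0r nrmN ltxx.
Qed.

Lemma df_fst3 (f : M3 -> C) (x : M4) : (forall p, differentiable f p) ->
  differentiable (fun y : M3 * C => f y.1) x.
Proof.
by move=> df; exact: (@differentiable_comp _ M4 M3 C fst f x (@diff_fst R M3 C x).1 (df _)).
Qed.

Lemma df_fst5 (f : M4 -> C) (x : M5) : (forall p, differentiable f p) ->
  differentiable (fun y : M3 * C * C => f y.1) x.
Proof.
by move=> df; exact: (@differentiable_comp _ M5 M4 C fst f x (@diff_fst R M4 C x).1 (df _)).
Qed.

Lemma df_z4 (x : M4) : differentiable (fun y : M3 * C => crd0 y.1 : C) x.
Proof. exact: (@df_fst3 (@crd0 R) x (@differentiable_crd0 R)). Qed.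
Lemma df_u4 (x : M4) : differentiable (fun y : M3 * C => crd1 y.1 : C) x.
Proof. exact: (@df_fst3 (@crd1 R) x (@differentiable_crd1 R)). Qed.
Lemma df_v4 (x : M4) : differentiable (fun y : M3 * C => crd2 y.1 : C) x.
Proof. exact: (@df_fst3 (@crd2 R) x (@differentiable_crd2 R)). Qed.
Lemma df_t4 (x : M4) : differentiable (fun y : M3 * C => y.2) x.
Proof. exact: (@diff_snd R M3 C x).1. Qed.
Lemma df_z5 (x : M5) : differentiable (fun y : M3 * C * C => crd0 y.1.1 : C) x.
Proof. exact: (@df_fst5 (fun y : M3 * C => crd0 y.1 : C) x df_z4). Qed.
Lemma df_u5 (x : M5) : differentiable (fun y : M3 * C * C => crd1 y.1.1 : C) x.
Proof. exact: (@df_fst5 (fun y : M3 * C => crd1 y.1 : C) x df_u4). Qed.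
Lemma df_v5 (x : M5) : differentiable (fun y : M3 * C * C => crd2 y.1.1 : C) x.
Proof. exact: (@df_fst5 (fun y : M3 * C => crd2 y.1 : C) x df_v4). Qed.
Lemma df_t5 (x : M5) : differentiable (fun y : M3 * C * C => y.1.2) x.
Proof. exact: (@df_fst5 snd x df_t4). Qed.
Lemma df_w5 (x : M5) : differentiable (fun y : M3 * C * C => y.2) x.
Proof. exact: (@diff_snd R M4 C x).1. Qed.

(** A function that depends on z and its conjugate is written as a holomorphic function
    of one more variable, composed with this map; holomorphy and smoothness are then
    established separately ([twist_smooth]). *)
Definition with_conj (p : M3 * C) : M3 * C * C := (p, (crd0 p.1)^*%C).

Lemma hadamard_Ck_with_conj n : @hadamard_Ck R M5 n M4 setT with_conj.
Proof.
apply: hadamard_Ck_pair.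
  apply: (@hadamard_Ck_Rlinear _ _ _ _ _ _ 1) => // x.
  by rewrite mul1r.
have h1 : @hadamard_Ck R C n M4 setT (fun y : M3 * C => crd0 y.1 : C).
  by apply: hadamard_Ck_holo => [|x _]; [exact: openT|exact: df_z4].
apply: (hadamard_Ck_comp h1 (B := setT) (f := fun z : C => z^*%C : C)) => //.
apply: (@hadamard_Ck_Rlinear _ _ _ _ _ _ 1) => //.
- by move=> x y; exact: rmorphD.
- by move=> h [u v]; apply/eqP; rewrite eq_complex /= !mul0r !subr0 !addr0 mulrN !eqxx.
- by move=> x; rewrite mul1r /nrm normcJ.
Qed.

Lemma twist_smooth (F : M5 -> M3) (f : M5 -> C) : (forall x, differentiable f x) ->
  (forall x, f x != 0 -> differentiable F x) -> (forall p, f (with_conj p) != 0) ->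
  forall n, @hadamard_Ck R M3 n M4 setT (F \o with_conj).
Proof.
move=> df dF f0 n; apply: (hadamard_Ck_comp (hadamard_Ck_with_conj n)
  (hadamard_Ck_holo3 n (open_neq0 df) dF)) => x _.
exact: f0.
Qed.

End ConcreteTwists.

Ltac diff_rules :=
  repeat first
    [ exact: df_cst | exact: df_z5 | exact: df_u5 | exact: df_v5 | exact: df_t5
    | exact: df_w5 | exact: df_z4 | exact: df_u4 | exact: df_v4 | exact: df_t4
    | apply: dfX | apply: dfB | apply: dfD | apply: dfM | (apply: df_comp; first by []) ].
Arguments with_conj {R}.

(** The deformed gluing is v2 = z^(-k) u2 + t z^(-k-1) q(u1), v1 = z^(k+2) (u1 + t v2).  As a
    cocycle each of the two terms with t is split by a partition of unity with weights
    |z|^(2k+4) / (1 + |z|^(2k+4)), used on U, and 1 / (1 + |z|^(2k+4)), used on V; the two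
    sides of the splitting are the twists of U and V.  The term of order t^2 in the
    twist of V accounts for the interaction of the two. *)
Section Transition.
Variable R : realType.
Local Notation C := (R[i]^o).
Local Notation M3 := ('rV[R[i]]_3 : normedModType R[i]).
Local Notation M4 := ((M3 * C)%type : normedModType R[i]).
Local Notation M5 := ((M3 * C * C)%type : normedModType R[i]).
Variables (k : nat) (q : C -> C).
Hypothesis dq : forall z, differentiable q z.
Let n := k.+2.

Definition den (x : M3 * C * C) : C := 1 + crd0 x.1.1 ^+ n * x.2 ^+ n.

Lemma df_den (x : M5) : differentiable den x.
Proof. by rewrite /den; diff_rules. Qed.

Lemma den_conj p : den (with_conj p) != 0.
Proof.
rewrite /den /with_conj/=; set z := crd0 p.1.
have h : 0 <= z ^+ n * (z^*)%C ^+ n.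
  by rewrite -exprMn exprn_ge0// mulcJ_ge0.
have h1 : 0 < 1 + z ^+ n * (z^*)%C ^+ n by rewrite ltr_pwDl// ltr01.
by rewrite gt_eqF.
Qed.

(** The coefficients of the twists.  The last component of x stands for the conjugate
    of the first coordinate, so that [den] is 1 + |z|^(2k+4). *)
Definition cA1 (x : M3 * C * C) : C := crd0 x.1.1 ^+ k.+1 * x.2 ^+ n / den x.
Definition cA2 (x : M3 * C * C) : C := crd0 x.1.1 ^+ 2 * x.2 ^+ n / den x.
Definition cB0 (x : M3 * C * C) : C := x.2 ^+ n / den x.
Definition cB1 (x : M3 * C * C) : C :=
  crd0 x.1.1 ^+ n * crd0 x.1.1 ^+ k.+1 * x.2 ^+ n / den x.
Definition cB2 (x : M3 * C * C) : C := crd0 x.1.1 ^+ k.+1 * x.2 ^+ n / den x / den x.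
Definition cBs (x : M3 * C * C) : C := 1 / den x.

Lemma df_div (f : M5 -> C) x : differentiable f x -> den x != 0 ->
  differentiable (fun y => f y / den y : C) x.
Proof. by move=> df d0; exact: (dfM df (dfV (df_den x) d0)). Qed.

Lemma df_cA1 x : den x != 0 -> differentiable cA1 (x : M5).
Proof. by move=> d0; apply: (df_div _ d0); diff_rules. Qed.
Lemma df_cA2 x : den x != 0 -> differentiable cA2 (x : M5).
Proof. by move=> d0; apply: (df_div _ d0); diff_rules. Qed.
Lemma df_cB0 x : den x != 0 -> differentiable cB0 (x : M5).
Proof. by move=> d0; apply: (df_div _ d0); diff_rules. Qed.
Lemma df_cB1 x : den x != 0 -> differentiable cB1 (x : M5).
Proof. by move=> d0; apply: (df_div _ d0); diff_rules. Qed.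
Lemma df_cB2 x : den x != 0 -> differentiable cB2 (x : M5).
Proof. by move=> d0; apply: (df_div _ d0); apply: (df_div _ d0); diff_rules. Qed.
Lemma df_cBs x : den x != 0 -> differentiable cBs (x : M5).
Proof. by move=> d0; apply: (df_div _ d0); diff_rules. Qed.

Ltac diff_rules2 :=
  repeat first
    [ exact: df_cst | exact: df_z5 | exact: df_u5 | exact: df_v5 | exact: df_t5
    | exact: df_w5 | exact: df_cA1 | exact: df_cA2 | exact: df_cB0 | exact: df_cB1
    | exact: df_cB2 | exact: df_cBs
    | apply: dfX | apply: dfB | apply: dfD | apply: dfM | (apply: (df_comp dq)) ].

(** Shears of U and V, [shear_U] and [shear_V], and their inverses. *)
Definition shear_U (x : M3 * C * C) : M3 :=
  let v := crd2 x.1.1 + x.1.2 * cA1 x * q (crd1 x.1.1) in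
  C3 (crd0 x.1.1) (crd1 x.1.1 + x.1.2 * cA2 x * v) v.

Definition shear_U_inv (x : M3 * C * C) : M3 :=
  let u := crd1 x.1.1 - x.1.2 * cA2 x * crd2 x.1.1 in
  C3 (crd0 x.1.1) u (crd2 x.1.1 - x.1.2 * cA1 x * q u).

Definition shear_V (x : M3 * C * C) : M3 :=
  let Q := q (crd0 x.1.1 ^+ n * crd1 x.1.1 - x.1.2 * crd2 x.1.1) in
  C3 (crd0 x.1.1)
     (crd1 x.1.1 - x.1.2 * cB0 x * crd2 x.1.1 - x.1.2 ^+ 2 * cB2 x * Q)
     (crd2 x.1.1 - x.1.2 * cB1 x * Q).

Definition shear_V_inv (x : M3 * C * C) : M3 :=
  let Q := q (crd0 x.1.1 ^+ n * crd1 x.1.1 - x.1.2 * cBs x * crd2 x.1.1) in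
  let v := crd2 x.1.1 + x.1.2 * cB1 x * Q in
  C3 (crd0 x.1.1) (crd1 x.1.1 + x.1.2 * cB0 x * v + x.1.2 ^+ 2 * cB2 x * Q) v.

Lemma df_shear_U x : den x != 0 -> differentiable shear_U (x : M5).
Proof. by move=> d0; apply: differentiable_C3; diff_rules2. Qed.
Lemma df_shear_U_inv x : den x != 0 -> differentiable shear_U_inv (x : M5).
Proof. by move=> d0; apply: differentiable_C3; diff_rules2. Qed.
Lemma df_shear_V x : den x != 0 -> differentiable shear_V (x : M5).
Proof. by move=> d0; apply: differentiable_C3; diff_rules2. Qed.
Lemma df_shear_V_inv x : den x != 0 -> differentiable shear_V_inv (x : M5).
Proof. by move=> d0; apply: differentiable_C3; diff_rules2. Qed.

Lemma twAK p t : (shear_U_inv \o with_conj) ((shear_U \o with_conj) (p, t), t) = p.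
Proof.
rewrite /shear_U_inv /shear_U /comp /cA1 /cA2 /den /= !crdE -[RHS]C3_crd.
by rewrite addrK; congr C3; rewrite addrK.
Qed.
Lemma twAiK p t : (shear_U \o with_conj) ((shear_U_inv \o with_conj) (p, t), t) = p.
Proof.
rewrite /shear_U_inv /shear_U /comp /cA1 /cA2 /den /= !crdE -[RHS]C3_crd.
by rewrite subrK; congr C3; rewrite subrK.
Qed.

Definition twistA : twist R :=
  Twist twAK twAiK (twist_smooth df_den df_shear_U den_conj) (twist_smooth df_den df_shear_U_inv den_conj).

Lemma twBK p t : (shear_V_inv \o with_conj) ((shear_V \o with_conj) (p, t), t) = p.
Proof.
have := den_conj (p, t).
rewrite /shear_V_inv /shear_V /comp /cB0 /cB1 /cB2 /cBs /den /= !crdE -[RHS]C3_crd /=.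
move: (crd0 p) (crd1 p) (crd2 p) => z u v.
set w := (z^*)%C ^+ n; set Z := z ^+ n; set P := z ^+ k.+1; set d := 1 + Z * w => d0.
set Q := q (Z * u - t * v).
have -> : Z * (u - t * (w / d) * v - t ^+ 2 * (P * w / d / d) * Q)
   - t * (1 / d) * (v - t * (Z * P * w / d) * Q) = Z * u - t * v.
  by rewrite /d in d0 *; field.
rewrite -/Q; have -> : v - t * (Z * P * w / d) * Q + t * (Z * P * w / d) * Q = v by ring.
by congr C3; ring.
Qed.

Lemma twBiK p t : (shear_V \o with_conj) ((shear_V_inv \o with_conj) (p, t), t) = p.
Proof.
have := den_conj (p, t).
rewrite /shear_V_inv /shear_V /comp /cB0 /cB1 /cB2 /cBs /den /= !crdE -[RHS]C3_crd /=.
move: (crd0 p) (crd1 p) (crd2 p) => z u v.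
set w := (z^*)%C ^+ n; set Z := z ^+ n; set P := z ^+ k.+1; set d := 1 + Z * w => d0.
set Q := q (Z * u - t * (1 / d) * v).
have -> : Z * (u + t * (w / d) * (v + t * (Z * P * w / d) * Q) + t ^+ 2 * (P * w / d / d) * Q)
   - t * (v + t * (Z * P * w / d) * Q) = Z * u - t * (1 / d) * v.
  by rewrite /d in d0 *; field.
by rewrite -/Q; congr C3; ring.
Qed.

Definition twistB : twist R :=
  Twist twBK twBiK (twist_smooth df_den df_shear_V den_conj) (twist_smooth df_den df_shear_V_inv den_conj).

Definition gluing (x : M3 * C) : M3 :=
  let z := crd0 x.1 in
  let v := z ^+ 2 / z ^+ n * crd2 x.1 + x.2 * (z / z ^+ n) * q (crd1 x.1) in
  C3 z^-1 (z ^+ n * crd1 x.1 + x.2 * z ^+ n * v) v.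

(** The deformed gluing read from V to U. *)
Definition gluing_inv (x : M3 * C) : M3 :=
  let z := crd0 x.1 in
  let u := z ^+ n * crd1 x.1 - x.2 * crd2 x.1 in
  C3 z^-1 u (z ^+ 2 / z ^+ n * crd2 x.1 - x.2 * z * q u).

Lemma df_zinv (x : M4) : crd0 x.1 != 0 -> differentiable (fun x : M3 * C => (crd0 x.1)^-1 : C) x.
Proof. by move=> x0; exact: (dfV (df_z4 x) x0). Qed.

Lemma df_zninv (x : M4) : crd0 x.1 != 0 -> differentiable (fun x : M3 * C => (crd0 x.1 ^+ n)^-1 : C) x.
Proof. by move=> x0; apply: dfV; [diff_rules|rewrite expf_neq0]. Qed.

Ltac diff_rules4 :=
  repeat first
    [ exact: df_cst | exact: df_z4 | exact: df_u4 | exact: df_v4 | exact: df_t4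
    | exact: df_zinv | exact: df_zninv
    | apply: dfX | apply: dfB | apply: dfD | apply: dfM | (apply: (df_comp dq)) ].

Lemma df_gluing (x : M4) : crd0 x.1 != 0 -> differentiable gluing x.
Proof. by move=> x0; apply: differentiable_C3; diff_rules4. Qed.

Lemma df_gluing_inv (x : M4) : crd0 x.1 != 0 -> differentiable gluing_inv x.
Proof. by move=> x0; apply: differentiable_C3; diff_rules4. Qed.

Lemma W_transitionE (p : M3) : crd0 p != 0 -> W_transition n p =
  C3 (crd0 p)^-1 (crd0 p ^+ n * crd1 p) (crd0 p ^+ 2 / crd0 p ^+ n * crd2 p).
Proof. by move=> p0; rewrite /W_transition expfzDr// -exprnP -exprnN. Qed.

Lemma W_transitionK (p : M3) : crd0 p != 0 -> W_transition n (W_transition n p) = p.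
Proof.
move=> p0; rewrite [W_transition n p]W_transitionE// W_transitionE ?crdE ?invr_eq0//.
rewrite -[RHS]C3_crd invrK !exprVn; have pn : crd0 p ^+ n != 0 by rewrite expf_neq0.
by congr C3; field; rewrite ?pn ?p0.
Qed.

Lemma gluing_twist (p : M3) (t : C) : crd0 p != 0 ->
  tw twistB (gluing (p, t), t) = W_transition n (tw twistA (p, t)).
Proof.
move=> p0; have := den_conj (p, t); rewrite W_transitionE; last by rewrite /= /shear_U crdE.
rewrite /= /shear_V /shear_U /gluing /comp /cA1 /cA2 /cB0 /cB1 /cB2 /den /= !crdE.
move: (crd0 p) p0 (crd1 p) (crd2 p) => z z0 u v.
rewrite conjc_inv !exprVn.
have w0 : (z^*)%C != 0 by rewrite conjc_eq0.
have w0n : (z^*)%C ^+ n != 0 by rewrite expf_neq0.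
have -> : z ^+ n = z * z ^+ k.+1 by exact: exprS.
have P0 : z ^+ k.+1 != 0 by rewrite expf_neq0.
move: ((z^*)%C ^+ n) w0n (z ^+ k.+1) P0 => w w0n P P0 d0.
have d0' : 1 + (z * P)^-1 * w^-1 != 0.
  have -> : 1 + (z * P)^-1 * w^-1 = (1 + z * P * w) / (z * P * w).
    by field; rewrite z0 P0 w0n.
  by rewrite mulf_neq0// invr_eq0 !mulf_neq0.
set v2 := z ^+ 2 / (z * P) * v + t * (z / (z * P)) * q u.
(* the argument of q in the twist of V is the coordinate u1 *)
have -> : (z * P)^-1 * (z * P * u + t * (z * P) * v2) - t * v2 = u.
  by field; rewrite z0 P0.
move: (q u) @v2 => Q v2; rewrite /v2 {v2}; congr C3.
  field; rewrite ?z0 ?P0 ?w0n ?d0 ?d0'//.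
field; rewrite ?z0 ?P0 ?w0n ?d0 ?d0'//.
Qed.

Lemma gluing_inv_twist (p : M3) (t : C) : crd0 p != 0 ->
  tw twistA (gluing_inv (p, t), t) = W_transition n (tw twistB (p, t)).
Proof.
move=> p0; have := den_conj (p, t); rewrite W_transitionE; last by rewrite /= /shear_V crdE.
rewrite /= /shear_V /shear_U /gluing_inv /comp /cA1 /cA2 /cB0 /cB1 /cB2 /den /= !crdE.
move: (crd0 p) p0 (crd1 p) (crd2 p) => z z0 u v.
rewrite conjc_inv !exprVn.
have w0 : (z^*)%C != 0 by rewrite conjc_eq0.
have w0n : (z^*)%C ^+ n != 0 by rewrite expf_neq0.
have -> : z ^+ n = z * z ^+ k.+1 by exact: exprS.
have P0 : z ^+ k.+1 != 0 by rewrite expf_neq0.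
move: ((z^*)%C ^+ n) w0n (z ^+ k.+1) P0 => w w0n P P0 d0.
have d0' : 1 + (z * P)^-1 * w^-1 != 0.
  have -> : 1 + (z * P)^-1 * w^-1 = (1 + z * P * w) / (z * P * w).
    by field; rewrite z0 P0 w0n.
  by rewrite mulf_neq0// invr_eq0 !mulf_neq0.
move: (q _) => Q; congr C3.
  field; rewrite ?z0 ?P0 ?w0n ?d0 ?d0'//.
field; rewrite ?z0 ?P0 ?w0n ?d0 ?d0'//.
Qed.

Lemma twistA0 p : tw twistA (p, 0) = p.
Proof. by rewrite /= /shear_U /= !mul0r !addr0 C3_crd. Qed.

Lemma twistB0 p : tw twistB (p, 0) = p.
Proof. by rewrite /= /shear_V /= !expr0n/= !mul0r !subr0 C3_crd. Qed.

Lemma crd0_twistA p t : crd0 (tw twistA (p, t)) = crd0 p.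
Proof. by rewrite /= /shear_U crdE. Qed.

Lemma crd0_twistB p t : crd0 (tw twistB (p, t)) = crd0 p.
Proof. by rewrite /= /shear_V crdE. Qed.

Section Linking.
Variables (T : topologicalType) (cU cV : chart T M3).
Hypothesis ovU : cfun cU @` (cdom cU `&` cdom cV) = [set x | crd0 x != 0].
Hypothesis ovV : cfun cV @` (cdom cU `&` cdom cV) = [set x | crd0 x != 0].
Hypothesis tr : forall y, cdom cU y -> cdom cV y -> cfun cV y = W_transition n (cfun cU y).

Lemma overlapP (c d : chart T M3) : cfun c @` (cdom c `&` cdom d) = [set x | crd0 x != 0] ->
  forall y, cdom c y -> (cdom d y <-> crd0 (cfun c y) != 0).
Proof.
move=> ov y cy; split=> [dy|y0].
  by have : [set x : M3 | crd0 x != 0] (cfun c y) by rewrite -ov; exists y.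
have : [set x : M3 | crd0 x != 0] (cfun c y) by [].
rewrite -ov => -[y' [cy' dy'] E].
by rewrite -(cfunK cy) -E cfunK.
Qed.

Lemma linkedUV : linked (@W_transition R n) cU cV twistA twistB gluing.
Proof.
split; [exact: overlapP|exact: tr|exact: crd0_twistA| |exact: df_gluing].
by move=> p t p0; exact: gluing_twist.
Qed.

Lemma linkedVU : linked (@W_transition R n) cV cU twistB twistA gluing_inv.
Proof.
split; [apply: overlapP; by rewrite setIC| |exact: crd0_twistB| |exact: df_gluing_inv].
  move=> y Vy Uy; rewrite tr// W_transitionK//.
  exact/(overlapP ovU Uy).
by move=> p t p0; exact: gluing_inv_twist.
Qed.

End Linking.
End Transition.

Section Roots.
Variable R : realType.
Local Notation C := (R[i]^o).

Definition root_poly (n : nat) (w : C) : C := \prod_(i < n) (w - i%:R).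

Lemma df_root_poly n w : differentiable (root_poly n) w.
Proof.
elim: n => [|n IH].
  have -> : root_poly 0 = (fun=> 1) by apply/funext => z; rewrite /root_poly big_ord0.
  exact: differentiable_cst.
have -> : root_poly n.+1 = (fun z => root_poly n z * (z - n%:R)).
  by apply/funext => z; rewrite /root_poly big_ord_recr.
exact: (dfM IH (dfB (df_id w) (df_cst w n%:R))).
Qed.

Lemma root_poly_eq0 n w : root_poly n w = 0 -> exists2 i, (i < n)%N & w = i%:R.
Proof.
move/eqP; rewrite /root_poly prodf_seq_eq0 => /hasP[i _ /=].
by rewrite subr_eq0 => /eqP ->; exists i.
Qed.

Lemma root_poly_root n i : (i < n)%N -> root_poly n i%:R = 0.
Proof.
by move=> ni; rewrite /root_poly (bigD1 (Ordinal ni))//= subrr mul0r.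
Qed.

End Roots.

(** * Threefolds glued from two copies of C^3 *)

Section GluedSpace.
Variable R : realType.
Local Notation C := (R[i]^o).
Local Notation M3 := ('rV[R[i]]_3 : normedModType R[i]).

Lemma second_countable_C3 : @second_countable M3.
Proof.
have scC := @second_countable_complex R.
have [B cB [oB bB]] := second_countable_pair (second_countable_pair scC scC) scC.
pose h (x : M3) : C * C * C := (crd0 x, crd1 x, crd2 x).
pose h' (y : C * C * C) : M3 := C3 y.1.1 y.1.2 y.2.
have hK x : h' (h x) = x by exact: C3_crd.
have ch : continuous h.
  move=> x; apply: (@continuous_pair _ _ _ (fun x : M3 => (crd0 x : C, crd1 x : C)) (@crd2 R : M3 -> C)).
    apply: (@continuous_pair _ _ _ (@crd0 R : M3 -> C) (@crd1 R : M3 -> C)).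
      exact: (differentiable_continuous (differentiable_crd0 x)).
    exact: (differentiable_continuous (differentiable_crd1 x)).
  exact: (differentiable_continuous (differentiable_crd2 x)).
have ch' : continuous h'.
  pose V := ((C * C)%type : normedModType R[i]); pose V3 := ((V * C)%type : normedModType R[i]).
  move=> y; apply: (differentiable_continuous (f := (h' : V3 -> M3))).
  have d1 := (@diff_fst R V C y).1; have d2 := (@diff_snd R V C y).1.
  apply: (@differentiable_C3 R V3 (fun y : V3 => y.1.1) (fun y : V3 => y.1.2) (fun y => y.2)) d2.
    exact: (differentiable_comp d1 (@diff_fst R C C y.1).1).
  exact: (differentiable_comp d1 (@diff_snd R C C y.1).1).
exists [set h @^-1` b | b in B].
  by apply: sub_countable (card_image_le _ _) _.
split=> [_ [b Bb <-]|x A nA].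
  by apply: open_comp; [move=> x _; exact: ch|exact: oB].
have nA' : nbhs (h x) (h' @^-1` A) by apply: ch'; rewrite hK.
have [b [Bb bx] bA] := bB (h x) _ nA'.
exists (h @^-1` b); first by split => //; exists b.
by move=> y /bA; rewrite /= hK.
Qed.

(** The left summand is U, the right one the plane xi = 0 of V.  The parameter D serves
    to attach to this type the topology of the space glued along D. *)
Definition glued_space (D : M3 -> M3) : Type := (M3 + C * C)%type.

Section Topology.
Variable D : M3 -> M3.
Local Notation T := (glued_space D).

Definition from_U (p : M3) : T := inl p.
Definition from_V (p : M3) : T :=
  if crd0 p == 0 then inr (crd1 p : C, crd2 p : C) else inl (D p).

(** The finest topology for which both parametrizations are continuous. *)
Definition glued_open : set_system T :=
  [set A | open (from_U @^-1` A) /\ open (from_V @^-1` A)].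

Lemma glued_openT : glued_open setT.
Proof. by split; exact: openT. Qed.

Lemma glued_openI : setI_closed glued_open.
Proof. by move=> A B [A1 A2] [B1 B2]; split; rewrite preimage_setI; exact: openI. Qed.

Lemma glued_open_bigU (I : Type) (f : I -> set T) : (forall i, glued_open (f i)) ->
  glued_open (\bigcup_i f i).
Proof.
by move=> fo; split; rewrite preimage_bigcup; apply: bigcup_open => i _; have [] := fo i.
Qed.

HB.instance Definition _ := Choice.copy (glued_space D) (M3 + C * C)%type.
HB.instance Definition _ := isOpenTopological.Build (glued_space D)
  glued_openT glued_openI glued_open_bigU.

Lemma from_U_continuous : continuous from_U.
Proof. by apply/continuousP => A [oA _]. Qed.

Lemma from_V_continuous : continuous from_V.
Proof. by apply/continuousP => A [_ oA]. Qed.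

Definition to_U (x : T) : M3 := if x is inl p then p else 0.
Definition to_V (x : T) : M3 :=
  match x with inl p => D p | inr (a, b) => C3 0 a b end.
Definition dom_U : set T := [set x | if x is inl _ then True else False].
Definition dom_V : set T := [set x | if x is inl p then crd0 p != 0 else True].

Hypothesis D_crd0 : forall p : M3, crd0 p != 0 -> crd0 (D p) = (crd0 p)^-1.
Hypothesis DK : forall p : M3, crd0 p != 0 -> D (D p) = p.
Hypothesis dD : forall p : M3, crd0 p != 0 -> differentiable D p.

Lemma D_crd0_neq0 p : crd0 p != 0 -> crd0 (D p) != 0.
Proof. by move=> p0; rewrite D_crd0 ?invr_eq0. Qed.

Lemma to_UK x : dom_U x -> from_U (to_U x) = x.
Proof. by case: x. Qed.

Lemma to_VK x : dom_V x -> from_V (to_V x) = x.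
Proof.
case: x => [p|[a b] _] /=; rewrite /from_V.
  by move=> p0; rewrite (negbTE (D_crd0_neq0 p0)) DK.
by rewrite crd0_C3 eqxx crd1_C3 crd2_C3.
Qed.

Lemma dom_from_V p : dom_V (from_V p).
Proof. by rewrite /from_V; case: eqP => // /eqP p0 /=; exact: D_crd0_neq0. Qed.

Lemma from_VK p : to_V (from_V p) = p.
Proof.
rewrite /from_V; case: eqP => [p0|/eqP p0] /=; last exact: DK.
by rewrite -[RHS]C3_crd p0.
Qed.

Lemma open_D O : open O -> open [set p : M3 | crd0 p != 0 /\ O (D p)].
Proof.
move=> oO; rewrite openE => p [/= p0 Op].
have nO : nbhs (D p) O by exact: open_nbhs_nbhs.
exact: (@filterI _ _ (nbhs_filter p) _ _ (near_crd0 p0) (differentiable_continuous (dD p0) nO)).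
Qed.

Lemma open_to_U O : open O -> open (dom_U `&` to_U @^-1` O).
Proof.
move=> oO; split.
  have -> : from_U @^-1` (dom_U `&` to_U @^-1` O) = O; last exact: oO.
  by apply/seteqP; split=> [p []|p].
have -> : from_V @^-1` (dom_U `&` to_U @^-1` O) = [set p | crd0 p != 0 /\ O (D p)].
  apply/seteqP; split=> p; rewrite /from_V /=.
    by case: eqP => [_ []|/eqP p0 []].
  by move=> [p0 Op]; rewrite (negbTE p0).
exact: open_D.
Qed.

Lemma open_to_V O : open O -> open (dom_V `&` to_V @^-1` O).
Proof.
move=> oO; split.
  have -> : from_U @^-1` (dom_V `&` to_V @^-1` O) = [set p | crd0 p != 0 /\ O (D p)].
    by apply/seteqP; split.
  exact: open_D.
have -> : from_V @^-1` (dom_V `&` to_V @^-1` O) = O; last exact: oO.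
apply/seteqP; split=> p; rewrite /preimage /=; first by rewrite from_VK => -[].
by move=> Op; split; [exact: dom_from_V|rewrite from_VK].
Qed.

Lemma dom_U_open : open dom_U.
Proof. by have := open_to_U openT; rewrite preimage_setT setIT. Qed.

Lemma dom_V_open : open dom_V.
Proof. by have := open_to_V openT; rewrite preimage_setT setIT. Qed.

Lemma within_continuous (d : set T) (f : T -> M3) : open d ->
  (forall O, open O -> open (d `&` f @^-1` O)) -> {within d, continuous f}.
Proof.
move=> od H; rewrite continuous_open_subspace// => x; rewrite inE => dx A /= nA.
have : nbhs (f x) A by []; rewrite nbhsE => -[V [oV Vx] VA].
have nx : nbhs x (d `&` f @^-1` V) by apply: open_nbhs_nbhs; split; [exact: H|split].
by apply: filterS nx => y [_ /VA].
Qed.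

Lemma img_U : to_U @` dom_U = [set: M3].
Proof. by apply/seteqP; split => // p _; exists (from_U p). Qed.

Lemma img_V : to_V @` dom_V = [set: M3].
Proof.
by apply/seteqP; split => // p _; exists (from_V p); [exact: dom_from_V|exact: from_VK].
Qed.

Lemma img_U_open : open (to_U @` dom_U). Proof. by rewrite img_U; exact: openT. Qed.
Lemma img_V_open : open (to_V @` dom_V). Proof. by rewrite img_V; exact: openT. Qed.

Definition chart_U : chart T M3 := Chart dom_U_open img_U_open to_UK
  (within_continuous dom_U_open open_to_U) (continuous_subspaceT from_U_continuous).
Definition chart_V : chart T M3 := Chart dom_V_open img_V_open to_VK
  (within_continuous dom_V_open open_to_V) (continuous_subspaceT from_V_continuous).

Lemma glued_second_countable : @second_countable T.
Proof.
have [B cB [oB bB]] := second_countable_C3.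
exists [set if p.1 then dom_U `&` to_U @^-1` p.2 else dom_V `&` to_V @^-1` p.2
    | p in [set: bool] `*` B].
  by apply: sub_countable (card_image_le _ _) _; apply: countableX => //; exact: countableP.
split=> [_ [[[] b] /= [_ /oB ob] <-]|x A nA].
- exact: open_to_U.
- exact: open_to_V.
have [Ux|Vx] : dom_U x \/ dom_V x by case: x {nA} => [p|q]; [left|right].
  have nA' : nbhs (to_U x) (from_U @^-1` A) by apply: from_U_continuous; rewrite to_UK.
  have [b [Bb bx] bA] := bB (to_U x) _ nA'.
  exists (dom_U `&` to_U @^-1` b); first by split; [exists (true, b)|split].
  by move=> y [Uy /bA]; rewrite /= to_UK.
have nA' : nbhs (to_V x) (from_V @^-1` A) by apply: from_V_continuous; rewrite to_VK.
have [b [Bb bx] bA] := bB (to_V x) _ nA'.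
exists (dom_V `&` to_V @^-1` b); first by split; [exists (false, b)|split].
by move=> y [Vy /bA]; rewrite /= to_VK.
Qed.

Lemma open_disc : open [set p : M3 | nrm (crd0 p : C) < 1].
Proof.
rewrite openE => p /= p1.
have /cvg_nrm/(_ (1 - nrm (crd0 p : C)))[|d d0 H] :=
  differentiable_continuous (differentiable_crd0 p); first by rewrite subr_gt0.
apply/nbhs_nrm; exists d => // y /H h.
rewrite /= -[crd0 y](subrK (crd0 p)); apply: le_lt_trans (nrmD _ _) _.
by rewrite -ltrBrDr; exact: h.
Qed.

(** Two points in a common chart are separated there.  Otherwise one is a point of U with
    z = 0 and the other a point of V with xi = 0, and the sets |z| < 1 and |xi| < 1
    are disjoint since xi = 1 / z. *)
Lemma glued_hausdorff : hausdorff_space T.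
Proof.
rewrite open_hausdorff => x y xy.
have sep (d : set T) (f : T -> M3) : (forall O, open O -> open (d `&` f @^-1` O)) ->
    {in d &, injective f} -> d x -> d y ->
    exists2 AB, (x \in AB.1 /\ y \in AB.2) & [/\ open AB.1, open AB.2 & AB.1 `&` AB.2 == set0].
  move=> H inj dx dy; have fxy : f x != f y.
    by apply: contra_neq xy => /inj; apply; rewrite inE.
  have := @norm_hausdorff _ M3; rewrite open_hausdorff => /(_ _ _ fxy)[[A B] [/= xA yB] [oA oB AB]].
  exists (d `&` f @^-1` A, d `&` f @^-1` B) => /=.
    by rewrite inE in xA; rewrite inE in yB; split; rewrite inE.
  split; [exact: H|exact: H|]; apply/eqP; rewrite -subset0 => z [[_ Az] [_ Bz]].
  by have : (A `&` B) (f z) by []; rewrite (eqP AB).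
have injU : {in dom_U &, injective to_U}.
  by move=> u v; rewrite !inE => du dv E; rewrite -(to_UK du) E to_UK.
have injV : {in dom_V &, injective to_V}.
  by move=> u v; rewrite !inE => du dv E; rewrite -(to_VK du) E to_VK.
pose A := dom_U `&` to_U @^-1` [set p : M3 | nrm (crd0 p : C) < 1].
pose B := dom_V `&` to_V @^-1` [set p : M3 | nrm (crd0 p : C) < 1].
have oA : open A := open_to_U open_disc.
have oB : open B := open_to_V open_disc.
have AB : A `&` B = set0.
  rewrite -subset0 => -[p|q] [[//= _ p1] [p0]]; rewrite /preimage /= D_crd0// nrmV.
  have n0 : 0 < nrm (crd0 p : C) by exact: nrm_gt0.
  by rewrite invf_lt1// => p2; have := lt_trans p1 p2; rewrite ltxx.
have inA p : crd0 p = 0 -> A (inl p) by move=> p0; split => //=; rewrite p0 nrm0.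
have inB q : B (inr q) by case: q => a b; split => //=; rewrite crd0_C3 nrm0.
case: x y xy sep => [p|p] [q|q] xy sep.
- exact: (sep dom_U to_U open_to_U injU).
- have [p0|p0] := eqVneq (crd0 p) 0.
    exists (A, B); first by rewrite !inE; split; [exact: inA|exact: inB].
    by split => //=; apply/eqP.
  exact: (sep dom_V to_V open_to_V injV).
- have [q0|q0] := eqVneq (crd0 q) 0.
    exists (B, A); first by rewrite !inE; split; [exact: inB|exact: inA].
    by split => //=; rewrite setIC; apply/eqP.
  exact: (sep dom_V to_V open_to_V injV).
- exact: (sep dom_V to_V open_to_V injV).
Qed.

Lemma chart_compat c d : [set chart_U; chart_V] c -> [set chart_U; chart_V] d ->
  holo_compatible c d.
Proof.
have did p : differentiable (fun p : M3 => p) p by [].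
have UU x : dom_U x -> differentiable (to_U \o from_U) (to_U x).
  by move=> _; exact: did.
have VV x : dom_V x -> differentiable (to_V \o from_V) (to_V x).
  move=> _; have := did (to_V x); apply: differentiable_near_eq.
  by apply: filterE => p; rewrite /= from_VK.
have UV x : dom_U x -> dom_V x -> differentiable (to_V \o from_U) (to_U x).
  by case: x => [p|//] _ p0; exact: dD.
have VU x : dom_U x -> dom_V x -> differentiable (to_U \o from_V) (to_V x).
  case: x => [p|//] _ /= p0; have := dD (D_crd0_neq0 p0); apply: differentiable_near_eq.
  have [r r0 Hr] := (nbhs_nrm _ _).1 (near_crd0 (D_crd0_neq0 p0)).
  by apply/nbhs_nrm; exists r => // q /Hr q0; rewrite /from_V /= (negbTE q0).
by move=> [->|->] [->|->] x dx dx'; split; solve [exact: UU|exact: VV|exact: UV|exact: VU].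
Qed.

Lemma chart_cover x : exists2 c, [set chart_U; chart_V] c & cdom c x.
Proof. by case: x => [p|q]; [exists chart_U; [left|]|exists chart_V; [right|]]. Qed.

Definition glued_manifold : threefold R :=
  ComplexManifold glued_hausdorff glued_second_countable chart_cover chart_compat.

Lemma glued_manifold_glued : @glued R glued_manifold chart_U chart_V D.
Proof.
split.
- by split=> d Ad; apply: chart_compat => //; [left|right].
- by split; [exact: img_U|exact: img_V].
- by apply/seteqP; split => // -[p|q] _; [left|right].
- split; apply/seteqP; split.
  + by move=> _ [[p|q] [//= _ p0] <-].
  + by move=> p p0; exists (from_U p).
  + by move=> _ [[p|q] [//= _ p0] <-]; exact: D_crd0_neq0.
  + move=> p p0; exists (from_V p); last exact: from_VK.
    by split; [rewrite /= /from_V (negbTE p0)|exact: dom_from_V].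
- by move=> [p|q].
Qed.

End Topology.

(** The transition of W is holomorphic because it is the deformed gluing at t = 0. *)
Lemma W_exists k : exists W : threefold R, is_W k.+2 W.
Proof.
have h1 (p : M3) : crd0 p != 0 -> crd0 (W_transition k.+2 p) = (crd0 p)^-1.
  by move=> _; rewrite /W_transition crd0_C3.
have h2 (p : M3) : crd0 p != 0 -> differentiable (@W_transition R k.+2 : M3 -> M3) p.
  move=> p0; have d1 : differentiable (fun p : M3 => (p, 0 : C)) p.
    by apply: differentiable_pair => //; exact: differentiable_cst.
  have := differentiable_comp d1 (@df_gluing R k (fun=> 0) (fun z => df_cst z 0) (p, 0) p0).
  apply: differentiable_near_eq.
  have [r r0 Hr] := (nbhs_nrm _ _).1 (near_crd0 p0).
  apply/nbhs_nrm; exists r => // q /Hr q0; rewrite W_transitionE// /gluing /=.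
  by rewrite !mul0r !addr0.
exists (glued_manifold h1 (@W_transitionK R k) h2).
exists (chart_U h2), (chart_V h1 (@W_transitionK R k) h2); exact: glued_manifold_glued.
Qed.

End GluedSpace.

(** * Global holomorphic functions *)

Section HolomorphicFunctions.
Variable R : realType.
Local Notation C := (R[i]^o).
Local Notation M3 := ('rV[R[i]]_3 : normedModType R[i]).

Section Change.
Variables (T : topologicalType) (c d : chart T M3).
Hypothesis cd : holo_compatible c d.

Lemma change_chart (V : normedModType R[i]) (f : T -> V) x : cdom c x -> cdom d x ->
  differentiable (f \o cinv d) (cfun d x) -> differentiable (f \o cinv c) (cfun c x).
Proof.
move=> cx dx df.
have E : (cfun d \o cinv c) (cfun c x) = cfun d x by rewrite /= cfunK.
have df' : differentiable (f \o cinv d) ((cfun d \o cinv c) (cfun c x)) by rewrite E.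
have := differentiable_comp (cd cx dx).1 df'.
have nd : nbhs x (cdom d) by apply: open_nbhs_nbhs; split => //; exact: cdom_open.
apply: differentiable_near_eq.
have [r r0 Hr] := (nbhs_nrm _ _).1 (cinv_near cx nd).
by apply/nbhs_nrm; exists r => // p /Hr[cp dp]; rewrite /= cfunK.
Qed.

End Change.

Section Maps.
Variables X Y : threefold R.

Definition hol_fun (f : X -> C) := forall c, atlas c -> forall x, cdom c x ->
  differentiable (f \o cinv c) (cfun c x).

Lemma hol_fun_chart (f : X -> C) (c : chart X M3) x : holo_chart c -> hol_fun f ->
  cdom c x -> differentiable (f \o cinv c) (cfun c x).
Proof.
move=> hc hf cx; have [d ad dx] := atlas_cover x.
exact: (change_chart (hc d ad) cx dx (hf d ad x dx)).
Qed.

(** The definition of holomorphic maps mentions the charts of the atlases only; it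
    extends to all compatible charts. *)
Lemma holomorphic_chart (F : X -> Y) (c : chart X M3) (d : chart Y M3) x :
  holomorphic F -> holo_chart c -> holo_chart d -> cdom c x -> cdom d (F x) ->
  differentiable (cfun d \o F \o cinv c) (cfun c x).
Proof.
move=> [cF hF] hc hd cx dx; have [c0 ac0 c0x] := atlas_cover x.
have [d0 ad0 d0x] := atlas_cover (F x).
apply: (change_chart (f := cfun d \o F) (hc c0 ac0) cx c0x).
have h1 := hF c0 d0 ac0 ad0 x c0x d0x.
have h2 := (hd d0 ad0 (F x) dx d0x).2.
have E : (cfun d0 \o F \o cinv c0) (cfun c0 x) = cfun d0 (F x) by rewrite /= cfunK.
have h2' : differentiable (cfun d \o cinv d0) ((cfun d0 \o F \o cinv c0) (cfun c0 x)).
  by rewrite E.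
have := differentiable_comp h1 h2'; apply: differentiable_near_eq.
have nd : nbhs x (F @^-1` cdom d0).
  by apply: cF; apply: open_nbhs_nbhs; split => //; exact: cdom_open.
have [r r0 Hr] := (nbhs_nrm _ _).1 (cinv_near c0x nd).
by apply/nbhs_nrm; exists r => // p /Hr[cp dp]; rewrite /= cfunK.
Qed.

Lemma hol_fun_comp (F : X -> Y) (f : Y -> C) : holomorphic F ->
  (forall c, atlas c -> forall y, cdom c y -> differentiable (f \o cinv c) (cfun c y)) ->
  hol_fun (f \o F).
Proof.
move=> [cF hF] hf c ac x cx; have [d ad dx] := atlas_cover (F x).
have h1 := hF c d ac ad x cx dx.
have E : (cfun d \o F \o cinv c) (cfun c x) = cfun d (F x) by rewrite /= cfunK.
have h2 : differentiable (f \o cinv d) ((cfun d \o F \o cinv c) (cfun c x)).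
  by rewrite E; exact: hf.
have := differentiable_comp h1 h2; apply: differentiable_near_eq.
have nd : nbhs x (F @^-1` cdom d).
  by apply: cF; apply: open_nbhs_nbhs; split => //; exact: cdom_open.
have [r r0 Hr] := (nbhs_nrm _ _).1 (cinv_near cx nd).
by apply/nbhs_nrm; exists r => // p /Hr[cp dp]; rewrite /= cfunK.
Qed.

End Maps.

(** An equivalence relation defined by the complex structure alone, hence preserved by
    isomorphisms. *)
Definition unseparated (X : threefold R) (x y : X) := forall f, hol_fun f -> f x = f y.

Lemma unseparated_map (X Y : threefold R) (F : X -> Y) x y : holomorphic F ->
  unseparated x y -> unseparated (F x) (F y).
Proof. by move=> hF xy f hf; exact: xy _ (hol_fun_comp hF hf). Qed.

Section Glued.
Variables (X : threefold R) (cU cV : chart X M3) (g : M3 -> M3).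
Hypothesis gl : glued cU cV g.

Lemma glued_holoU : holo_chart cU. Proof. by case: gl => -[]. Qed.
Lemma glued_holoV : holo_chart cV. Proof. by case: gl => -[]. Qed.
Lemma glued_fullU : full cU. Proof. by case: gl => _ []. Qed.
Lemma glued_fullV : full cV. Proof. by case: gl => _ []. Qed.

Lemma glued_cover x : cdom cU x \/ cdom cV x.
Proof. by case: gl => _ _ UV _ _; have : [set: X] x by []; rewrite -UV. Qed.

Lemma glued_ovU y : cdom cU y -> (cdom cV y <-> crd0 (cfun cU y) != 0).
Proof. by case: gl => _ _ _ [ov _] _; exact: overlapP. Qed.

Lemma glued_ovV y : cdom cV y -> (cdom cU y <-> crd0 (cfun cV y) != 0).
Proof. by case: gl => _ _ _ [_ ov] _; apply: overlapP; rewrite setIC. Qed.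

Lemma glued_tr y : cdom cU y -> cdom cV y -> cfun cV y = g (cfun cU y).
Proof. by case: gl => _ _ _ _ h; exact: h. Qed.

Lemma glued_cinv p : crd0 p != 0 -> cinv cU p = cinv cV (g p).
Proof.
move=> p0; have Uy := full_dom p glued_fullU.
have Vy : cdom cV (cinv cU p) by apply/(glued_ovU Uy); rewrite full_K//; exact: glued_fullU.
by rewrite -(full_K p glued_fullU) -(glued_tr Uy Vy) full_K ?cfunK//; exact: glued_fullU.
Qed.

Lemma glued_hol_fun (f : X -> C) : (forall p, differentiable (f \o cinv cU) p) ->
  (forall p, differentiable (f \o cinv cV) p) -> hol_fun f.
Proof.
move=> fU fV c ac x cx; case: (glued_cover x) => dx.
  by apply: (change_chart (holo_compatibleC (glued_holoU ac)) cx dx).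
by apply: (change_chart (holo_compatibleC (glued_holoV ac)) cx dx).
Qed.

Lemma hol_funU (f : X -> C) p : hol_fun f -> differentiable (f \o cinv cU) p.
Proof.
move=> hf; have := hol_fun_chart glued_holoU hf (full_dom p glued_fullU).
by rewrite full_K//; exact: glued_fullU.
Qed.

Lemma hol_funV (f : X -> C) p : hol_fun f -> differentiable (f \o cinv cV) p.
Proof.
move=> hf; have := hol_fun_chart glued_holoV hf (full_dom p glued_fullV).
by rewrite full_K//; exact: glued_fullV.
Qed.

(** lU and lV parametrize a projective line in the two charts; by Liouville's theorem
    all holomorphic functions are constant on it. *)
Section Line.
Variables lU lV : C -> M3.
Hypotheses (dU : forall z, differentiable lU z) (dV : forall z, differentiable lV z).
Hypothesis lUV : forall z, z != 0 -> crd0 (lU z) != 0 /\ g (lU z) = lV z^-1.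

Lemma line_glued z : z != 0 -> cinv cU (lU z) = cinv cV (lV z^-1).
Proof. by move=> /lUV[z0 E]; rewrite glued_cinv// E. Qed.

Lemma line_unseparatedU z : unseparated (cinv cU (lU z)) (cinv cU (lU 0)).
Proof.
move=> f hf; apply: (@liouville_P1 R (fun z => f (cinv cU (lU z))) (fun z => f (cinv cV (lV z)))).
- by move=> w; exact: (differentiable_comp (dU w) (hol_funU _ hf)).
- by move=> w; exact: (differentiable_comp (dV w) (hol_funV _ hf)).
- by move=> w w0; rewrite line_glued.
Qed.

Lemma line_unseparatedV z : unseparated (cinv cV (lV z)) (cinv cU (lU 0)).
Proof.
move=> f hf; rewrite -(line_unseparatedU 1 hf) (line_glued (oner_neq0 _)) invr1.
have H w : f (cinv cV (lV w)) = f (cinv cV (lV 0)).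
  apply: (@liouville_P1 R (fun z => f (cinv cV (lV z))) (fun z => f (cinv cU (lU z)))).
  - by move=> v; exact: (differentiable_comp (dV v) (hol_funV _ hf)).
  - by move=> v; exact: (differentiable_comp (dU v) (hol_funU _ hf)).
  - by move=> v v0; rewrite line_glued ?invrK// invr_eq0.
by rewrite H (H 1).
Qed.

End Line.

Section GluedFunction.
Variables fU fV : M3 -> C.
Hypothesis fUV : forall p, crd0 p != 0 -> fU p = fV (g p).

Definition glued_fun (x : X) : C :=
  if pselect (cdom cU x) then fU (cfun cU x) else fV (cfun cV x).

Lemma glued_funU x : cdom cU x -> glued_fun x = fU (cfun cU x).
Proof. by move=> Ux; rewrite /glued_fun; case: pselect. Qed.

Lemma glued_funV x : cdom cV x -> glued_fun x = fV (cfun cV x).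
Proof.
move=> Vx; rewrite /glued_fun; case: pselect => // Ux.
by rewrite fUV ?glued_tr//; exact/(glued_ovU Ux).
Qed.

Lemma glued_fun_hol : (forall p, differentiable fU p) -> (forall p, differentiable fV p) ->
  hol_fun glued_fun.
Proof.
move=> dU dV; apply: glued_hol_fun => p.
  have := dU p; apply: differentiable_near_eq; apply: filterE => s.
  by rewrite /= glued_funU ?full_K//; [exact: glued_fullU|exact: full_dom glued_fullU].
have := dV p; apply: differentiable_near_eq; apply: filterE => s.
by rewrite /= glued_funV ?full_K//; [exact: glued_fullV|exact: full_dom glued_fullV].
Qed.

End GluedFunction.
End Glued.
End HolomorphicFunctions.

(** * The points of X_n not separated by holomorphic functions *)

Section Separation.
Variable R : realType.
Local Notation C := (R[i]^o).
Local Notation M3 := ('rV[R[i]]_3 : normedModType R[i]).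
Variables (k : nat) (q : C -> C).
Hypothesis dq : forall z, differentiable q z.

(** The gluing of the fiber over t = 1. *)
Definition gluing1 (p : M3) : M3 := gluing k q (p, 1).

(** Four holomorphic functions w, c, b, a, each in the two charts.  They are u1,
    z^k u1 + u2, z times it, and v1; the terms with q in the formulas make them
    polynomial on both sides. *)
Definition invwU (p : M3) : C := crd1 p.
Definition invwV (p : M3) : C := crd0 p ^+ k.+2 * crd1 p - crd2 p.
Definition invcU (p : M3) : C := crd0 p ^+ k * crd1 p + crd2 p.
Definition invcV (p : M3) : C := crd0 p ^+ 2 * crd1 p - crd0 p * q (invwV p).
Definition invbU (p : M3) : C := crd0 p * invcU p.
Definition invbV (p : M3) : C := crd0 p * crd1 p - q (invwV p).
Definition invaU (p : M3) : C := crd0 p ^+ 2 * invcU p + crd0 p * q (crd1 p).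
Definition invaV (p : M3) : C := crd1 p.

Lemma gluing1E (p : M3) : crd0 p != 0 -> let z := crd0 p in
  gluing1 p = C3 z^-1 (z ^+ 2 * invcU p + z * q (crd1 p))
                 ((z ^+ k)^-1 * (crd2 p + z^-1 * q (crd1 p))).
Proof.
move=> p0; rewrite /gluing1 /gluing /=.
have -> : crd0 p ^+ k.+2 = crd0 p * (crd0 p * crd0 p ^+ k) by rewrite !exprS.
have h : crd0 p ^+ k != 0 by rewrite expf_neq0.
rewrite /invcU; move: (crd0 p) p0 h (crd1 p) (crd2 p) (q _) => z z0 Z0 u v Q.
by congr C3; field; rewrite ?Z0 ?z0.
Qed.

Lemma invw_glued (p : M3) : crd0 p != 0 -> invwU p = invwV (gluing1 p).
Proof.
move=> p0; rewrite gluing1E// /invwU /invwV !crdE /invcU exprVn.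
have -> : crd0 p ^+ k.+2 = crd0 p * (crd0 p * crd0 p ^+ k) by rewrite !exprS.
have h : crd0 p ^+ k != 0 by rewrite expf_neq0.
move: (crd0 p) p0 h (crd1 p) (crd2 p) (q _) => z z0 Z0 u v Q.
by field; rewrite ?z0 ?Z0.
Qed.

Lemma invc_glued (p : M3) : crd0 p != 0 -> invcU p = invcV (gluing1 p).
Proof.
move=> p0; rewrite /invcV -invw_glued// gluing1E// !crdE /invwU.
move: (invcU p) (q _) (crd0 p) p0 => c Q z z0.
by field; rewrite z0.
Qed.

Lemma invb_glued (p : M3) : crd0 p != 0 -> invbU p = invbV (gluing1 p).
Proof.
move=> p0; rewrite /invbV -invw_glued// gluing1E// !crdE /invwU /invbU.
move: (invcU p) (q _) (crd0 p) p0 => c Q z z0.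
by field; rewrite z0.
Qed.

Lemma inva_glued (p : M3) : crd0 p != 0 -> invaU p = invaV (gluing1 p).
Proof. by move=> p0; rewrite /invaV gluing1E// !crdE. Qed.

Ltac diff_rules3 :=
  repeat first
    [ exact: df_cst | exact: differentiable_crd0 | exact: differentiable_crd1
    | exact: differentiable_crd2
    | apply: dfX | apply: dfB | apply: dfD | apply: dfM | (apply: (df_comp dq)) ].

Lemma df_invwV (p : M3) : differentiable invwV p. Proof. by rewrite /invwV; diff_rules3. Qed.
Lemma df_invcU (p : M3) : differentiable invcU p. Proof. by rewrite /invcU; diff_rules3. Qed.
Lemma df_invcV (p : M3) : differentiable invcV p. Proof. by rewrite /invcV /invwV; diff_rules3. Qed.
Lemma df_invbU (p : M3) : differentiable invbU p. Proof. by rewrite /invbU /invcU; diff_rules3. Qed.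
Lemma df_invbV (p : M3) : differentiable invbV p. Proof. by rewrite /invbV /invwV; diff_rules3. Qed.
Lemma df_invaU (p : M3) : differentiable invaU p. Proof. by rewrite /invaU /invcU; diff_rules3. Qed.

Variables (X : threefold R) (cU cV : chart X M3).
Hypothesis gl : glued cU cV gluing1.

Definition invw : X -> C := glued_fun cU cV invwU invwV.
Definition invc : X -> C := glued_fun cU cV invcU invcV.
Definition invb : X -> C := glued_fun cU cV invbU invbV.
Definition inva : X -> C := glued_fun cU cV invaU invaV.

Lemma hol_invw : hol_fun invw.
Proof. exact: (glued_fun_hol gl invw_glued (@differentiable_crd1 R) df_invwV). Qed.
Lemma hol_invc : hol_fun invc.
Proof. exact: (glued_fun_hol gl invc_glued df_invcU df_invcV). Qed.
Lemma hol_invb : hol_fun invb.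
Proof. exact: (glued_fun_hol gl invb_glued df_invbU df_invbV). Qed.
Lemma hol_inva : hol_fun inva.
Proof. exact: (glued_fun_hol gl inva_glued df_invaU (@differentiable_crd1 R)). Qed.

Lemma invariantsU x : cdom cU x -> [/\ invw x = invwU (cfun cU x), invc x = invcU (cfun cU x),
  invb x = invbU (cfun cU x) & inva x = invaU (cfun cU x)].
Proof. by move=> Ux; split; exact: glued_funU. Qed.

Lemma invariantsV x : cdom cV x -> [/\ invw x = invwV (cfun cV x), invc x = invcV (cfun cV x),
  invb x = invbV (cfun cV x) & inva x = invaV (cfun cV x)].
Proof.
move=> Vx; split; [exact: (glued_funV gl invw_glued)|exact: (glued_funV gl invc_glued)
  |exact: (glued_funV gl invb_glued)|exact: (glued_funV gl inva_glued)].
Qed.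

(** The union of the projective lines over the roots of q. *)
Definition exceptional (x : X) := [/\ q (invw x) = 0, invc x = 0 & inva x = 0].

Lemma cfun_inj (c : chart X M3) x y : cdom c x -> cdom c y -> cfun c x = cfun c y -> x = y.
Proof. by move=> cx cy E; rewrite -(cfunK cx) E cfunK. Qed.

(** If the coordinates z differ while w, c, b and a agree, then b = z c forces c = 0 and
    a = z^2 c + z q(w) forces q(w) = 0. *)
Lemma separate_UU (p p' : M3) : p <> p' -> invwU p = invwU p' -> invcU p = invcU p' ->
  invbU p = invbU p' -> invaU p = invaU p' ->
  [/\ q (invwU p) = 0, invcU p = 0 & invaU p = 0].
Proof.
move=> npp' Ew Ec Eb Ea.
have zz : crd0 p - crd0 p' != 0.
  rewrite subr_eq0; apply: contra_notN npp' => /eqP zz; rewrite -[p]C3_crd -[p']C3_crd.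
  congr C3 => //; move: Ec; rewrite /invcU zz; rewrite /invwU in Ew; rewrite Ew.
  exact: addrI.
have c0 : invcU p = 0.
  apply/eqP; rewrite -(mulrI_eq0 _ (mulfI zz)) mulrBl subr_eq0; apply/eqP.
  by rewrite -[LHS]/(invbU p) Eb /invbU Ec.
have q0 : q (invwU p) = 0.
  apply/eqP; rewrite -(mulrI_eq0 _ (mulfI zz)) mulrBl subr_eq0; apply/eqP.
  move: Ea; rewrite /invaU -Ec c0 !mulr0 !add0r.
  by rewrite -[crd1 p]/(invwU p) -[crd1 p']/(invwU p') -Ew.
by split => //; rewrite /invaU c0 mulr0 add0r -[crd1 p]/(invwU p) q0 mulr0.
Qed.

(** In V, with coordinates (xi, v1, v2) and a = v1, the roles are exchanged:
    b = xi a - q(w) forces a = 0, then c = xi^2 a - xi q(w) forces q(w) = 0. *)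
Lemma separate_VV (p p' : M3) : p <> p' -> invwV p = invwV p' -> invcV p = invcV p' ->
  invbV p = invbV p' -> invaV p = invaV p' ->
  [/\ q (invwV p) = 0, invcV p = 0 & invaV p = 0].
Proof.
move=> npp' Ew Ec Eb Ea.
have zz : crd0 p - crd0 p' != 0.
  rewrite subr_eq0; apply: contra_notN npp' => /eqP zz; rewrite -[p]C3_crd -[p']C3_crd.
  congr C3 => //; move: Ew; rewrite /invwV zz; rewrite /invaV in Ea; rewrite Ea.
  by move/addrI/oppr_inj.
have a0 : invaV p = 0.
  apply/eqP; rewrite -(mulrI_eq0 _ (mulfI zz)) mulrBl subr_eq0; apply/eqP.
  move: Eb; rewrite /invbV Ew => /addIr; rewrite -[crd1 p]/(invaV p).
  by rewrite -[crd1 p']/(invaV p') -Ea.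
have q0 : q (invwV p) = 0.
  apply/eqP; rewrite -(mulrI_eq0 _ (mulfI zz)) mulrBl subr_eq0; apply/eqP.
  move: Ec; rewrite /invcV -[crd1 p]/(invaV p) -[crd1 p']/(invaV p') -Ea a0 !mulr0 !sub0r.
  by move/oppr_inj; rewrite -Ew.
by split => //; rewrite /invcV -[crd1 p]/(invaV p) a0 q0 !mulr0 subr0.
Qed.

(** A point with z = 0 and a point with xi = 0: b vanishes at the first one and is
    -q(w) at the second. *)
Lemma separate_UV (p p' : M3) : crd0 p = 0 -> crd0 p' = 0 -> invwU p = invwV p' ->
  invcU p = invcV p' -> invbU p = invbV p' -> invaU p = invaV p' ->
  [/\ q (invwU p) = 0, invcU p = 0 & invaU p = 0].
Proof.
move=> z0 z0' Ew Ec Eb Ea; split.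
- rewrite Ew; apply/eqP; rewrite -oppr_eq0; apply/eqP.
  by move: Eb; rewrite /invbU /invbV z0 z0' !mul0r sub0r => <-.
- by rewrite Ec /invcV z0' expr0n/= !mul0r subr0.
- by rewrite /invaU z0 expr0n/= !mul0r addr0.
Qed.

Lemma unseparated_exceptional x y : unseparated x y -> x <> y -> exceptional x.
Proof.
have UV u v : unseparated u v -> cdom cU u -> ~ cdom cV u -> cdom cV v -> ~ cdom cU v ->
    exceptional u.
  move=> uv Uu nVu Vv nUv.
  move: (uv _ hol_invw) (uv _ hol_invc) (uv _ hol_invb) (uv _ hol_inva).
  rewrite /exceptional; have [-> -> -> ->] := invariantsU Uu; have [-> -> -> ->] := invariantsV Vv.
  apply: separate_UV; apply/eqP; apply/negP => /negP h.
    by apply: nVu; exact/(glued_ovU gl Uu).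
  by apply: nUv; exact/(glued_ovV gl Vv).
move=> xy nxy; have [Ux|nUx] := pselect (cdom cU x).
  have [Uy|nUy] := pselect (cdom cU y).
    have nU : cfun cU x <> cfun cU y by move/(cfun_inj Ux Uy).
    move: (xy _ hol_invw) (xy _ hol_invc) (xy _ hol_invb) (xy _ hol_inva).
    rewrite /exceptional; have [-> -> -> ->] := invariantsU Ux; have [-> -> -> ->] := invariantsU Uy.
    exact: separate_UU.
  have Vy : cdom cV y by case: (glued_cover gl y).
  have [Vx|nVx] := pselect (cdom cV x); last exact: UV xy _ _ _ _.
  have nV : cfun cV x <> cfun cV y by move/(cfun_inj Vx Vy).
  move: (xy _ hol_invw) (xy _ hol_invc) (xy _ hol_invb) (xy _ hol_inva).
  rewrite /exceptional; have [-> -> -> ->] := invariantsV Vx; have [-> -> -> ->] := invariantsV Vy.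
  exact: separate_VV.
have Vx : cdom cV x by case: (glued_cover gl x).
have [Vy|nVy] := pselect (cdom cV y).
  have nV : cfun cV x <> cfun cV y by move/(cfun_inj Vx Vy).
  move: (xy _ hol_invw) (xy _ hol_invc) (xy _ hol_invb) (xy _ hol_inva).
  rewrite /exceptional; have [-> -> -> ->] := invariantsV Vx; have [-> -> -> ->] := invariantsV Vy.
  exact: separate_VV.
have Uy : cdom cU y by case: (glued_cover gl y).
have yx : unseparated y x by move=> f hf; rewrite (xy f hf).
have [h1 h2 h3] := UV _ _ yx Uy nVy Vx nUx.
by split; rewrite ?(xy _ hol_invw) ?(xy _ hol_invc) ?(xy _ hol_inva).
Qed.

(** The projective line over the root i of q. *)
Definition lineU (i : C) (z : C) : M3 := C3 z i (- (z ^+ k * i)).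
Definition lineV (i : C) (z : C) : M3 := C3 z 0 (- i).

Lemma df_lineU i z : differentiable (lineU i) z.
Proof.
apply: differentiable_C3; first exact: (df_id z); first exact: df_cst.
have -> : (fun x : C => - (x ^+ k * i) : C) = (fun x => 0 - x ^+ k * i).
  by apply/funext => x; rewrite sub0r.
exact: (dfB (df_cst z 0) (dfM (dfX k (df_id z)) (df_cst z i))).
Qed.

Lemma df_lineV i z : differentiable (lineV i) z.
Proof.
by apply: differentiable_C3; [exact: (df_id z)|exact: df_cst|exact: df_cst].
Qed.

Lemma line_gluing i z : q i = 0 -> z != 0 ->
  crd0 (lineU i z) != 0 /\ gluing1 (lineU i z) = lineV i z^-1.
Proof.
move=> qi z0; split; rewrite ?gluing1E /lineU ?crdE//.
have h : z ^+ k != 0 by rewrite expf_neq0.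
rewrite qi /invcU !crdE /lineV; congr C3; first by ring.
move: (z ^+ k) h => Z Z0; field; by rewrite ?Z0 ?z0.
Qed.

(** An exceptional point lies on the line over its own value of w. *)
Lemma exceptional_line x : exceptional x -> unseparated x (cinv cU (lineU (invw x) 0)).
Proof.
case=> q0 c0 a0; have lg := fun z => @line_gluing (invw x) z q0.
case: (glued_cover gl x) => dx.
  have := line_unseparatedU gl (df_lineU _) (df_lineV _) lg (crd0 (cfun cU x)).
  suff -> : lineU (invw x) (crd0 (cfun cU x)) = cfun cU x by rewrite cfunK.
  have [Ew Ec _ _] := invariantsU dx; move: c0; rewrite Ec Ew /invcU /invwU => c0.
  rewrite /lineU -[RHS]C3_crd; congr C3.
  by apply/eqP; rewrite eq_sym -subr_eq0 opprK addrC c0.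
have := line_unseparatedV gl (df_lineU _) (df_lineV _) lg (crd0 (cfun cV x)).
suff -> : lineV (invw x) (crd0 (cfun cV x)) = cfun cV x by rewrite cfunK.
have [Ew _ _ Ea] := invariantsV dx; move: a0; rewrite Ea Ew /invaV /invwV => a0.
by rewrite /lineV -[RHS]C3_crd a0 mulr0 sub0r opprK.
Qed.

Lemma invw_line i z : invw (cinv cU (lineU i z)) = i.
Proof.
have Ud := full_dom (lineU i z) (glued_fullU gl).
have [-> _ _ _] := invariantsU Ud; rewrite full_K; last exact: glued_fullU gl.
by rewrite /invwU crdE.
Qed.

Lemma lineU_inj i z z' : lineU i z = lineU i z' -> z = z'.
Proof. by move=> h; rewrite -[z](crd0_C3 z i (- (z ^+ k * i))) -/(lineU i z) h crd0_C3. Qed.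

Lemma cinv_inj (c : chart X M3) p p' : full c -> cinv c p = cinv c p' -> p = p'.
Proof. by move=> fc h; rewrite -(full_K p fc) h full_K. Qed.

Lemma line_unseparated i : q i = 0 ->
  unseparated (cinv cU (lineU i 1)) (cinv cU (lineU i 0)) /\
  cinv cU (lineU i 1) <> cinv cU (lineU i 0).
Proof.
move=> qi; split; first exact: (line_unseparatedU gl (df_lineU _) (df_lineV _) (fun z => line_gluing qi)).
move=> h; exact: (elimN eqP (oner_neq0 R[i]) (lineU_inj (cinv_inj (glued_fullU gl) h))).
Qed.

End Separation.

(** * Pairwise non-isomorphic deformations *)

Section Distinct.
Variable R : realType.
Local Notation C := (R[i]^o).
Local Notation M3 := ('rV[R[i]]_3 : normedModType R[i]).
Variable k : nat.

Lemma natc_inj (i j : nat) : (i%:R : C) = j%:R -> i = j.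
Proof. by move=> h; apply/eqP; rewrite -(eqr_nat R[i]); apply/eqP. Qed.

Lemma unseparated_sym (X : threefold R) (x y : X) : unseparated x y -> unseparated y x.
Proof. by move=> h f hf; rewrite (h f hf). Qed.

Lemma unseparated_trans (X : threefold R) (x y z : X) :
  unseparated x y -> unseparated y z -> unseparated x z.
Proof. by move=> h h' f hf; rewrite (h f hf) (h' f hf). Qed.

(** On the line over each root i of the first polynomial take the points z = 0 and
    z = 1.  They are unseparated and distinct, so F maps them to an exceptional point,
    over a root s i of the second polynomial.  If s i = s j, the images are on the same
    line, hence unseparated, and so are the points themselves; then w gives i = j. *)
Lemma fewer_roots (m n : nat) (X Y : threefold R) (cU cV : chart X M3) (dU dV : chart Y M3)
    (F : X -> Y) (G : Y -> X) :
  glued cU cV (gluing1 k (@root_poly R m)) -> glued dU dV (gluing1 k (@root_poly R n)) ->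
  holomorphic F -> holomorphic G -> cancel F G -> (m <= n)%N.
Proof.
move=> glX glY hF hG FG.
pose x i : X := cinv cU (lineU k (i%:R : C) 0).
pose wY : Y -> C := invw k dU dV.
have rX i : (i < m)%N -> root_poly m (i%:R : C) = 0 by exact: root_poly_root.
have ex i : (i < m)%N -> exceptional k (@root_poly R n) dU dV (F (x i)).
  move=> im; have [us ne] := line_unseparated glX (rX i im).
  exact: (unseparated_exceptional (@df_root_poly R n) glY
    (unseparated_map hF (unseparated_sym us)) (fun E => ne (esym (can_inj FG E)))).
have sg (i : 'I_m) : exists j : 'I_n, wY (F (x i)) = (j : nat)%:R.
  have [q0 _ _] := ex i (ltn_ord i).
  by have [j jn E] := root_poly_eq0 q0; exists (Ordinal jn).
have [s sE] := choice sg.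
have sI : injective s.
  move=> i j sij; apply/val_inj/natc_inj.
  have EF : wY (F (x i)) = wY (F (x j)) by rewrite !sE sij.
  have ui := exceptional_line glY (ex i (ltn_ord i)).
  have uj := exceptional_line glY (ex j (ltn_ord j)).
  have uij : unseparated (F (x i)) (F (x j)).
    apply: unseparated_trans ui _; rewrite -/(wY _) EF; exact: unseparated_sym uj.
  have := unseparated_map hG uij (hol_invw glX).
  by rewrite !FG /x !(invw_line glX).
by have := leq_card s sI; rewrite !card_ord.
Qed.

Lemma roots_not_biholomorphic (m n : nat) (X Y : threefold R) (cU cV : chart X M3)
    (dU dV : chart Y M3) :
  glued cU cV (gluing1 k (@root_poly R m)) -> glued dU dV (gluing1 k (@root_poly R n)) ->
  m <> n -> ~ biholomorphic X Y.
Proof.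
move=> glX glY mn [F [G [FG GF hF hG]]]; apply: mn; apply/eqP.
by rewrite eqn_leq (fewer_roots glX glY hF hG FG) (fewer_roots glY glX hG hF GF).
Qed.

(** The surface u1 = 0 of W is covered by the projective lines u2 = c, that is,
    v2 = c xi^k. *)
Section OriginalW.
Variables (W : threefold R) (cU cV : chart W M3).
Hypothesis gl : glued cU cV (@W_transition R k.+2).

Definition wlineU (c z : C) : M3 := C3 z 0 c.
Definition wlineV (c z : C) : M3 := C3 z 0 (c * z ^+ k).

Lemma df_wlineU c z : differentiable (wlineU c) z.
Proof.
by apply: differentiable_C3; [exact: (df_id z)|exact: df_cst|exact: df_cst].
Qed.

Lemma df_wlineV c z : differentiable (wlineV c) z.
Proof.
apply: differentiable_C3; [exact: (df_id z)|exact: df_cst|].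
exact: (dfM (df_cst z c) (dfX k (df_id z))).
Qed.

Lemma wline_gluing c z : z != 0 ->
  crd0 (wlineU c z) != 0 /\ W_transition k.+2 (wlineU c z) = wlineV c z^-1.
Proof.
move=> z0; rewrite /wlineU crdE; split => //; rewrite W_transitionE crdE// !crdE mulr0.
have h : z ^+ k != 0 by rewrite expf_neq0.
rewrite /wlineV exprVn !exprS; congr C3.
by move: (z ^+ k) h => Z Z0; field; by rewrite ?Z0 ?z0.
Qed.

Lemma W_unseparated c z : exists2 y, unseparated (cinv cU (wlineU c z)) y & cinv cU (wlineU c z) <> y.
Proof.
have us z' : unseparated (cinv cU (wlineU c z')) (cinv cU (wlineU c 0)).
  exact: (line_unseparatedU gl (df_wlineU c) (df_wlineV c) (fun z => @wline_gluing c z)).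
exists (cinv cU (wlineU c (z + 1))).
  exact: unseparated_trans (us z) (unseparated_sym (us (z + 1))).
move=> h; have := congr1 (@crd0 R) (cinv_inj (glued_fullU gl) h).
rewrite !crd0_C3 => E; apply: (elimN eqP (oner_neq0 R[i])).
by apply: (addrI z); rewrite addr0.
Qed.

End OriginalW.
End Distinct.

(** * The deformation X_1 is not isomorphic to W *)

Section DerivativeAlongLines.
Variable R : realType.
Local Notation C := (R[i]^o).
Local Notation M3 := ('rV[R[i]]_3 : normedModType R[i]).

Lemma diff_line0 (V W : normedModType R[i]) (f : V -> W) (x v : V) : differentiable f x ->
  (\forall h \near (0 : C), f (x + h *: v) = 0) -> 'd f x v = 0.
Proof.
move=> df f0; have E0 : x + (0 : C) *: v = x by rewrite scale0r addr0.
have df0 : differentiable f (x + (0 : C) *: v) by rewrite E0.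
have [dg dgE] := diff_line df0.
have [d d0 Hd] := (nbhs_nrm _ _).1 f0.
have Hd0 (u : C) : nrm u < d -> f (x + u *: v) = 0 by move=> ud; apply: Hd; rewrite subr0.
have [| | |_ E2] := @nrm_diff_fun _ _ _ (fun z : C => f (x + z *: v)) 0 (fun=> 0) 0.
- by move=> a h h'; rewrite scaler0 addr0.
- by move=> h; rewrite mul0r nrm0.
- move=> e e0; exists d => // u ud; rewrite add0r Hd0// Hd0 ?nrm0// !subr0 nrm0.
  by rewrite mulr_ge0 ?nrm_ge0// ltW.
have E3 := congr1 (fun F : C -> W => F 1) E2.
exact: (etrans (esym (congr1 (fun y => 'd f y v) E0)) (etrans (esym dgE) E3)).
Qed.

Lemma diff_comp_linear (V W U : normedModType R[i]) (f : V -> W) (L : {linear W -> U}) x v :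
  continuous L -> differentiable f x -> 'd (L \o f) x v = L ('d f x v).
Proof.
move=> cL df; have dL : differentiable L (f x) by exact: linear_differentiable.
have E : 'd (L \o f) x = 'd L (f x) \o 'd f x :> (V -> U) := diff_comp df dL.
have EL : 'd L (f x) = L :> (W -> U) := @diff_lin _ _ _ L (f x) cL.
exact: (etrans (congr1 (fun F : V -> U => F v) E) (congr1 (fun F : W -> U => F ('d f x v)) EL)).
Qed.

Lemma crd1_linear : linear (@crd1 R : M3 -> C).
Proof. by move=> a u v; rewrite /crd1 !mxE. Qed.
Lemma crd2_linear : linear (@crd2 R : M3 -> C).
Proof. by move=> a u v; rewrite /crd2 !mxE. Qed.

Definition crd1L : {linear M3 -> C} :=
  HB.pack_for {linear M3 -> C} (@crd1 R : M3 -> C) (GRing.isLinear.Build _ _ _ _ _ crd1_linear).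
Definition crd2L : {linear M3 -> C} :=
  HB.pack_for {linear M3 -> C} (@crd2 R : M3 -> C) (GRing.isLinear.Build _ _ _ _ _ crd2_linear).

Lemma crd1_continuous : continuous crd1L.
Proof. by move=> x; exact: (differentiable_continuous (differentiable_crd1 x)). Qed.
Lemma crd2_continuous : continuous crd2L.
Proof. by move=> x; exact: (differentiable_continuous (differentiable_crd2 x)). Qed.

Lemma diff_axis (f : M3 -> M3) (x v : M3) : differentiable f x ->
  (\forall h \near (0 : C), crd1 (f (x + h *: v)) = 0 /\ crd2 (f (x + h *: v)) = 0) ->
  exists a : C, 'd f x v = a *: C3 1 0 0.
Proof.
move=> df ax; exists (crd0 ('d f x v)).
have E1 : crd1 ('d f x v) = 0.
  have h := @diff_line0 _ _ (crd1L \o f) x v (differentiable_comp df (differentiable_crd1 (f x)))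
    (filterS (fun h => @proj1 _ _) ax).
  exact: (etrans (esym (diff_comp_linear v crd1_continuous df)) (h _)).
have E2 : crd2 ('d f x v) = 0.
  have h := @diff_line0 _ _ (crd2L \o f) x v (differentiable_comp df (differentiable_crd2 (f x)))
    (filterS (fun h => @proj2 _ _) ax).
  exact: (etrans (esym (diff_comp_linear v crd2_continuous df)) (h _)).
move: ('d f x v) E1 E2 => w E1 E2.
by rewrite -[w in LHS]C3_crd C3E E1 E2 !scale0r !addr0.
Qed.

Lemma linear_not_axis (L : {linear M3 -> M3}) (a b : C) : injective L ->
  L (C3 1 0 0) = a *: C3 1 0 0 -> L (C3 0 0 1) = b *: C3 1 0 0 -> False.
Proof.
move=> inj Ea Eb; have zz w : L w = 0 -> w = 0 by move=> h; apply: inj; rewrite h linear0.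
have /zz h0 : L (b *: C3 1 0 0 - a *: C3 0 0 1) = 0.
  by rewrite linearB !linearZ/= Ea Eb scalerN !scalerA (mulrC b a) subrr.
have a0 : a = 0.
  have := congr1 (@crd2 R) h0; rewrite /crd2 !mxE /= mulr1 mulr0 sub0r => /eqP.
  by rewrite oppr_eq0 => /eqP.
have e0 : L (C3 1 0 0) = 0 by rewrite Ea a0 scale0r.
have := congr1 (@crd0 R) (zz _ e0); rewrite crd0_C3 /crd0 mxE => h.
exact: (elimN eqP (oner_neq0 R[i]) h).
Qed.

(** A map with a local left inverse has an injective differential, so it cannot send
    the plane u1 = const., of dimension 2, into the axis. *)
Lemma plane_not_axis (f g : M3 -> M3) (x : M3) : differentiable f x ->
  differentiable g (f x) -> (\forall y \near x, g (f y) = y) ->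
  ~ (\forall y \near x, crd1 y = crd1 x -> crd1 (f y) = 0 /\ crd2 (f y) = 0).
Proof.
move=> df dg gf ax.
have near_line v : crd1 v = 0 ->
    \forall h \near (0 : C), crd1 (f (x + h *: v)) = 0 /\ crd2 (f (x + h *: v)) = 0.
  move=> v1; have [d d0 Hd] := (nbhs_nrm _ _).1 ax.
  have n0 := nrm_ge0 v; have n1 : 0 < nrm v + 1 by rewrite ltr_wpDl.
  apply/nbhs_nrm; exists (d / (nrm v + 1)); first by rewrite divr_gt0.
  move=> h; rewrite subr0 ltr_pdivlMr// => hd; apply: Hd.
    rewrite addrAC subrr add0r nrmZ; apply: le_lt_trans hd.
    by apply: ler_wpM2l; rewrite ?nrm_ge0// lerDl.
  by rewrite -[crd1 (x + _)]/(crd1L (x + _)) linearD linearZ/= v1 scaler0 addr0.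
have [|a Ea] := @diff_axis f x (C3 1 0 0) df _; first by apply: near_line; rewrite crd1_C3.
have [|b Eb] := @diff_axis f x (C3 0 0 1) df _; first by apply: near_line; rewrite crd1_C3.
exact: (linear_not_axis (can_inj (diff_left_inverse df dg gf)) Ea Eb).
Qed.

End DerivativeAlongLines.

Section WDistinct.
Variable R : realType.
Local Notation C := (R[i]^o).
Local Notation M3 := ('rV[R[i]]_3 : normedModType R[i]).
Variable k : nat.

(** The points of W with u1 = 0 are unseparated from others, so their images are
    exceptional.  As q(w) = w for X_1, the exceptional points form the single line
    which is the axis of each of the two charts. *)
Lemma W_not_biholomorphic (W X : threefold R) (cU cV : chart W M3) (dU dV : chart X M3) :
  glued cU cV (@W_transition R k.+2) -> glued dU dV (gluing1 k (@root_poly R 1)) ->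
  ~ biholomorphic W X.
Proof.
move=> glW glX [F [G [FG GF hF hG]]].
have dq := @df_root_poly R 1.
have ex p : crd1 p = 0 -> exceptional k (@root_poly R 1) dU dV (F (cinv cU p)).
  move=> p0; have -> : p = wlineU (crd2 p) (crd0 p) by rewrite -[LHS]C3_crd p0.
  have [y us ne] := W_unseparated glW (crd2 p) (crd0 p).
  exact: (unseparated_exceptional dq glX (unseparated_map hF us) (fun E => ne (can_inj FG E))).
have w0 p : crd1 p = 0 -> invw k dU dV (F (cinv cU p)) = 0.
  move=> /ex[q0 _ _]; have [j] := root_poly_eq0 q0.
  by rewrite ltnS leqn0 => /eqP -> ->.
have exU p : crd1 p = 0 -> cdom dU (F (cinv cU p)) ->
    crd1 (cfun dU (F (cinv cU p))) = 0 /\ crd2 (cfun dU (F (cinv cU p))) = 0.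
  move=> p0 /(invariantsU k (@root_poly R 1) dV)[Ew Ec _ _].
  have := ex p p0; have := w0 p p0; rewrite /exceptional Ew Ec /invcU /invwU => u0 [_ + _].
  by rewrite u0 mulr0 add0r.
have exV p : crd1 p = 0 -> cdom dV (F (cinv cU p)) ->
    crd1 (cfun dV (F (cinv cU p))) = 0 /\ crd2 (cfun dV (F (cinv cU p))) = 0.
  move=> p0 /(invariantsV glX)[Ew _ _ Ea].
  have := ex p p0; have := w0 p p0; rewrite /exceptional Ew Ea /invaV /invwV => v0 [_ _ u0].
  by move: v0; rewrite u0 mulr0 sub0r => /eqP; rewrite oppr_eq0 => /eqP.
have p0 : crd1 (0 : M3) = 0 :> C by rewrite /crd1 mxE.
pose x0 := cinv cU (0 : M3); have Ux0 : cdom cU x0 by exact: full_dom (glued_fullU glW).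
have main (d : chart X M3) : holo_chart d -> full d -> cdom d (F x0) ->
    (forall p, crd1 p = 0 -> cdom d (F (cinv cU p)) ->
      crd1 (cfun d (F (cinv cU p))) = 0 /\ crd2 (cfun d (F (cinv cU p))) = 0) -> False.
  move=> hd fd dx0 exd.
  pose f := cfun d \o F \o cinv cU; pose g := cfun cU \o G \o cinv d.
  have cx0 : cfun cU x0 = 0 by exact: full_K (glued_fullU glW).
  have df : differentiable f (0 : M3).
    by have := holomorphic_chart hF (glued_holoU glW) hd Ux0 dx0; rewrite cx0.
  have f0 : f 0 = cfun d (F x0) by [].
  have dg : differentiable g (f 0).
    rewrite f0; apply: (holomorphic_chart hG hd (glued_holoU glW) dx0).
    by rewrite FG.
  have nd : nbhs x0 (F @^-1` cdom d).
    by apply: (hF.1); apply: open_nbhs_nbhs; split => //; exact: cdom_open.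
  have := cinv_near Ux0 nd; rewrite cx0 => N.
  have [r r0 Hr] := (nbhs_nrm _ _).1 N.
  apply: (@plane_not_axis R f g 0 df dg).
    apply/nbhs_nrm; exists r => // p /Hr[cp dp].
    by rewrite /g /f /= cfunK// FG full_K//; exact: (glued_fullU glW).
  apply/nbhs_nrm; exists r => // p /Hr[cp dp]; rewrite p0 => pp.
  exact: exd p pp dp.
case: (glued_cover glX (F x0)) => dx.
  exact: (main dU (glued_holoU glX) (glued_fullU glX) dx exU).
exact: (main dV (glued_holoV glX) (glued_fullV glX) dx exV).
Qed.

End WDistinct.

(** * Vector bundles of splitting type 2 on X_1 *)

Section Moduli.
Variable R : realType.
Local Notation C := (R[i]^o).
Local Notation M3 := ('rV[R[i]]_3 : normedModType R[i]).

(** The derivative at s = 0, by the product rule, of an identity of the shape of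
    [entry01] restricted to a line. *)
Lemma diff_product_identity (alpha f g : C -> C) (c d e : C) :
  differentiable alpha (0 : C) -> differentiable f (0 : C) -> differentiable g (0 : C) ->
  (forall s, alpha s * (c * s) + d * f s = e * g s) ->
  alpha 0 * c + d * 'd f 0 (1 : C) = e * 'd g 0 (1 : C).
Proof.
move=> da df dg E.
have EF : alpha * (c \*: (id : C -> C)) + d \*: f = e \*: g :> (C -> C) by apply/funext => s; exact: E.
have Da := derivableP (diff_derivable (v := (1 : C)) da).
have Df := derivableP (diff_derivable (v := (1 : C)) df).
have Dg := derivableP (diff_derivable (v := (1 : C)) dg).
have Di := is_derive_id (0 : C) (1 : C).
have D1 := is_deriveD (is_deriveM Da (is_deriveZ c Di)) (is_deriveZ d Df).
have D2 := is_deriveZ e Dg.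
have H : alpha 0 *: (c *: (1 : C)) + (c \*: (id : C -> C)) 0 *: 'D_1 alpha 0 + d *: 'D_1 f 0 = e *: 'D_1 g 0.
  by rewrite -(@derive_val _ _ _ _ _ _ _ D1) -(@derive_val _ _ _ _ _ _ _ D2) EF.
have fin (x y x' y' D : C) : x = x' -> y = y' ->
    alpha 0 *: (c *: (1 : C)) + (c *: (0 : C)) *: D + d *: x = e *: y ->
    alpha 0 * c + d * x' = e * y'.
  by move=> -> ->; rewrite scaler0 scale0r addr0 -[c *: 1]/(c * 1) mulr1.
exact: (fin _ _ _ _ _ (deriveE (1 : C) df) (deriveE (1 : C) dg) H).
Qed.

Definition axis (z : C) : M3 := C3 z 0 0.

Lemma axis_line z s a b : axis z + s *: C3 0 a b = C3 z (s * a) (s * b).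
Proof.
by apply/rowP => -[[|[|[|//]]] h]; rewrite !mxE /= ?mulr0 ?addr0 ?add0r.
Qed.

Section Partial.
Variable f : M3 -> C.
Hypothesis df : forall p, differentiable f p.

Definition partial (v : M3) (z : C) : C := 'd f (axis z) v.

Lemma df_axis z : differentiable axis z.
Proof.
by apply: differentiable_C3; [exact: (df_id z)|exact: df_cst|exact: df_cst].
Qed.

Lemma df_partial v z : differentiable (partial v) z.
Proof.
have h : \forall y \near axis z, differentiable f y by apply: filterE.
have h1 : differentiable (fun z : C => (axis z, v)) z.
  by apply: differentiable_pair; [exact: df_axis|exact: differentiable_cst].
exact: (differentiable_comp h1 (@diff_diff R M3 f (axis z) v h)).
Qed.

Lemma df_axis_line v z : differentiable (fun s : C => f (axis z + s *: v)) 0 /\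
  'd (fun s : C => f (axis z + s *: v)) 0 (1 : C) = partial v z.
Proof.
have [h1 h2] := diff_line (df (axis z + 0 *: v)); split; first exact: h1.
have E : axis z + (0 : C) *: v = axis z by rewrite scale0r addr0.
exact: (etrans h2 (congr1 (fun y => 'd f y v) E)).
Qed.

Lemma partial_lin a b z : partial (C3 0 a b) z = a * partial (C3 0 1 0) z + b * partial (C3 0 0 1) z.
Proof.
rewrite /partial; have L (l : {linear M3 -> C}) : l (C3 0 a b) = a * l (C3 0 1 0) + b * l (C3 0 0 1).
  by rewrite C3E scale0r add0r linearD !linearZ.
exact: (L ('d f (axis z))).
Qed.

End Partial.

Local Notation M2 := ('M[R[i]]_2 : normedModType R[i]).
Lemma df_entry (A : M3 -> M2) i j p : differentiable A p ->
  differentiable (fun x => A x i j : C) p.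
Proof.
move=> dA; have dc : differentiable (fun N : M2 => N i j : C) (A p) by exact: differentiable_coord.
exact: (differentiable_comp dA dc).
Qed.

Lemma class_zu2 (x : M3) : first_order_class 0 ('X%:P : {poly {poly R[i]}}) x = crd0 x * crd2 x.
Proof. by rewrite /first_order_class /laurent_eval !horner0 hornerC hornerX mul0r add0r. Qed.

Lemma class_0 (x : M3) : first_order_class (0 : {poly {poly R[i]}}) 0 x = 0.
Proof. by rewrite /first_order_class /laurent_eval !horner0 !mul0r addr0. Qed.

(** Frame changes A over U and A' over V that intertwine the bundle of the class z u2
    with the split one.  Of the gluing g only the values on the line and, to first
    order, in the direction u2 along it enter. *)
Section Obstruction.
Variables (k : nat) (g : M3 -> M3) (A A' : M3 -> 'M[R[i]]_2).
Hypothesis g_axis : forall z, z != 0 -> g (axis z) = axis z^-1.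
Hypothesis g_line : forall z s : C, z != 0 ->
  g (axis z + s *: C3 0 0 1) = axis z^-1 + s *: C3 0 (z ^+ 2) (z ^- k).
Hypotheses (dA : forall x, differentiable A x /\ A x \in unitmx)
  (dA' : forall x, differentiable A' x).
Hypothesis AA' : forall x, crd0 x != 0 ->
  A' (g x) *m ext_matrix 2 (fun x => crd0 x * crd2 x) x = ext_matrix 2 (fun=> 0) x *m A x.

Let a x : C := A x 0 0.
Let b x : C := A x 0 1.
Let a' x : C := A' x 0 0.
Let b' x : C := A' x 0 1.

Let da x : differentiable a x. Proof. exact: df_entry (dA x).1. Qed.
Let db x : differentiable b x. Proof. exact: df_entry (dA x).1. Qed.
Let da' x : differentiable a' x. Proof. exact: df_entry (dA' x). Qed.
Let db' x : differentiable b' x. Proof. exact: df_entry (dA' x). Qed.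

Lemma entry00 x : crd0 x != 0 -> a' (g x) = a x.
Proof.
move=> x0; have := congr1 (fun M : 'M[R[i]]_2 => M 0 0) (AA' x0).
rewrite !mxE !big_ord_recl !big_ord0 !mxE /= mulr0 mul0r !addr0 mulrC.
by apply: mulfI; rewrite expf_neq0.
Qed.

Lemma entry01 x : crd0 x != 0 ->
  a' (g x) * (crd0 x * crd2 x) + b' (g x) * crd0 x ^- 2 = crd0 x ^+ 2 * b x.
Proof.
move=> x0; have := congr1 (fun M : 'M[R[i]]_2 => M 0 1) (AA' x0).
rewrite !mxE !big_ord_recl !big_ord0 !mxE /= !mul0r !addr0.
by have -> : lift ord0 ord0 = 1 :> 'I_2 by exact: val_inj.
Qed.

Lemma axis0 z : z != 0 -> crd0 (axis z) != 0.
Proof. by rewrite /axis crd0_C3. Qed.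

(** On the line z^4 b(z) = b'(1/z) is a global function, hence constant, and it vanishes
    at z = 0. *)
Lemma b_axis1 : b (axis 1) = 0.
Proof.
have H := @liouville_P1 R (fun z => z ^+ 4 * b (axis z)) (fun z => b' (axis z)).
have := H _ _ _ 1; rewrite expr1n mul1r expr0n/= mul0r; apply.
- move=> z; exact: (dfM (dfX 4 (df_id z)) (differentiable_comp (df_axis z) (db _))).
- by move=> z; exact: (differentiable_comp (df_axis z) (db' _)).
- move=> z z0; have := entry01 (axis0 z0); rewrite g_axis// /axis crd0_C3 crd2_C3 !mulr0 add0r -/(axis z^-1) -/(axis z).
  move: (b' _) (b _) => u v E.
  have -> : u = z ^+ 2 * (u * z ^- 2) by field.
  by rewrite E mulrA -exprD.
Qed.

Lemma a_axis z : a (axis z) = a (axis 0).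
Proof.
apply: (@liouville_P1 R (fun z => a (axis z)) (fun z => a' (axis z))).
- by move=> w; exact: (differentiable_comp (df_axis w) (da _)).
- by move=> w; exact: (differentiable_comp (df_axis w) (da' _)).
- by move=> w w0; rewrite -entry00 ?axis0// g_axis.
Qed.

(** Otherwise the first row of A would vanish at the point z = 1. *)
Lemma a_axis0 : a (axis 0) != 0.
Proof.
rewrite -(a_axis 1); apply/eqP => a0.
have [_] := dA (axis 1); rewrite unitmxE (expand_det_row _ 0) big1 ?unitr0// => j _.
have -> : A (axis 1) 0 j = 0; last by rewrite mul0r.
case: j => -[|[|//]] h.
  by rewrite -[RHS]a0 /a; congr (A _ _ _); exact: val_inj.
by rewrite -[RHS]b_axis1 /b; congr (A _ _ _); exact: val_inj.
Qed.

(** The derivative of [entry01] at the points of the line, in the direction u2. *)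
Lemma entry01_diff z : z != 0 ->
  a (axis z) * z + z ^- 2 * (z ^+ 2 * partial b' (C3 0 1 0) z^-1 + z ^- k * partial b' (C3 0 0 1) z^-1)
    = z ^+ 2 * partial b (C3 0 0 1) z.
Proof.
move=> z0; rewrite -partial_lin.
have [d1 E1] := df_axis_line db (C3 0 0 1) z.
have [d2 _] := df_axis_line da (C3 0 0 1) z.
have [d3 E3] := df_axis_line db' (C3 0 (z ^+ 2) (z ^- k)) z^-1.
have D := @diff_product_identity _ _ _ z (z ^- 2) (z ^+ 2) d2 d3 d1.
have P s : a (axis z + s *: C3 0 0 1) * (z * s) +
    z ^- 2 * b' (axis z^-1 + s *: C3 0 (z ^+ 2) (z ^- k)) = z ^+ 2 * b (axis z + s *: C3 0 0 1).
  have p0 : crd0 (axis z + s *: C3 0 0 1) != 0 by rewrite axis_line crd0_C3.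
  have := entry01 p0; rewrite entry00// g_line//.
  by rewrite axis_line crd0_C3 crd2_C3 mulr1 => <-; rewrite [b' _ * _]mulrC.
have fin (a0 a1 x y x' y' : C) : a0 = a1 -> x = x' -> y = y' ->
    a0 * z + z ^- 2 * x = z ^+ 2 * y -> a1 * z + z ^- 2 * x' = z ^+ 2 * y'.
  by move=> -> -> ->.
apply: (fin _ _ _ _ _ _ _ E3 E1 (D P)).
by congr (a _); rewrite scale0r addr0.
Qed.

(** By [entry01_diff], z^2 g(z) - a0 z = h(1/z) with g and h entire; so both sides are
    constant, equal to their value 0 at z = 0.  Then z g(z) is the constant a0, which is
    0 for the same reason. *)
Lemma no_intertwiner : False.
Proof.
have H z : z ^+ 2 * partial b (C3 0 0 1) z - a (axis 0) * z = 0.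
  have L := @liouville_P1 R (fun z => z ^+ 2 * partial b (C3 0 0 1) z - a (axis 0) * z)
    (fun w => partial b' (C3 0 1 0) w + w ^+ k.+2 * partial b' (C3 0 0 1) w).
  rewrite L; first by rewrite expr0n /= mul0r mulr0 subrr.
  - move=> w; exact: (dfB (dfM (dfX 2 (df_id w)) (df_partial db _ w)) (dfM (df_cst w _) (df_id w))).
  - move=> w; exact: (dfD (df_partial db' _ w) (dfM (dfX k.+2 (df_id w)) (df_partial db' _ w))).
  - move=> w w0; rewrite -entry01_diff// a_axis addrC addKr exprVn.
    have h : w ^+ k != 0 by rewrite expf_neq0.
    move: (partial _ _ _) (partial _ _ _) => x y; rewrite !exprS.
    by field; rewrite ?h ?w0.
have H2 z : z * partial b (C3 0 0 1) z = 0.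
  rewrite (@liouville_P1 R (fun z => z * partial b (C3 0 0 1) z) (fun=> a (axis 0))).
  - by rewrite mul0r.
  - move=> w; exact: (dfM (df_id w) (df_partial db _ w)).
  - by move=> w; exact: differentiable_cst.
  - move=> w w0; apply: (mulfI w0); move/eqP: (H w); rewrite subr_eq0 => /eqP E.
    by rewrite [RHS]mulrC -E mulrA -expr2.
have := H 1; rewrite expr1n H2 sub0r mulr1 => /eqP; rewrite oppr_eq0.
by rewrite (negbTE a_axis0).
Qed.

End Obstruction.

Lemma root_poly1 (w : C) : root_poly 1 w = w.
Proof. by rewrite /root_poly big_ord_recl big_ord0 mulr1 /= subr0. Qed.

Lemma nontrivial_moduli1 k : nontrivial_moduli (gluing1 k (@root_poly R 1)) 2.
Proof.
exists 0, 'X%:P, 0, 0 => -[A [A' [dA dA' AA']]].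
apply: (@no_intertwiner k (gluing1 k (@root_poly R 1)) A A') => //.
- move=> z z0; rewrite gluing1E /axis /invcU !crdE// root_poly1; congr C3; ring.
- move=> z s z0; rewrite !axis_line gluing1E /invcU !crdE// root_poly1; congr C3; rewrite ?exprVn; ring.
- by move=> x; exact: (dA' x).1.
- move=> x x0; rewrite -[RHS]/(ext_matrix 2 _ x *m A x).
  have -> : (fun x : M3 => crd0 x * crd2 x) = first_order_class 0 'X%:P.
    by apply/funext => y; rewrite class_zu2.
  have -> : (fun _ : M3 => 0) = first_order_class (0 : {poly {poly R[i]}}) 0.
    by apply/funext => y; rewrite class_0.
  exact: AA'.
Qed.

End Moduli.

(** * The deformations of W *)

(** The fiber over t = 1 of the family of the polynomial with roots 0, ..., n - 1. *)
Lemma W_deformation (R : realType) (k n : nat) (W : threefold R) : is_W k.+2 W ->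
  exists X : threefold R, deformation W X /\
    exists cU cV : chart X 'rV[R[i]]_3, glued cU cV (gluing1 k (@root_poly R n)).
Proof.
move=> [cU [cV gl]].
have UV := glued_cover gl; have fU := glued_fullU gl; have fV := glued_fullV gl.
have hU := glued_holoU gl; have hV := glued_holoV gl.
have [ovU ovV] : cfun cU @` (cdom cU `&` cdom cV) = [set x | crd0 x != 0] /\
    cfun cV @` (cdom cU `&` cdom cV) = [set x | crd0 x != 0] by case: gl.
have tr := glued_tr gl.
have dq := @df_root_poly R n.
case: W cU cV gl UV fU fV hU hV ovU ovV tr => T hs sc At cov comp /= cU cV gl UV fU fV hU hV ovU ovV tr.
have lUV := linkedUV dq ovU tr; have lVU := linkedVU dq ovU ovV tr.
exists (fiber_manifold hs sc fU fV UV lUV lVU 1); split.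
  exact: (fiber_deformation hs sc fU fV UV lUV lVU cov comp hU hV (twistA0 k dq) (twistB0 k dq) 1).
exists (slice fU (twistA k dq) 1), (slice fV (twistB k dq) 1).
exact: fiber_glued.
Qed.

Theorem corollary2p22 (R : realType) (k : nat) (hk : (2 <= k)%N) :
  (exists W : threefold R, is_W k W) /\
  forall W : threefold R, is_W k W ->
  exists X : nat -> threefold R,
    [/\ forall n, deformation W (X n),
        forall m n, m <> n -> ~ biholomorphic (X m) (X n) &
        exists n, ~ biholomorphic W (X n) /\ supports_nontrivial_moduli (X n)].
Proof.
case: k hk => [|[|k]] // _; split; first exact: W_exists.
move=> W isW; have [X HX] := choice (fun n => W_deformation n isW).
exists X; split.
- by move=> n; have [] := HX n.
- move=> m n mn; have [_ [cU [cV glm]]] := HX m; have [_ [dU [dV gln]]] := HX n.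
  exact: (roots_not_biholomorphic glm gln mn).
exists 1%N; have [_ [dU [dV gl1]]] := HX 1%N; split.
  by have [cU [cV glW]] := isW; exact: (W_not_biholomorphic glW gl1).
exists dU, dV, (gluing1 k (@root_poly R 1)); split => //.
- by move=> x x0; rewrite gluing1E// crd0_C3.
- move=> z z0; rewrite gluing1E /invcU !crdE// root_poly1.
  by congr C3; ring.
by exists 2%N; exact: nontrivial_moduli1.
Qed.
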